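(* Let $(X_p,T_p,\mu_q)$, $q\in(0,1/a_0)$, be a polynomial adic system and let $g$ be a cylindric function of rank $N$. Then: (a) if $g$ is not cohomologous to a constant in $L^\infty(X_p,\mu_q)$, then for $\mu_q$-a.e. $x$ there is a sequence of positive integers $l_n=l_n(x)\to\infty$ with $R^g_{x,l_n}>0$ such that $\varphi^g_{x,l_n}$ converges uniformly on $[0,1]$ to a continuous function (i.e. a limiting curve exists); (b) if $g$ is cohomologous to a constant in $L^\infty(X_p,\mu_q)$, then for $\mu_q$-a.e. $x$ there is no such sequence $l_n\to\infty$.
   Context: Let $p(x)=a_0+a_1x+\dots+a_dx^d$, $d\ge1$, all $a_i$ positive integers. The diagram $B_p$ has vertices $(n,k)$, $n\ge0$, $0\le k\le nd$; for every $n,k$ and $0\le j\le d$, $(n,k)$ and $(n+1,k+j)$ are joined by $a_j$ edges (edges of type $j$). Edges entering a vertex are linearly ordered canonically: first the $a_d$ edges of type $d$, then those of type $d-1$, ..., last the $a_0$ edges of type $0$ (parallel edges in a fixed order). $X_p$ is the set of infinite paths $x=(x_1,x_2,\dots)$ from $(0,0)$. Paths agreeing from some index on are compared by: $x\prec y$ iff at the largest index $i$ with $x_i\ne y_i$, $x_i$ precedes $y_i$. $T_p x$ is the successor of $x$. For $q\in(0,1/a_0)$ let $t_q\in(0,1)$ be the unique solution of $a_0q^d+a_1q^{d-1}t+\dots+a_dt^d=q^{d-1}$; $\mu_q$ is the product measure under which the $x_n$ are independent and every edge of type $j$ has probability $t_q^j/q^{j-1}$ (it is $T_p$-invariant and ergodic).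 A cylindric function of rank $N$ is constant on every cylinder $\{x:x_1=c_1,\dots,x_N=c_N\}$. For $x$ and integer $j\ge0$, $S^g_x(j)=\sum_{k=0}^{j-1}g(T_p^kx)$, $F^g_x$ is its piecewise-linear interpolation on $[0,\infty)$, $R^g_{x,l}=\max_{t\in[0,1]}|F^g_x(tl)-tF^g_x(l)|$ and, if $R^g_{x,l}>0$, $\varphi^g_{x,l}(t)=(F^g_x(tl)-tF^g_x(l))/R^g_{x,l}$. $g$ is cohomologous to a constant in $L^\infty$ if $g=c+h\circ T_p-h$ a.e. for some $c\in\mathbb R$, $h\in L^\infty$. *)

(* Defs.v *)
From Stdlib Require Import Reals List ClassicalEpsilon ZArith.
Open Scope R_scope.

(* An edge of B_p is encoded by (type j, index m) with m < a_j; together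
   with the path it belongs to this determines the diagram edge (the source
   vertex at level n is (n, vtx x n)).  Paths are indexed from 0:
   x i is the paper's x_{i+1}, edge from level i to level i+1. *)
Definition edge : Type := (nat * nat)%type.
Definition path : Type := nat -> edge.

Definition valid_edge (d : nat) (a : nat -> nat) (e : edge) : Prop :=
  (fst e <= d)%nat /\ (snd e < a (fst e))%nat.

(* X_p : every such sequence is a path from (0,0) (k stays in [0, n d]). *)
Definition valid_path (d : nat) (a : nat -> nat) (x : path) : Prop :=
  forall i, valid_edge d a (x i).

Fixpoint vtx (x : path) (n : nat) : nat :=
  match n with
  | O => O
  | S n' => (vtx x n' + fst (x n'))%nat
  end.

Definition edge_prec (e f : edge) : Prop :=
  (fst f < fst e)%nat \/ (fst e = fst f /\ (snd e < snd f)%nat).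

(* x precedes y: they coincide (as diagram edges) from some index on, and at
   the largest index i of disagreement x_i precedes y_i. *)
Definition path_prec (x y : path) : Prop :=
  exists i, x i <> y i /\ (forall k, (i < k)%nat -> x k = y k)
            /\ vtx x (S i) = vtx y (S i) /\ edge_prec (x i) (y i).

Definition is_succ (d : nat) (a : nat -> nat) (x y : path) : Prop :=
  valid_path d a y /\ path_prec x y /\
  forall z, valid_path d a z -> ~ (path_prec x z /\ path_prec z y).

(* T_p x : the successor of x (arbitrary if x has none, e.g. x maximal) *)
Definition Tp (d : nat) (a : nat -> nat) (x : path) : path :=
  epsilon (inhabits x) (fun y => is_succ d a x y).

Fixpoint Ssum (T : path -> path) (g : path -> R) (x : path) (j : nat) : R :=
  match j with
  | O => 0
  | S j' => Ssum T g x j' + g (Nat.iter j' T x)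
  end.

Definition Fg (T : path -> path) (g : path -> R) (x : path) (s : R) : R :=
  let n := Z.to_nat (Int_part s) in
  Ssum T g x n + (s - INR n) * g (Nat.iter n T x).

Definition dev (T : path -> path) (g : path -> R) (x : path) (l : nat) (s : R) : R :=
  Fg T g x (s * INR l) - s * Fg T g x (INR l).

Definition is_R (T : path -> path) (g : path -> R) (x : path) (l : nat) (r : R) : Prop :=
  (forall s, 0 <= s <= 1 -> Rabs (dev T g x l s) <= r) /\
  (exists s, 0 <= s <= 1 /\ Rabs (dev T g x l s) = r).

Definition phi (T : path -> path) (g : path -> R) (x : path) (l : nat) (r s : R) : R :=
  dev T g x l s / r.

Definition limit_curve_exists (T : path -> path) (g : path -> R) (x : path) : Prop :=
  exists (l : nat -> nat) (Rs : nat -> R) (f : R -> R),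
    (forall n, (0 < l n)%nat) /\
    (forall M, exists N0, forall n, (N0 <= n)%nat -> (M <= l n)%nat) /\
    (forall n, is_R T g x (l n) (Rs n) /\ 0 < Rs n) /\
    (forall s, 0 <= s <= 1 -> forall eps, 0 < eps -> exists delta, 0 < delta /\
        forall s', 0 <= s' <= 1 -> Rabs (s' - s) < delta -> Rabs (f s' - f s) < eps) /\
    (forall eps, 0 < eps -> exists N0, forall n, (N0 <= n)%nat ->
        forall s, 0 <= s <= 1 -> Rabs (phi T g x (l n) (Rs n) s - f s) < eps).

(* ---- the measure mu_q (via its outer measure from cylinders) ---- *)
(* probability of an edge of type j : t^j / q^(j-1) = q (t/q)^j *)
Definition pe (q t : R) (e : edge) : R := q * (t / q) ^ (fst e).

Definition weight (q t : R) (c : list edge) : R :=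
  fold_right (fun e acc => pe q t e * acc) 1 c.

Definition cyl (c : list edge) (x : path) : Prop :=
  forall i, (i < length c)%nat -> x i = nth i c (O, O).

(* mu_q^*(A) <= r *)
Definition OM_le (d : nat) (a : nat -> nat) (q t : R) (A : path -> Prop) (r : R) : Prop :=
  forall eps, 0 < eps -> exists cs : nat -> list edge,
    (forall x, valid_path d a x -> A x -> exists n, cyl (cs n) x) /\
    (forall M, sum_f_R0 (fun n => weight q t (cs n)) M <= r + eps).

Definition ae (d : nat) (a : nat -> nat) (q t : R) (P : path -> Prop) : Prop :=
  OM_le d a q t (fun x => ~ P x) 0.

(* Caratheodory (= mu_q-completion) measurability *)
Definition cmeas (d : nat) (a : nat -> nat) (q t : R) (E : path -> Prop) : Prop :=
  forall A r, OM_le d a q t A r -> exists r1 r2, r1 + r2 <= r /\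
    OM_le d a q t (fun x => A x /\ E x) r1 /\ OM_le d a q t (fun x => A x /\ ~ E x) r2.

Definition Linf (d : nat) (a : nat -> nat) (q t : R) (h : path -> R) : Prop :=
  (forall c, cmeas d a q t (fun x => h x < c)) /\
  exists B, ae d a q t (fun x => Rabs (h x) <= B).

Definition cohom_const (d : nat) (a : nat -> nat) (q t : R) (g : path -> R) : Prop :=
  exists (c : R) (h : path -> R), Linf d a q t h /\
    ae d a q t (fun x => g x = c + h (Tp d a x) - h x).

Definition cylindric (d : nat) (a : nat -> nat) (g : path -> R) (N : nat) : Prop :=
  forall x y, valid_path d a x -> valid_path d a y ->
    (forall i, (i < N)%nat -> x i = y i) -> g x = g y.

(* Main.v *)
(** With w = t/q, the prefixes ending at (n,k) form a tower of height h(n,k) =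
    [X^k] p^n, and the sums of g along the towers are H(n,k) = [X^k] G p^(n-N),
    where G has the level-N sums as coefficients.

    If G = c p^N, then g - c sums to zero over each level-N tower and its
    partial sums inside these towers are a bounded transfer function.
    Conversely, if g = c + h o T - h, then S_j - jc is bounded; for a uniform
    limit of the phi to be continuous at 0 all the S_j - jc must vanish, which
    is incompatible with R > 0.

    Otherwise let s be the mean of g on the tower of (n,k) and Gam = G - s p^N.
    Put z = X - w.  Since z^(2A) p^n has weighted l^1 norm O(n^(-A) p(w)^n), the
    coefficients of Gam z^l p^n for l < 2A determine, up to such a remainder,
    all the Gam f p^n, in particular the sums over the towers m levels below,
    which come out smaller by a factor rho^m.  They cannot all be negligible:
    X p d/dX costs only a factor n by integration by parts, and a few
    applications of it to X (p G' - N p' G), which is nonzero because G is not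
    a multiple of p^N, give a polynomial not vanishing at w, so that [X^k] p^n
    itself would be too small at vertices where h(n,k) >= n^(-3) p(w)^n w^(-k);
    by Borel-Cantelli almost every path eventually runs through such vertices
    only.  Hence the normalized curves attached to the levels n at which the
    path ends with many minimal edges are equicontinuous, and Arzela-Ascoli
    yields a limiting curve. *)

Require Import Defs.
From Stdlib Require Import Reals List ClassicalEpsilon ZArith.
From Stdlib Require Import Lia Lra FunctionalExtensionality.
From mathcomp Require all_boot all_order all_algebra ring lra zify Rstruct.
Open Scope R_scope.

(** The size of the normalizing deviation is not known in advance, so nothing is estimated
    absolutely: the largest deviation D over the tower serves as the unit. Sums over subtowers at
    depth M are differences of two values of the curve, hence at most 2 D, and this is propagated to
    K rho^m D at depth m. The propagation stops at depth n/2, beyond which the remainder n^(-A)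
    could deteriorate; there D is at least a constant times n^(-A) p(w)^n w^(-k), which beats the
    heights exponentially, so that bounding g - s trivially is enough. The mean s changes with the
    vertex, so every constant has to be uniform in |s| <= gm, and the differential operator is
    chosen to eliminate s. Finally T only moves forward: a path sees the deviation D of its tower
    only if it starts early in it, which is what the minimal edges ensure. What remains is
    deterministic, and the measure enters only through null sets. *)

(** * Recursions and estimates shared by the polynomial part and the dynamical part *)

Definition conv (d : nat) (a : nat -> nat) (f : nat -> R) (k : nat) : R :=
  sum_f_R0 (fun j => if (j <=? k)%nat then INR (a j) * f (k - j)%nat else 0) d.

Definition p_at (d : nat) (a : nat -> nat) (w : R) : R :=
  sum_f_R0 (fun j => INR (a j) * w ^ j) d.

(** Towers are built from lists, the estimates from polynomials; this recursion and the next are all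
    that either side knows of the other. *)
Definition height_array (d : nat) (a : nat -> nat) (h : nat -> nat -> R) : Prop :=
  (forall k, h O k = if (k =? 0)%nat then 1 else 0) /\
  (forall n k, h (S n) k = conv d a (h n) k).

(** The recursion starts at level N, from which on g depends only on the word and a tower sum is the
    total of its subtower sums. *)
Definition sum_array (d : nat) (a : nat -> nat) (N : nat) (H : nat -> nat -> R) : Prop :=
  (forall k, (N * d < k)%nat -> H N k = 0) /\
  (forall n k, (N <= n)%nat -> H (S n) k = conv d a (H n) k).

(* The exponent 3 makes the complement summable: q^n w^k h(n,k) is the
   probability that the path passes through (n,k), and p0 = 1/q. *)
Definition good_vertex (p0 w : R) (h : nat -> nat -> R) (n k : nat) : Prop :=
  p0 ^ n / w ^ k <= INR (S n) ^ 3 * h n k.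

(* [H - s h] are the sums of g - s over the towers m levels below (n,k). *)
Definition decay_statement (d N : nat) (p0 w gm : R) (h H : nat -> nat -> R) : Prop :=
  exists (K rho : R) (M n0 : nat), 0 <= K /\ 0 < rho < 1 /\
  forall n k s D, (n0 <= n)%nat -> good_vertex p0 w h n k -> Rabs s <= gm ->
   (M + N <= n)%nat /\
   ((forall i, (i <= M * d)%nat -> (i <= k)%nat ->
       Rabs (H (n - M)%nat (k - i)%nat - s * h (n - M)%nat (k - i)%nat) <= 2 * D) ->
    0 < D /\
    (forall m i, (M <= m)%nat -> (m + m <= n)%nat -> (i <= m * d)%nat -> (i <= k)%nat ->
       Rabs (H (n - m)%nat (k - i)%nat - s * h (n - m)%nat (k - i)%nat) <= K * rho ^ m * D) /\
    (forall m i, (n <= 4 * m)%nat -> (m <= n)%nat -> (i <= m * d)%nat -> (i <= k)%nat ->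
       h (n - m)%nat (k - i)%nat <= K * rho ^ m * D)).

(** Subtowers m levels down occupy a fixed fraction of the tower; this yields the modulus of
    continuity. *)
Definition ratio_statement (d : nat) (p0 w : R) (h : nat -> nat -> R) : Prop :=
  forall m, exists (C : R) (n0 : nat), 0 < C /\ forall n k i, (n0 <= n)%nat ->
    good_vertex p0 w h n k -> (i <= m * d)%nat -> h n k <= C * h (n - m)%nat (k - i)%nat.

(** Forces the lengths l_n to infinity. *)
Definition large_statement (p0 w : R) (h : nat -> nat -> R) : Prop :=
  forall B, exists n0 : nat, forall n k, (n0 <= n)%nat -> good_vertex p0 w h n k -> B <= h n k.

Module Coefficients.
Import all_boot all_order all_algebra Rstruct.
Import ring lra zify.
Import Order.TTheory GRing.Theory Num.Theory.
Set Implicit Arguments.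
Unset Strict Implicit.
Local Open Scope ring_scope.

(** * Weighted norm of (X - w) p^n *)

Section Norm.
Context {F : realFieldType}.
Variable w : F.
Hypothesis w0 : 0 < w.
Implicit Types f g : {poly F}.

Definition nrm f : F := \sum_(i < size f) `|f`_i| * w ^+ i.

Lemma nrm_wide f n : (size f <= n)%N -> nrm f = \sum_(i < n) `|f`_i| * w ^+ i.
Proof.
move=> le; rewrite /nrm (big_ord_widen _ (fun i => `|f`_i| * w ^+ i) le) big_mkcond /=.
apply: eq_bigr => i _; case: ltnP => // h; by rewrite nth_default // normr0 mul0r.
Qed.

Lemma nrm_ge0 f : 0 <= nrm f.
Proof. by apply: sumr_ge0 => i _; rewrite mulr_ge0 // exprn_ge0 // ltW. Qed.

Lemma nrm_coef f k : `|f`_k| * w ^+ k <= nrm f.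
Proof.
case: (ltnP k (size f)) => h; last by rewrite nth_default // normr0 mul0r nrm_ge0.
rewrite /nrm (bigD1 (Ordinal h)) //= lerDl.
by apply: sumr_ge0 => i _; rewrite mulr_ge0 // exprn_ge0 // ltW.
Qed.

Lemma nrmD f g : nrm (f + g) <= nrm f + nrm g.
Proof.
pose n := maxn (size f) (size g).
rewrite (nrm_wide (f:=f+g) (n:=n)) ?size_polyD // (nrm_wide (f:=f) (n:=n)) ?leq_maxl //.
rewrite (nrm_wide (f:=g) (n:=n)) ?leq_maxr // -big_split /=.
apply: ler_sum => i _; rewrite coefD -mulrDl ler_wpM2r ?ler_normD //.
by rewrite exprn_ge0 // ltW.
Qed.

Lemma nrmZ c f : nrm (c *: f) = `|c| * nrm f.
Proof.
rewrite (nrm_wide (f:=c *: f) (n:=size f)) ?size_scale_leq // /nrm mulr_sumr.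
by apply: eq_bigr => i _; rewrite coefZ normrM mulrA.
Qed.

Lemma nrmXM f : nrm ('X * f) = w * nrm f.
Proof.
rewrite mulrC (nrm_wide (f:= f * 'X) (n:=(size f).+1)); last first.
  by rewrite (leq_trans (size_polyMleq _ _)) // size_polyX addn2.
rewrite big_ord_recl coefMX /= normr0 mul0r add0r /nrm mulr_sumr.
by apply: eq_bigr => i _; rewrite coefMX /= exprS mulrCA.
Qed.

Lemma nrm0 : nrm 0 = 0.
Proof. by rewrite /nrm size_poly0 big_ord0. Qed.

Lemma nrmM f g : nrm (f * g) <= nrm f * nrm g.
Proof.
elim/poly_ind: f => [|f c IH]; first by rewrite mul0r nrm0 mul0r.
have -> : nrm (f * 'X + c%:P) = w * nrm f + `|c|.
  rewrite (nrm_wide (f:= f * 'X + c%:P) (n:=(size f).+1)); last first.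
    rewrite (leq_trans (size_polyD _ _)) // geq_max (leq_trans (size_polyC_leq1 _)) // andbT.
    by rewrite (leq_trans (size_polyMleq _ _)) // size_polyX addn2.
  rewrite big_ord_recl coefD coefMX coefC /= add0r expr0 mulr1 addrC; congr (_ + _).
  rewrite /nrm mulr_sumr.
  by apply: eq_bigr => i _; rewrite coefD coefMX coefC /= addr0 exprS mulrCA.
rewrite !mulrDl; apply: le_trans (nrmD _ _) _; apply: lerD.
  by rewrite [f * 'X]mulrC -(mulrA 'X) nrmXM -mulrA ler_wpM2l // ltW.
by rewrite mul_polyC nrmZ.
Qed.

Lemma nrm_horner f : (forall i, 0 <= f`_i) -> nrm f = f.[w].
Proof. by move=> h; rewrite horner_coef; apply: eq_bigr => i _; rewrite ger0_norm. Qed.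

Lemma nrm1 : nrm 1 = 1.
Proof. by rewrite nrm_horner ?hornerC // => i; rewrite coef1; case: (i == 0%N). Qed.

Lemma nrmXn f n : nrm (f ^+ n) <= nrm f ^+ n.
Proof.
elim: n => [|n IH]; first by rewrite !expr0 nrm1.
rewrite !exprS; apply: le_trans (nrmM _ _) _; by rewrite ler_wpM2l // nrm_ge0.
Qed.

End Norm.

Section Walk.
Context {F : realFieldType}.
Variables (w u : F) (p : {poly F}).
Hypotheses (w0 : 0 < w) (u0 : 0 < u).
Let v := p - u *: ('X + w%:P).
Hypothesis v_ge0 : forall i, 0 <= v`_i.

(** Sum over all words of n letters taken from u w, u X and v, with scores 1, -1 and 0, of the
    product of the letters times [phi] of the total score. *)
Fixpoint wpoly n (phi : int -> F) : {poly F} :=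
  if n is n'.+1 then
    v * wpoly n' phi + (u * w) *: wpoly n' (fun j => phi (j + 1))
    + u *: ('X * wpoly n' (fun j => phi (j - 1)))
  else (phi 0)%:P.

Notation wval n phi := (wpoly n phi).[w].

Lemma wval_S n phi : wval n.+1 phi =
  v.[w] * wval n phi + u * w * (wval n (fun j => phi (j + 1)) + wval n (fun j => phi (j - 1))).
Proof. by rewrite /= hornerD hornerD (hornerM v) !hornerZ hornerM hornerX; ring. Qed.

Lemma wpolyD n phi psi a b :
  wpoly n (fun j => a * phi j + b * psi j) = a *: wpoly n phi + b *: wpoly n psi.
Proof.
elim: n phi psi => [|n IH] phi psi /=; first by rewrite polyCD !polyCM -!mul_polyC.
rewrite IH (IH (fun j => phi (j + 1)) (fun j => psi (j + 1))).
rewrite (IH (fun j => phi (j - 1)) (fun j => psi (j - 1))) -!mul_polyC; ring.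
Qed.

Lemma wvalD n phi psi a b :
  wval n (fun j => a * phi j + b * psi j) = a * wval n phi + b * wval n psi.
Proof. by rewrite wpolyD !hornerE. Qed.

Lemma eq_wpoly n phi psi : phi =1 psi -> wpoly n phi = wpoly n psi.
Proof.
elim: n phi psi => [|n IH] phi psi e /=; first by rewrite e.
rewrite (IH _ _ e) (IH (fun j => phi (j + 1)) (fun j => psi (j + 1))) => [|j]; last by rewrite e.
by rewrite (IH (fun j => phi (j - 1)) (fun j => psi (j - 1))) => [|j]; last by rewrite e.
Qed.

Lemma wpoly1 n : wpoly n (fun=> 1) = p ^+ n.
Proof. by elim: n => [|n IH] //=; rewrite IH /v -!mul_polyC exprS polyCM; ring. Qed.

Lemma wval1 n : wval n (fun=> 1) = p.[w] ^+ n.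
Proof. by rewrite wpoly1 horner_exp. Qed.

(** Each of the n + 1 positions contributes u w - u X, with a factor p for each of the other
    positions. *)
Lemma wpoly_id n :
  wpoly n.+1 (fun j => j%:~R) = (n.+1%:R * u) *: ((w%:P - 'X) * p ^+ n).
Proof.
have step m : wpoly m.+1 (fun j => j%:~R) =
    p * wpoly m (fun j => j%:~R) + u *: ((w%:P - 'X) * p ^+ m).
  rewrite /= (@eq_wpoly m (fun j => (j + 1)%:~R) (fun j => 1 * j%:~R + 1 * 1)); last first.
    by move=> j; rewrite !mul1r intrD.
  rewrite (@eq_wpoly m (fun j => (j - 1)%:~R) (fun j => 1 * j%:~R + (-1) * 1)); last first.
    by move=> j; rewrite !mul1r intrD mulN1r.
  rewrite !wpolyD wpoly1 /v -!mul_polyC !polyCM polyCN polyC1; ring.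
elim: n => [|n IH].
  by rewrite step expr0 /= mul1r polyC0 mulr0 add0r.
rewrite step IH exprS -[in RHS]natr1 -!mul_polyC !polyCM polyCD polyC1; ring.
Qed.

(** At X = w the letters of score 1 and -1 have the same weight u w, so the mixed terms cancel and
    only the n + 1 diagonal terms remain. *)
Lemma wval_sq n :
  wval n.+1 (fun j => j%:~R ^+ 2) = n.+1%:R * (2 * u * w) * p.[w] ^+ n.
Proof.
have step m : wval m.+1 (fun j => j%:~R ^+ 2) =
    p.[w] * wval m (fun j => j%:~R ^+ 2) + 2 * u * w * p.[w] ^+ m.
  have e : wval m (fun j => (j + 1)%:~R ^+ 2) + wval m (fun j => (j - 1)%:~R ^+ 2)
     = 2 * wval m (fun j => j%:~R ^+ 2) + 2 * p.[w] ^+ m.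
    rewrite -wval1 -wvalD -[LHS]mul1r mulrDr -wvalD; congr (_.[w]); apply: eq_wpoly => j.
    by rewrite !intrD mulrN1z; ring.
  rewrite wval_S e /v !hornerE; ring.
elim: n => [|n IH]; first by rewrite step expr0 /= hornerC expr0n /=; ring.
by rewrite step IH exprS -[in RHS]natr1; ring.
Qed.

Lemma wval_le n phi psi : (forall j, phi j <= psi j) -> wval n phi <= wval n psi.
Proof.
have vw : 0 <= v.[w].
  by rewrite horner_coef; apply: sumr_ge0 => i _; rewrite mulr_ge0 // exprn_ge0 // ltW.
have uw : 0 <= u * w by rewrite mulr_ge0 ?ltW.
elim: n phi psi => [|n IH] phi psi h; first by rewrite !hornerC.
by rewrite !wval_S; apply: lerD; apply: ler_wpM2l => //; [|apply: lerD]; apply: IH.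
Qed.

(** The letters have nonnegative coefficients, so their norms are their values at w and the triangle
    inequality can be applied word by word. *)
Lemma nrm_wpoly n phi : nrm w (wpoly n phi) <= wval n (fun j => `|phi j|).
Proof.
elim: n phi => [|n IH] phi.
  by rewrite hornerC /= -[_%:P]mulr1 mul_polyC nrmZ nrm1 // mulr1.
have uw : 0 <= u * w by rewrite mulr_ge0 ?ltW.
rewrite wval_S mulrDr addrA.
apply: le_trans (nrmD w0 _ _) _; apply: lerD; first apply: le_trans (nrmD w0 _ _) _; first apply: lerD.
- apply: le_trans (nrmM w0 _ _) _; rewrite (@nrm_horner _ _ v) //.
  apply: ler_wpM2l => //; rewrite horner_coef.
  by apply: sumr_ge0 => i _; rewrite mulr_ge0 // exprn_ge0 // ltW.
- rewrite nrmZ (ger0_norm uw); exact: (ler_wpM2l uw (IH _)).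
- rewrite nrmZ nrmXM // (ger0_norm (ltW u0)) mulrA; exact: (ler_wpM2l uw (IH _)).
Qed.

Hypothesis p0 : 0 < p.[w].

(* The n+1 independent letters w, X, v of p = u (w + X) + v carry the score
   +1, -1, 0; summing the total score over all words gives (n+1) u (w - X) p^n,
   so that Cauchy-Schwarz against the second moment yields the decay. *)
Lemma nrm_subX_exp n :
  nrm w (('X - w%:P) * p ^+ n) ^+ 2 <= 2 * w / u * p.[w] ^+ (2 * n).+1 / n.+1%:R.
Proof.
set X := nrm _ _.
have X0 : 0 <= X by rewrite nrm_ge0.
set a := wval n.+1 (fun j => `|j%:~R|).
have aX : n.+1%:R * u * X <= a.
  have := nrm_wpoly n.+1 (fun j => j%:~R); rewrite wpoly_id nrmZ ger0_norm; last first.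
    by rewrite mulr_ge0 // ltW.
  congr (_ * _ <= _); rewrite /X -opprB mulNr -scaleN1r nrmZ normrN1 mul1r //.
(* Cauchy-Schwarz in linear form: 2 |y| <= y^2 / mu + mu, summed over all words. Taking mu = a /
   p(w)^(n+1) below gives the quadratic inequality. *)
have key (mu : F) : 0 < mu ->
    2 * a <= mu^-1 * (n.+1%:R * (2 * u * w) * p.[w] ^+ n) + mu * p.[w] ^+ n.+1.
  move=> mu0; rewrite -wval_sq -wval1 -wvalD.
  have -> : 2 * a = wval n.+1 (fun j => 2 * `|j%:~R| + 0 * 1).
    by rewrite wvalD mul0r addr0.
  apply: wval_le => j; rewrite -(real_normK (num_real (j%:~R : F))).
  set y := `|_|; rewrite mul0r addr0 mulr1 -subr_ge0.
  have -> : mu^-1 * y ^+ 2 + mu - 2 * y = (y - mu) ^+ 2 / mu by field; rewrite gt_eqF.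
  by rewrite divr_ge0 ?sqr_ge0 // ltW.
have [a0|a0] := leP a 0.
  have -> : X = 0.
    apply/eqP; rewrite eq_le X0 andbT -(@pmulr_rle0 _ (n.+1%:R * u)) ?mulr_gt0 ?ltr0n //.
    exact: le_trans a0.
  by rewrite expr2 mul0r; repeat (apply: mulr_ge0); rewrite ?invr_ge0 ?exprn_ge0 // ltW.
have c0 : 0 < p.[w] ^+ n.+1 by rewrite exprn_gt0.
have := key (a / p.[w] ^+ n.+1) (divr_gt0 a0 c0).
set b := n.+1%:R * _ * _; set c := p.[w] ^+ n.+1 => h.
have {}h : a ^+ 2 <= b * c.
  have : a <= (a / c)^-1 * b.
    have e : a / c * c = a by rewrite mulfVK // gt_eqF.
    by rewrite e in h; lra.
  rewrite invf_div mulrC -(ler_pM2r a0) -expr2 => /le_trans; apply.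
  by rewrite -mulrA mulfVK ?gt_eqF.
have n0 : 0 < n.+1%:R :> F by rewrite ltr0n.
have y0 : 0 <= n.+1%:R * u * X by apply: mulr_ge0 => //; apply: mulr_ge0; apply: ltW.
have h2 : (n.+1%:R * u * X) ^+ 2 <= b * c.
  by apply: le_trans h; rewrite ler_pXn2r // nnegrE ltW.
have q0 : 0 < (n.+1%:R * u) ^+ 2 by rewrite exprn_gt0 // mulr_gt0.
rewrite -(ler_pM2l q0) -exprMn; apply: le_trans h2 _.
rewrite le_eqVlt; apply/orP; left; apply/eqP; rewrite /b /c mul2n -addnn !exprSr exprD.
move: n0; move: (n.+1%:R : F) => m m0; move: (p.[w] ^+ n) (p.[w]) => P P1.
by field; rewrite !gt_eqF.
Qed.
End Walk.

Section Decay.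
Context {F : realFieldType}.
Variables (d : nat) (w : F) (p : {poly F}).
Hypotheses (w0 : 0 < w) (d0 : (0 < d)%N) (sp : (size p <= d.+1)%N).
Hypothesis p_gt0 : forall j, (j <= d)%N -> 0 < p`_j.

Lemma coefp_ge0 j : 0 <= p`_j.
Proof.
case: (leqP j d) => h; first by rewrite ltW // p_gt0.
by rewrite nth_default // (leq_trans sp).
Qed.

Lemma hornerp_gt0 x : 0 < x -> 0 < p.[x].
Proof.
move=> x0; rewrite (horner_coef_wide _ sp) big_ord_recl /=.
apply: ltr_wpDr; last by rewrite expr0 mulr1 p_gt0.
by apply: sumr_ge0 => i _; rewrite mulr_ge0 ?coefp_ge0 // exprn_ge0 // ltW.
Qed.

Lemma coef_exp_ge0 n k : 0 <= (p ^+ n)`_k.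
Proof.
elim: n k => [|n IH] k; first by rewrite expr0 coef1; case: (k == 0%N).
by rewrite exprS coefM; apply: sumr_ge0 => i _; rewrite mulr_ge0 // coefp_ge0.
Qed.

Lemma nrm_exp n : nrm w (p ^+ n) = p.[w] ^+ n.
Proof. by rewrite nrm_horner ?horner_exp // => i; apply: coef_exp_ge0. Qed.

Lemma nrm_subX_le : exists2 C, 0 < C & forall n,
  nrm w (('X - w%:P) * p ^+ n) ^+ 2 <= C * p.[w] ^+ (2 * n) / n.+1%:R.
Proof.
have pw := hornerp_gt0 w0.
(* The largest u for which p - u (X + w) has nonnegative coefficients. *)
pose u := Num.min p`_1 (p`_0 / w).
have u0 : 0 < u by rewrite lt_min p_gt0 //= divr_gt0 // p_gt0.
have v0 i : 0 <= (p - u *: ('X + w%:P))`_i.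
  rewrite coefB coefZ coefD coefX coefC; case: i => [|[|i]] /=.
  - by rewrite add0r subr_ge0 -ler_pdivlMr // /u ge_min lexx orbT.
  - by rewrite addr0 mulr1 subr_ge0 /u ge_min lexx.
  - by rewrite addr0 mulr0 subr0 coefp_ge0.
exists (2 * w / u * p.[w]) => [|n]; first by rewrite !mulr_gt0 // invr_gt0.
have := nrm_subX_exp w0 u0 v0 pw n.
by rewrite (exprS p.[w]) !mulrA.
Qed.

(** The n factors p are divided into 2 A groups of size m = n / (2 A). Each group takes one factor X
    - w and gains m^(-1/2); the leftover powers of p have norm p(w) each. *)
Lemma nrm_subXn_le A : (0 < A)%N -> exists2 K, 0 < K & forall n,
  nrm w (('X - w%:P) ^+ (2 * A) * p ^+ n) <= K * p.[w] ^+ n / n.+1%:R ^+ A.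
Proof.
move=> A0; have [C C0 hC] := nrm_subX_le; have pw := hornerp_gt0 w0; have pw' := ltW pw; have C0' := ltW C0.
exists (((2 * A)%:R * C) ^+ A) => [|n].
  by rewrite exprn_gt0 // mulr_gt0 // ltr0n muln_gt0.
pose m := (n %/ (2 * A))%N.
have mn : (2 * A * m <= n)%N by rewrite mulnC leq_divM.
have -> : ('X - w%:P) ^+ (2 * A) * p ^+ n =
  (('X - w%:P) * p ^+ m) ^+ (2 * A) * p ^+ (n - 2 * A * m).
  by rewrite exprMn -mulrA -exprM -exprD [(m * _)%N]mulnC subnKC.
apply: le_trans (nrmM w0 _ _) _; rewrite nrm_exp.
apply: (@le_trans _ _ ((C * p.[w] ^+ (2 * m) / m.+1%:R) ^+ A * p.[w] ^+ (n - 2 * A * m))).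
  rewrite ler_wpM2r ?exprn_ge0 //.
  apply: le_trans (nrmXn w0 _ _) _.
  rewrite exprM; apply: lerXn2r; rewrite ?nnegrE ?exprn_ge0 ?nrm_ge0 //.
  by rewrite divr_ge0 // mulr_ge0 ?exprn_ge0.
have e : (C * p.[w] ^+ (2 * m) / m.+1%:R) ^+ A * p.[w] ^+ (n - 2 * A * m) =
   (C / m.+1%:R) ^+ A * p.[w] ^+ n.
  rewrite mulrAC exprMn -mulrA -exprM -exprD.
  by congr (_ * _ ^+ _); rewrite mulnAC subnKC.
rewrite e mulrAC ler_wpM2r ?exprn_ge0 // -expr_div_n.
apply: lerXn2r; rewrite ?nnegrE ?divr_ge0 ?mulr_ge0 ?ler0n //.
rewrite ler_pdivrMr ?ltr0n // mulrAC ler_pdivlMr ?ltr0n // [_ * C]mulrC -mulrA.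
rewrite ler_wpM2l // -natrM ler_nat.
by rewrite mulnC ltn_ceil // muln_gt0.
Qed.
End Decay.

Lemma coef_le_nrm (F : realFieldType) (w : F) (f : {poly F}) k :
  0 < w -> `|f`_k| <= nrm w f / w ^+ k.
Proof. by move=> w0; rewrite ler_pdivlMr ?exprn_gt0 // nrm_coef. Qed.

Lemma split_horner (F : realFieldType) (w : F) (f : {poly F}) :
  exists f1, f = f.[w]%:P + ('X - w%:P) * f1.
Proof.
have /factor_theorem [f1 e] : root (f - f.[w]%:P) w by rewrite rootE !hornerE subrr.
by exists f1; rewrite mulrC -e addrC subrK.
Qed.

(** * Propagation to lower levels *)

Section Upper.
Context {F : realFieldType}.
Variables (d N A : nat) (w gm : F) (p G : {poly F}).
Hypotheses (w0 : 0 < w) (d0 : (0 < d)%N) (sp : (size p <= d.+1)%N).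
Hypothesis p_gt0 : forall j, (j <= d)%N -> 0 < p`_j.
Hypotheses (A0 : (0 < A)%N) (gm0 : 0 <= gm).
Notation z := ('X - w%:P).
Notation bnd e m i := (p.[w]^-1 ^+ m * w ^+ i * (1 + m + i)%:R ^+ e).

(* The bound of [nrm_subXn_le] for a single coefficient. *)
Definition rmd n k := p.[w] ^+ n / w ^+ k / n.+1%:R ^+ A.
Definition Gam s := G - s *: p ^+ N.
(** A common bound for the remainder and for the finitely many coefficients from which all the
    others are estimated. *)
Definition small n k s B := [/\ `|s| <= gm, rmd n k <= B &
   forall l, (l < 2 * A)%N -> `|(Gam s * z ^+ l * p ^+ n)`_k| <= B].

Lemma rmd_gt0 n k : 0 < rmd n k.
Proof. by rewrite !divr_gt0 ?exprn_gt0 ?ltr0n // (hornerp_gt0 sp p_gt0). Qed.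

(** The exponential part scales exactly, and for m at most n / 2 the power of n + 1 changes by at
    most 2^A. *)
Lemma rmd_half n k m : (m + m <= n)%N ->
  rmd (n - m) k <= 2 ^+ A * (p.[w]^-1 ^+ m * rmd n k).
Proof.
move=> mn; have pw := hornerp_gt0 sp p_gt0 w0; have pw' := ltW pw; have w0' := ltW w0.
have -> : rmd (n - m) k = p.[w]^-1 ^+ m * (p.[w] ^+ n / w ^+ k / (n - m).+1%:R ^+ A).
  rewrite /rmd !mulrA; congr (_ / _ / _).
  by rewrite expfB_cond ?exprVn 1?mulrC // ?gt_eqF //=; lia.
rewrite (mulrCA (2 ^+ A)) ler_wpM2l ?exprn_ge0 ?invr_ge0 // /rmd (mulrCA (2 ^+ A)).
rewrite ler_wpM2l ?divr_ge0 ?exprn_ge0 // -expr_div_n.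
rewrite -exprVn; apply: lerXn2r; rewrite ?nnegrE ?divr_ge0 ?invr_ge0 ?ler0n //.
rewrite ler_pdivlMr ?ltr0n // mulrC ler_pdivrMr ?ltr0n // -natrM ler_nat; lia.
Qed.

Lemma nrm_Gam s : `|s| <= gm -> nrm w (Gam s) <= nrm w G + gm * p.[w] ^+ N.
Proof.
move=> h; apply: le_trans (nrmD w0 _ _) _; rewrite lerD2l -scaleNr nrmZ normrN.
by rewrite (nrm_exp w sp p_gt0) ler_wpM2r // exprn_ge0 // ltW // (hornerp_gt0 sp p_gt0).
Qed.

(** The factor z^(2A) p^n is small in norm, while |s| <= gm bounds the norm of [Gam s] uniformly. *)
Lemma tail_bound f : exists2 K, 0 <= K & forall s n k i, `|s| <= gm ->
  `|(Gam s * z ^+ (2 * A) * f * 'X^i * p ^+ n)`_k| <= K * w ^+ i * rmd n k.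
Proof.
have [K K0 hK] := nrm_subXn_le w0 d0 sp p_gt0 A0; have pw := hornerp_gt0 sp p_gt0 w0; have pw' := ltW pw; have w0' := ltW w0.
set g := nrm w G + gm * p.[w] ^+ N.
have g0 : 0 <= g by rewrite addr_ge0 ?nrm_ge0 // mulr_ge0 // exprn_ge0 // ltW.
exists (g * nrm w f * K) => [|s n k i hs].
  by rewrite !mulr_ge0 ?nrm_ge0 // ltW.
apply: le_trans (coef_le_nrm _ _ w0) _; rewrite /rmd !mulrA.
rewrite [X in _ <= X]mulrAC ler_pM2r ?invr_gt0 ?exprn_gt0 //.
have -> : Gam s * z ^+ (2 * A) * f * 'X^i * p ^+ n = Gam s * f * 'X^i * (z ^+ (2 * A) * p ^+ n) by ring.
apply: le_trans (nrmM w0 _ _) _.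
have -> : g * nrm w f * K * w ^+ i * p.[w] ^+ n / n.+1%:R ^+ A =
   (g * nrm w f * w ^+ i) * (K * p.[w] ^+ n / n.+1%:R ^+ A).
  by move: (_ ^- A) => V; ring.
apply: ler_pM; rewrite ?nrm_ge0 //.
apply: le_trans (nrmM w0 _ _) _; apply: ler_pM; rewrite ?nrm_ge0 //.
  by apply: le_trans (nrmM w0 _ _) _; apply: ler_pM; rewrite ?nrm_ge0 // nrm_Gam.
apply: le_trans (nrmXn w0 _ _) _; rewrite -['X]mulr1 nrmXM // nrm1 // mulr1 //.
Qed.
Lemma small_ge0 n k s B : small n k s B -> 0 <= B.
Proof. by case=> _ h _; apply: le_trans h; apply/ltW/rmd_gt0. Qed.

(** The factor X^i moves the index from k to k - i, so this covers the vertices m levels below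
    (n,k). The exponent e counts the polynomial loss accumulated while l is lowered from 2 A. *)
Definition upper_at l e f := exists2 K, 0 <= K & forall s n k m i B, small n k s B ->
  (m + m <= n)%N ->
  `|(Gam s * z ^+ l * f * 'X^i * p ^+ (n - m))`_k| <= K * bnd e m i * B.

(* Writing p = p(w) + z p1 trades a power of p for the factor p(w)^-1, up to
   terms that contain z^(l+1). *)
Lemma upper_step l e : (l < 2 * A)%N -> (forall f, upper_at l.+1 e f) ->
  upper_at l e.+1 1.
Proof.
move=> lA IH; have pw := hornerp_gt0 sp p_gt0 w0.
have [p1 ep] := split_horner w p.
have [K1 K10 h1] := IH p1; have [K2 K20 h2] := IH 1.
have q0 : 0 < p.[w]^-1 by rewrite invr_gt0.
set q := p.[w]^-1 in q0 *.
pose K := q * K1 + K2 / w.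
have K0 : 0 <= K by rewrite addr_ge0 ?divr_ge0 ?mulr_ge0 // ltW.
(* Each of the m + i replacements of a factor adds one error term, whence the linear factor that
   raises e by one. *)
suff key s n k m i B : small n k s B -> (m + m <= n)%N ->
    `|(Gam s * z ^+ l * 1 * 'X^i * p ^+ (n - m))`_k| <=
    (1 + K * (m + i)%:R) * bnd e m i * B.
  exists (1 + K) => [|s n k m i B hs mn]; first by rewrite addr_ge0.
  apply: le_trans (key _ _ _ _ _ _ hs mn) _; apply: ler_wpM2r; first exact: small_ge0 hs.
  have b0 : 0 <= q ^+ m * w ^+ i * (1 + m + i)%:R ^+ e.
    by rewrite !mulr_ge0 ?exprn_ge0 ?ler0n // ltW.
  rewrite [X in _ <= X](_ : _ = q ^+ m * w ^+ i * (1 + m + i)%:R ^+ e * ((1 + K) * (1 + m + i)%:R)); last first.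
    by rewrite exprSr; ring.
  rewrite mulrC.
  apply: ler_wpM2l => //.
  have -> : (1 + m + i)%:R = 1 + (m + i)%:R :> F by rewrite -addnA natrD.
  have : 0 <= (m + i)%:R :> F by rewrite ler0n.
  by move: K0; nra.
move=> hs mn; have B0 := small_ge0 hs.
have T j : (1 + K * j%:R) * (1 + j)%:R ^+ e + K * (2 + j)%:R ^+ e <= (1 + K * j.+1%:R) * (2 + j)%:R ^+ e.
  have -> : 1 + K * j.+1%:R = (1 + K * j%:R) + K by rewrite -natr1; ring.
  rewrite [X in _ <= X]mulrDl lerD2r; apply: ler_wpM2l; first by rewrite addr_ge0 // mulr_ge0 // ler0n.
  by apply: lerXn2r; rewrite ?nnegrE ?ler0n // ler_nat; lia.
(* At m = 0 only shifts occur: X = w + z replaces a factor X by w at the cost of a term with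
   z^(l+1). *)
have base c : `|(Gam s * z ^+ l * 1 * 'X^c * p ^+ (n - 0))`_k| <=
    (1 + K * (0 + c)%:R) * bnd e 0 c * B.
  elim: c => [|c IHi].
    rewrite !expr0 !mulr1 subn0 mulr0 addr0 !mul1r addn0 expr1n mul1r.
    by case: hs => _ _; apply.
  have -> : Gam s * z ^+ l * 1 * 'X^(c.+1) * p ^+ (n - 0) =
     w *: (Gam s * z ^+ l * 1 * 'X^c * p ^+ (n - 0)) + Gam s * z ^+ l.+1 * 1 * 'X^c * p ^+ (n - 0).
    by rewrite -mul_polyC !exprS; ring.
  rewrite coefD coefZ; apply: le_trans (ler_normD _ _) _; rewrite normrM (gtr0_norm w0).
  have h0 := h2 s n k 0%N c B hs isT.
  apply: (@le_trans _ _ (w * ((1 + K * (0 + c)%:R) * bnd e 0 c * B) + K2 * bnd e 0 c * B)).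
    by apply: lerD => //; rewrite ler_pM2l.
  have -> : (1 + K * (0 + c.+1)%:R) * bnd e 0 c.+1 * B =
     ((1 + K * c.+1%:R) * (2 + c)%:R ^+ e) * (w * w ^+ c * B).
    by rewrite !add0n !expr0 exprS addn0 -[(1 + c.+1)%N]/(2 + c)%N; ring.
  apply: (@le_trans _ _ (((1 + K * c%:R) * (1 + c)%:R ^+ e + K * (2 + c)%:R ^+ e) * (w * w ^+ c * B))); last first.
    by apply: ler_wpM2r => //; rewrite !mulr_ge0 // ?exprn_ge0 // ltW.
  rewrite !add0n !expr0 !addn0.
  have -> : K2 = (K2 / w) * w by rewrite divfK // gt_eqF.
  have : K2 / w * (1 + c)%:R ^+ e <= K * (2 + c)%:R ^+ e.
    apply: ler_pM; rewrite ?divr_ge0 ?exprn_ge0 ?ler0n //; first exact: ltW.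
      by rewrite /K lerDr mulr_ge0 // ltW.
    by apply: lerXn2r; rewrite ?nnegrE ?ler0n // ler_nat; lia.
  have WB : 0 <= w * w ^+ c * B by rewrite !mulr_ge0 // ?exprn_ge0 // ltW.
  move=> /(ler_wpM2r WB) hh.
  rewrite mulrDl -subr_ge0; move: hh; rewrite -subr_ge0.
  by congr (_ <= _); ring.
elim: m i mn => [|m IHm] i mn; first exact: base.
have mn' : (m + m <= n)%N by lia.
have nm : (n - m)%N = (n - m.+1).+1 by lia.
have e1 : Gam s * z ^+ l * 1 * 'X^i * p ^+ (n - m.+1) =
   q *: (Gam s * z ^+ l * 1 * 'X^i * p ^+ (n - m) - Gam s * z ^+ l.+1 * p1 * 'X^i * p ^+ (n - m.+1)).
  rewrite nm (exprS p) {2}ep.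
  have -> : Gam s * z ^+ l * 1 * 'X^i * ((p.[w]%:P + z * p1) * p ^+ (n - m.+1)) -
     Gam s * z ^+ l.+1 * p1 * 'X^i * p ^+ (n - m.+1) = p.[w] *: (Gam s * z ^+ l * 1 * 'X^i * p ^+ (n - m.+1)).
    by rewrite -mul_polyC exprS; ring.
  by rewrite scalerA mulVf ?scale1r // gt_eqF.
rewrite e1 coefZ coefB normrM (gtr0_norm q0).
apply: (@le_trans _ _ (q * ((1 + K * (m + i)%:R) * bnd e m i * B + K1 * bnd e m.+1 i * B))).
  rewrite ler_pM2l //; apply: le_trans (ler_normB _ _) _; apply: lerD; first exact: IHm.
  exact: h1.
have -> : (1 + K * (m.+1 + i)%:R) * bnd e m.+1 i * B =
   ((1 + K * (m + i).+1%:R) * (2 + (m + i))%:R ^+ e) * (q * q ^+ m * w ^+ i * B).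
  by rewrite -/q addSn exprS -[(1 + m.+1 + i)%N]/(2 + (m + i))%N; ring.
have WB : 0 <= q * q ^+ m * w ^+ i * B by rewrite !mulr_ge0 // ?exprn_ge0 // ltW.
apply: le_trans (ler_wpM2r WB (T (m + i)%N)).
have -> : q * ((1 + K * (m + i)%:R) * bnd e m i * B + K1 * bnd e m.+1 i * B) =
  ((1 + K * (m + i)%:R) * (1 + (m + i))%:R ^+ e + q * K1 * (2 + (m + i))%:R ^+ e) * (q * q ^+ m * w ^+ i * B).
  by rewrite -/q exprS -[(1 + m.+1 + i)%N]/(2 + (m + i))%N !addnA; ring.
apply: ler_wpM2r => //; rewrite lerD2l; apply: ler_wpM2r; first by rewrite exprn_ge0 // ler0n.
by rewrite /K lerDl divr_ge0 // ltW.
Qed.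
End Upper.

Lemma deriv_expS (F : realFieldType) (f : {poly F}) n :
  (f ^+ n.+1)^`() = n.+1%:R * (f^`() * f ^+ n).
Proof. by rewrite deriv_exp /= mulr_natl. Qed.

Lemma deriv_subXn (F : realFieldType) (w : F) (g : {poly F}) n :
  (g * ('X - w%:P) ^+ n.+1)^`() =
  ('X - w%:P) ^+ n * (g^`() * ('X - w%:P) + n.+1%:R * g).
Proof. by rewrite derivM deriv_expS derivXsubC exprS; ring. Qed.

(** * Sums over towers are not all negligible *)

Section Dop.
Context {F : realFieldType}.
Variables (w : F) (p : {poly F}).
Hypotheses (w0 : 0 < w) (pw : 0 < p.[w]).

Definition Dop (f : {poly F}) := 'X * p * f^`().

(** Each application lowers the order of vanishing at w by exactly one, because X p does not vanish
    there. *)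
Lemma Dop_nonroot f : f != 0 -> exists r, (iter r Dop f).[w] != 0.
Proof.
move=> f0; have [m [g]] := multiplicity_XsubC f w; rewrite f0 /= rootE => + ->.
elim: m g => [|m IH] g gw; first by exists 0%N; rewrite /= expr0 mulr1.
have [|r hr] := IH ('X * p * (g^`() * ('X - w%:P) + m.+1%:R * g)); last first.
  exists r.+1; rewrite iterSr /Dop deriv_subXn.
  by move: hr; congr (_.[w] != 0); congr (iter _ _ _); ring.
rewrite !hornerE subrr mulr0 add0r.
have -> : (m.+1%:R : {poly F}).[w] = m.+1%:R by rewrite -polyC_natr hornerC.
by rewrite !mulf_neq0 // ?gt_eqF // ltr0n.
Qed.

(** Choose c so that D = G - c p^N vanishes at w. A nonzero D of order m there is impossible: p D'
    has order m - 1, whereas N p' D has order at least m. *)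
Lemma exp_multiple_of_ode (G : {poly F}) N :
  p * G^`() = N%:R * p^`() * G -> exists c, G = c *: p ^+ N.
Proof.
move=> ode; exists (G.[w] / p.[w] ^+ N); set c := _ / _.
apply/eqP; rewrite -subr_eq0; apply/negPn/negP => D0; set D := G - _ in D0.
have Dw : D.[w] = 0 by rewrite /D !hornerE divfK ?subrr // expf_neq0 // gt_eqF.
have Dode : p * D^`() = N%:R * p^`() * D.
  rewrite /D derivB derivZ mulrBr ode -!mul_polyC.
  case: (N) => [|n]; first by rewrite expr0 derivC; ring.
  by rewrite deriv_expS exprS; ring.
have [m [g]] := multiplicity_XsubC D w; rewrite D0 /= rootE => gw eD.
case: m eD => [|m] eD; first by move: Dw gw; rewrite eD expr0 mulr1 => ->; rewrite eqxx.
move: Dode; rewrite eD deriv_subXn => e.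
have {}e : p * (g^`() * ('X - w%:P) + m.+1%:R * g) = N%:R * p^`() * g * ('X - w%:P).
  have zm : ('X - w%:P) ^+ m != 0 by rewrite expf_neq0 // polyXsubC_eq0.
  by apply: (mulfI zm); rewrite exprS in e; rewrite mulrCA e; ring.
move/(congr1 (fun f => f.[w])): e; rewrite !hornerE subrr !mulr0 add0r => /eqP.
have -> : (m.+1%:R : {poly F}).[w] = m.+1%:R by rewrite -polyC_natr hornerC.
by rewrite !mulf_eq0 (negPf gw) gt_eqF //= pnatr_eq0.
Qed.
End Dop.

Section Lower.
Context {F : realFieldType}.
Variables (d N : nat) (w gm : F) (p G : {poly F}) (kb : nat).
Hypotheses (w0 : 0 < w) (d0 : (0 < d)%N) (sp : (size p <= d.+1)%N).
Hypothesis p_gt0 : forall j, (j <= d)%N -> 0 < p`_j.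
Hypothesis gm0 : 0 <= gm.
Notation z := ('X - w%:P).
Notation Gam := (Gam N p G).
Notation small A := (small N A w gm p G).

Lemma coef_XderivM (f : {poly F}) k : ('X * f^`())`_k = k%:R * f`_k.
Proof. by rewrite coefXM coef_deriv; case: k => [|k] /=; rewrite ?mul0r // mulr_natl. Qed.

(** X d/dX multiplies the k-th coefficient by k; apply this to f p^(n+1) and expand by the product
    rule. *)
Lemma ibp n k (f : {poly F}) : ('X * p * f^`() * p ^+ n)`_k =
  k%:R * (p * f * p ^+ n)`_k - n.+1%:R * ('X * p^`() * f * p ^+ n)`_k.
Proof.
have -> : p * f * p ^+ n = f * p ^+ n.+1 by rewrite exprS; ring.
rewrite -coef_XderivM derivM deriv_expS.
have -> : n.+1%:R * ('X * p^`() * f * p ^+ n)`_k = ((n.+1%:R : F)%:P * ('X * p^`() * f * p ^+ n))`_k.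
  by rewrite coefCM.
rewrite -coefB polyC_natr; apply: (congr1 (fun g : {poly F} => g`_k)); rewrite exprS; ring.
Qed.

Section FixA.
Variable A : nat.
Hypothesis A0 : (0 < A)%N.
Notation rmd := (rmd A w p).

(** Downward induction on l from 2 A, where [tail_bound] applies. A general f is split as f(w) + z
    f1, and only the constant part needs [upper_step]. *)
Lemma upper l e f : (l + e = 2 * A)%N -> upper_at N A w gm p G l e f.
Proof.
have pw := hornerp_gt0 sp p_gt0 w0.
have q0 : 0 <= p.[w]^-1 by rewrite invr_ge0 ltW.
elim: e l f => [|e IH] l f.
  rewrite addn0 => ->; have [K K0 hK] := tail_bound N G w0 d0 sp p_gt0 A0 gm0 f.
  exists (K * 2 ^+ A) => [|s n k m i B]; first by rewrite mulr_ge0 // exprn_ge0.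
  case=> sg rB _ mn; apply: le_trans (hK s _ k i sg) _.
  have wi : 0 <= w ^+ i by rewrite exprn_ge0 // ltW.
  have h : rmd (n - m) k <= 2 ^+ A * (p.[w]^-1 ^+ m * rmd n k) by exact: (rmd_half w0 d0 sp p_gt0 A0 gm0).
  rewrite expr0 mulr1.
  apply: (@le_trans _ _ (K * w ^+ i * (2 ^+ A * (p.[w]^-1 ^+ m * B)))); last first.
    by rewrite le_eqVlt; apply/orP; left; apply/eqP; ring.
  apply: ler_wpM2l; first by rewrite mulr_ge0.
  apply: le_trans h _; rewrite ler_wpM2l ?exprn_ge0 // ler_wpM2l ?exprn_ge0 //.
move=> le; have [f1 ef] := split_horner w f.
have le' : (l.+1 + e = 2 * A)%N by lia.
have lA : (l < 2 * A)%N by lia.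
have [K1 K10 h1] := upper_step w0 d0 sp p_gt0 A0 gm0 lA (fun g => IH l.+1 g le').
have [K2 K20 h2] := IH l.+1 f1 le'.
exists (`|f.[w]| * K1 + K2) => [|s n k m i B hs mn]; first by rewrite addr_ge0 // mulr_ge0.
have B0 := small_ge0 w0 sp p_gt0 hs.
have -> : Gam s * z ^+ l * f * 'X^i * p ^+ (n - m) =
  f.[w] *: (Gam s * z ^+ l * 1 * 'X^i * p ^+ (n - m)) +
  Gam s * z ^+ l.+1 * f1 * 'X^i * p ^+ (n - m).
  by rewrite {1}ef -mul_polyC exprS; ring.
rewrite coefD coefZ; apply: le_trans (ler_normD _ _) _; rewrite normrM.
have := h1 s n k m i B hs mn; have := h2 s n k m i B hs mn.
set a1 := `|_|; set a2 := `|_|; set b := _ * _ ^+ i => e2 e1.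
have b0 : 0 <= b by rewrite mulr_ge0 ?exprn_ge0 // ltW.
have c1 : 1 <= (1 + m + i)%:R :> F by rewrite ler1n.
have c0 : 0 <= (1 + m + i)%:R :> F by rewrite ler0n.
have e2' : a1 <= K2 * (b * (1 + m + i)%:R ^+ e.+1) * B.
  apply: le_trans e2 _; rewrite ler_wpM2r // ler_wpM2l // ler_wpM2l //.
  by rewrite exprS ler_peMl ?exprn_ge0.
apply: (@le_trans _ _ (`|f.[w]| * (K1 * (b * (1 + m + i)%:R ^+ e.+1) * B) +
   K2 * (b * (1 + m + i)%:R ^+ e.+1) * B)).
  by apply: lerD => //; rewrite ler_wpM2l.
by rewrite !mulrDl !mulrA.
Qed.

(** All multiples f g are included because the product rule in [negl_Dop] produces them. There is no
    descent here: the level stays n and the loss is a power of n. *)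
Definition negl j f := forall g, exists2 K, 0 <= K & forall s n k B,
  small A n k s B -> (k <= kb * n.+1)%N ->
  `|(f * g * p ^+ n)`_k| <= K * n.+1%:R ^+ j * B.

Lemma Gam_negl g : exists2 K, 0 <= K & forall s n k B,
  small A n k s B -> `|(Gam s * g * p ^+ n)`_k| <= K * B.
Proof.
have [K K0 hK] := @upper 0 (2 * A) g (add0n _); exists K => // s n k B hs.
have := hK s n k 0%N 0%N B hs isT.
by rewrite !expr0 !mulr1 subn0 !addn0 expr1n !mulr1.
Qed.

(** The index is at most kb (n + 1), so both factors k and n + 1 from the integration by parts cost
    one power of n. *)
Lemma negl_Dop j f : negl j f -> negl j.+1 (Dop p f).
Proof.
move=> H g.
have [K1 K10 h1] := H (p * g); have [K2 K20 h2] := H ('X * p * g^`()).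
have [K3 K30 h3] := H ('X * p^`() * g).
exists (kb%:R * K1 + K2 + K3) => [|s n k B hs hk].
  by rewrite !addr_ge0 // mulr_ge0 // ler0n.
have e : (Dop p f * g * p ^+ n)`_k = k%:R * (f * (p * g) * p ^+ n)`_k -
   (f * ('X * p * g^`()) * p ^+ n)`_k - n.+1%:R * (f * ('X * p^`() * g) * p ^+ n)`_k.
  have := ibp n k (f * g).
  have -> : 'X * p * (f * g)^`() * p ^+ n = Dop p f * g * p ^+ n + f * ('X * p * g^`()) * p ^+ n.
    by rewrite derivM /Dop; ring.
  have -> : p * (f * g) * p ^+ n = f * (p * g) * p ^+ n by ring.
  have -> : 'X * p^`() * (f * g) * p ^+ n = f * ('X * p^`() * g) * p ^+ n by ring.
  by rewrite coefD => /(canRL (addrK _)) ->; rewrite addrAC.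
have := h1 s n k B hs hk; have := h2 s n k B hs hk; have := h3 s n k B hs hk.
rewrite {}e; set a := (_)`_k; set b := (_)`_k; set c := (_)`_k => ha hb hc.
have B0 := small_ge0 w0 sp p_gt0 hs.
set m : F := n.+1%:R; have m1 : 1 <= m by rewrite ler1n.
set Y := m ^+ j * B; have Y0 : 0 <= Y by rewrite mulr_ge0 // exprn_ge0 // (le_trans ler01).
have ha' : `|a| <= K3 * Y by rewrite mulrA.
have hb' : `|b| <= K2 * Y by rewrite mulrA.
have hc' : `|c| <= K1 * Y by rewrite mulrA.
have -> : (kb%:R * K1 + K2 + K3) * m ^+ j.+1 * B = kb%:R * m * (K1 * Y) + m * (K2 * Y) + m * (K3 * Y).
  by rewrite exprS /Y; ring.
apply: le_trans (ler_normB _ _) _; apply: lerD; first (apply: le_trans (ler_normB _ _) _; apply: lerD).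
- rewrite normrM normr_nat; apply: ler_pM; rewrite ?ler0n ?normr_ge0 //.
  by rewrite /m -natrM ler_nat.
- by apply: le_trans hb' _; rewrite ler_peMl // mulr_ge0.
- by rewrite normrM ger0_norm ?(le_trans ler01) // ler_wpM2l // (le_trans ler01).
Qed.

(* X p d/dX - N X p' kills p^N, so it maps every Gam s to this same polynomial. *)
Definition G1 := 'X * (p * G^`() - N%:R * p^`() * G).

Lemma negl_G1 : negl 1 G1.
Proof.
move=> g.
have [K1 K10 h1] := Gam_negl (p * g); have [K2 K20 h2] := Gam_negl ('X * p * g^`()).
have [K3 K30 h3] := Gam_negl ('X * p^`() * g).
have [K4 K40 h4] := Gam_negl ('X * N%:R * p^`() * g).
exists (kb%:R * K1 + K2 + K3 + K4) => [|s n k B hs hk].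
  by rewrite !addr_ge0 // mulr_ge0 // ler0n.
have e : (G1 * g * p ^+ n)`_k = k%:R * (Gam s * (p * g) * p ^+ n)`_k -
   (Gam s * ('X * p * g^`()) * p ^+ n)`_k - n.+1%:R * (Gam s * ('X * p^`() * g) * p ^+ n)`_k
   - (Gam s * ('X * N%:R * p^`() * g) * p ^+ n)`_k.
  have := ibp n k (Gam s * g).
  have -> : 'X * p * (Gam s * g)^`() * p ^+ n = G1 * g * p ^+ n +
      (Gam s * ('X * p * g^`()) * p ^+ n + Gam s * ('X * N%:R * p^`() * g) * p ^+ n).
    rewrite derivM /Gam derivB derivZ /G1 -!mul_polyC.
    case: (N) => [|m]; first by rewrite expr0 derivC; ring.
    by rewrite deriv_expS exprS; ring.
  have -> : p * (Gam s * g) * p ^+ n = Gam s * (p * g) * p ^+ n by ring.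
  have -> : 'X * p^`() * (Gam s * g) * p ^+ n = Gam s * ('X * p^`() * g) * p ^+ n by ring.
  by rewrite !coefD => /(canRL (addrK _)) ->; ring.
have := h1 s n k B hs; have := h2 s n k B hs; have := h3 s n k B hs; have := h4 s n k B hs.
rewrite {}e; set o := (_)`_k; set a := (_)`_k; set b := (_)`_k; set c := (_)`_k => ho ha hb hc.
have B0 := small_ge0 w0 sp p_gt0 hs.
set m : F := n.+1%:R; have m1 : 1 <= m by rewrite ler1n.
have -> : (kb%:R * K1 + K2 + K3 + K4) * m ^+ 1 * B =
  kb%:R * m * (K1 * B) + m * (K2 * B) + m * (K3 * B) + m * (K4 * B).
  by rewrite expr1; ring.
have up (K x : F) : 0 <= K -> x <= K * B -> x <= m * (K * B).
  by move=> K0 /le_trans; apply; rewrite ler_peMl // mulr_ge0.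
apply: le_trans (ler_normB _ _) _; apply: lerD; last exact: up.
apply: le_trans (ler_normB _ _) _; apply: lerD; first (apply: le_trans (ler_normB _ _) _; apply: lerD).
- rewrite normrM normr_nat; apply: ler_pM; rewrite ?ler0n ?normr_ge0 //.
  by rewrite /m -natrM ler_nat.
- exact: up.
- by rewrite normrM ger0_norm ?(le_trans ler01) // ler_wpM2l // (le_trans ler01).
Qed.

Lemma tail_negl f : exists2 K, 0 <= K & forall s n k B,
  small A n k s B -> `|(z ^+ (2 * A) * f * p ^+ n)`_k| <= K * B.
Proof.
have [K K0 hK] := nrm_subXn_le w0 d0 sp p_gt0 A0; have pw := hornerp_gt0 sp p_gt0 w0.
exists (nrm w f * K) => [|s n k B [_ hB _]]; first by rewrite mulr_ge0 ?nrm_ge0 // ltW.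
have K1 : 0 <= nrm w f * K by rewrite mulr_ge0 ?nrm_ge0 // ltW.
apply: le_trans (ler_wpM2l K1 hB); apply: le_trans (coef_le_nrm _ _ w0) _; rewrite /rmd.
have -> : z ^+ (2 * A) * f * p ^+ n = f * (z ^+ (2 * A) * p ^+ n) by ring.
rewrite [X in _ <= X](_ : _ = nrm w f * (K * p.[w] ^+ n / n.+1%:R ^+ A) / w ^+ k); last first.
  by move: (_ ^- A) (_ ^- k) => V V'; ring.
rewrite ler_wpM2r ?invr_ge0 ?exprn_ge0 ?(ltW w0) //.
by apply: le_trans (nrmM w0 _ _) _; apply: ler_pM; rewrite ?nrm_ge0.
Qed.

(* f is invertible modulo z^(2A). *)
Lemma negl_nonroot j f : negl j f -> f.[w] != 0 -> forall P, exists2 K, 0 <= K &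
  forall s n k B, small A n k s B -> (k <= kb * n.+1)%N ->
  `|(P * p ^+ n)`_k| <= K * n.+1%:R ^+ j * B.
Proof.
move=> H fw P; have [f1 ef] := split_horner w f; set c := f.[w] in fw ef.
(* Truncated geometric series: f S = c^(2A) modulo z^(2A). *)
pose S := \sum_(i < 2 * A) c%:P ^+ (2 * A - 1 - i) * (- (z * f1)) ^+ i.
have eS : c%:P ^+ (2 * A) = f * S + z ^+ (2 * A) * (- f1) ^+ (2 * A).
  rewrite -exprMn mulrN [f in f * S](_ : f = c%:P - (- (z * f1))); last by rewrite opprK.
  by rewrite /S; have := subrXX c%:P (- (z * f1)) (2 * A); rewrite subn1 => <-; rewrite subrK.
have [K1 K10 h1] := H (S * P); have [K2 K20 h2] := tail_negl ((- f1) ^+ (2 * A) * P).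
have cA : 0 < `|c ^+ (2 * A)| by rewrite normr_gt0 expf_neq0.
exists ((K1 + K2) / `|c ^+ (2 * A)|) => [|s n k B hs hk].
  by rewrite divr_ge0 ?addr_ge0 // ltW.
rewrite -!mulrA [_^-1 * _]mulrC !mulrA ler_pdivlMr // -normrM.
have -> : (P * p ^+ n)`_k * c ^+ (2 * A) = (f * (S * P) * p ^+ n)`_k +
     (z ^+ (2 * A) * ((- f1) ^+ (2 * A) * P) * p ^+ n)`_k.
  rewrite -coefD mulrC -coefCM polyC_exp eS.
  by apply: (congr1 (fun g : {poly F} => g`_k)); ring.
apply: le_trans (ler_normD _ _) _.
have := h1 s n k B hs hk; have := h2 s n k B hs.
set a := `|_|; set b := `|_| => ha hb.
have B0 := small_ge0 w0 sp p_gt0 hs.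
rewrite !mulrDl; apply: lerD => //; apply: le_trans ha _.
by rewrite ler_wpM2r // ler_peMr // exprn_ege1 // ler1n.
Qed.
End FixA.

(** The exponent r comes from the order of vanishing of [G1] at w and is fixed before A, so that A
    can later be taken large compared with it. *)
Theorem lower_bound : (forall c, G <> c *: p ^+ N) -> exists r, forall A, (0 < A)%N ->
  forall P, exists2 K, 0 <= K &
  forall s n k B, small A n k s B -> (k <= kb * n.+1)%N ->
  `|(P * p ^+ n)`_k| <= K * n.+1%:R ^+ r * B.
Proof.
move=> hG; have pw := hornerp_gt0 sp p_gt0 w0.
have G10 : G1 != 0.
  rewrite mulf_neq0 ?polyX_eq0 //; apply/eqP => /eqP; rewrite subr_eq0 => /eqP e.
  by have [c ec] := exp_multiple_of_ode pw e; apply: (hG c).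
have [r hr] := Dop_nonroot w0 pw G10; exists r.+1 => A A0.
apply: (@negl_nonroot A A0 r.+1 (iter r (Dop p) G1)) => //.
by elim: r {hr} => [|r IH]; [exact: negl_G1 | apply: negl_Dop].
Qed.
End Lower.

Section Arch.
Context {F : archiRealFieldType}.

Lemma bernoulli (x : F) n : 0 <= x -> 1 + n%:R * x <= (1 + x) ^+ n.
Proof.
move=> x0; elim: n => [|n IH]; first by rewrite mul0r addr0 expr0.
rewrite exprS; apply: (@le_trans _ _ ((1 + x) * (1 + n%:R * x))); last first.
  by rewrite ler_wpM2l // addr_ge0.
have : 0 <= n%:R * x * x by rewrite !mulr_ge0.
by rewrite -natr1; lra.
Qed.

Lemma nat_above (x : F) : exists n, x <= n%:R.
Proof.
exists (Num.bound `|x|); apply: le_trans (ler_norm _) _; apply/ltW.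
by apply: archi_boundP.
Qed.

(** With m = n / (e + 1), the power contains e + 1 factors (1 + x)^m. Each grows linearly by
    Bernoulli, and only e of them are spent on the polynomial. *)
Lemma exp_dominates (x K : F) e : 0 < x -> exists n0, forall n, (n0 <= n)%N ->
  K * n.+1%:R ^+ e < (1 + x) ^+ n.
Proof.
move=> x0; pose c := (e.+1)%:R * (1 + x^-1).
have [n0 hn0] := nat_above (`|K| * c ^+ e * c).
exists n0 => n hn; pose m := (n %/ e.+1)%N.
have mn : (m * e.+1 <= n)%N by rewrite leq_divM.
have nm : (n < m.+1 * e.+1)%N by rewrite ltn_ceil.
have x1 : 0 < 1 + x^-1 by rewrite addr_gt0 ?invr_gt0.
have n1 : (n.+1%:R : F) <= c * (1 + m%:R * x).
  apply: (@le_trans _ _ ((m.+1 * e.+1)%:R)); first by rewrite ler_nat.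
  rewrite natrM mulrC /c -mulrA ler_pM2l ?ltr0n // -natr1 mulrDl mul1r mulrDr mulr1.
  rewrite mulrCA mulVf ?gt_eqF // mulr1.
  have : 0 <= m%:R * x by rewrite mulr_ge0 // ltW.
  have : 0 < x^-1 by rewrite invr_gt0.
  lra.
have c0 : 0 < c by rewrite mulr_gt0.
have y0 : 0 < 1 + m%:R * x by rewrite ltr_wpDr // mulr_ge0 // ltW.
set y := 1 + m%:R * x in n1 y0.
have c0' := ltW c0; have y0' := ltW y0.
have Ky : `|K| * c ^+ e < y.
  rewrite -(ltr_pM2r c0); apply: le_lt_trans hn0 _; rewrite mulrC.
  by apply: lt_le_trans n1; rewrite ltr_nat ltnS.
apply: (@le_lt_trans _ _ (`|K| * c ^+ e * y ^+ e)).
  rewrite -mulrA -exprMn; apply: le_trans (ler_wpM2r _ (ler_norm K)) _.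
    by rewrite exprn_ge0.
  have cy0 : 0 <= c * y by exact: (mulr_ge0 c0' y0').
  by rewrite ler_wpM2l //; apply: lerXn2r; rewrite ?nnegrE ?ler0n.
apply: (@lt_le_trans _ _ (y * y ^+ e)); first by rewrite ltr_pM2r // exprn_gt0.
rewrite -exprS; apply: (@le_trans _ _ ((1 + x) ^+ (m * e.+1))).
  rewrite exprM; apply: lerXn2r; rewrite ?nnegrE // ?exprn_ge0 ?addr_ge0 //; try exact: ltW.
  by apply: bernoulli; apply: ltW.
by apply: ler_weXn2l => //; rewrite lerDl ltW.
Qed.
End Arch.

(** * Heights of towers near typical vertices *)

Section Heights.
Context {F : archiRealFieldType}.
Variables (d : nat) (w : F) (p : {poly F}).
Hypotheses (w0 : 0 < w) (d0 : (0 < d)%N) (sp : (size p <= d.+1)%N).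
Hypothesis p_ge1 : forall j, (j <= d)%N -> 1 <= p`_j.

Lemma p_gt0 j : (j <= d)%N -> 0 < p`_j.
Proof. by move=> /p_ge1; apply: lt_le_trans. Qed.
Notation h n k := ((p ^+ n)`_k).

Definition good n k := p.[w] ^+ n / w ^+ k <= n.+1%:R ^+ 3 * h n k.
(** Distance at least n / e from both sides of the diagram, without division or truncated
    subtraction. *)
Definition zone (e n k : nat) := (n <= e * k)%N /\ (n + e * k <= e * (n * d))%N.

Lemma size_exp_bound n : (size (p ^+ n)%R <= (n * d).+1)%N.
Proof.
elim: n => [|n IH]; first by rewrite expr0 size_poly1.
rewrite exprS (leq_trans (size_polyMleq _ _)) //.
have := leq_add sp IH; clear; lia.
Qed.

Lemma good_range n k : good n k -> (k <= n * d)%N.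
Proof.
have pw := hornerp_gt0 sp p_gt0 w0.
rewrite leqNgt /good => g; apply/negP => lt; move: g.
rewrite nth_default; last by rewrite (leq_trans (size_exp_bound n)).
by rewrite mulr0 leNgt divr_gt0 // exprn_gt0.
Qed.

Lemma coef_exp_le n k x : 0 < x -> h n k * x ^+ k <= p.[x] ^+ n.
Proof.
move=> x0; rewrite -(nrm_exp x sp p_gt0); apply: le_trans (nrm_coef x0 _ k).
by rewrite ger0_norm // (coef_exp_ge0 sp p_gt0).
Qed.

(** Let (1 + x)^e0 > 2. If j were below n / (2 e0), then 2^j would be at most (1 + x)^(n/2), and the
    other half of the exponential would beat the polynomial. The inequality is squared to avoid
    halving n, whence the exponent 6. *)
Lemma exp2_zone (x : F) : 0 < x -> exists e n0, forall n j, (n0 <= n)%N ->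
  (1 + x) ^+ n <= n.+1%:R ^+ 3 * 2 ^+ j -> (n <= e * j)%N.
Proof.
move=> x0; have [e0] := exp_dominates 2 0 x0; move=> /(_ _ (leqnn _)).
rewrite expr0 mulr1 => h2.
have [n0 hn0] := exp_dominates 1 6 x0.
exists (2 * e0)%N, n0 => n j hn hj; rewrite leqNgt; apply/negP => lt.
have x1 : 1 <= 1 + x by rewrite lerDl ltW.
have x1' : 0 < 1 + x by rewrite addr_gt0.
have h3 : (2 : F) ^+ j <= (1 + x) ^+ (e0 * j).
  by rewrite exprM; apply: lerXn2r; rewrite ?nnegrE ?exprn_ge0 ?(ltW x1') ?(ltW h2).
have N1 : 0 <= (n.+1%:R : F) ^+ 3 by rewrite exprn_ge0.
have h4 : (1 + x) ^+ n <= n.+1%:R ^+ 3 * (1 + x) ^+ (e0 * j).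
  by apply: le_trans hj _; rewrite ler_wpM2l.
have h5 : ((1 + x) ^+ n) ^+ 2 <= (n.+1%:R ^+ 3) ^+ 2 * (1 + x) ^+ n.
  apply: (@le_trans _ _ ((n.+1%:R ^+ 3 * (1 + x) ^+ (e0 * j)) ^+ 2)).
    by apply: lerXn2r; rewrite ?nnegrE ?mulr_ge0 ?exprn_ge0 ?(ltW x1').
  rewrite exprMn ler_wpM2l ?exprn_ge0 // -exprM; apply: ler_weXn2l => //; lia.
have := hn0 n hn; rewrite mul1r => h6.
have N2 : 0 < (1 + x) ^+ n by rewrite exprn_gt0.
by move: h5; rewrite expr2 ler_pM2r // -exprM => /(lt_le_trans h6); rewrite ltxx.
Qed.

(* Chernoff bounds at w / 2 and 2 w keep good vertices away from the sides of
   the diagram. *)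
Lemma good_zone : exists e n0, forall n k, (n0 <= n)%N -> good n k -> zone e n k.
Proof.
have pw := hornerp_gt0 sp p_gt0 w0.
pose w1 := w / 2; have w10 : 0 < w1 by rewrite divr_gt0.
pose w2 := 2 * w; have w20 : 0 < w2 by rewrite mulr_gt0.
have pw1 := hornerp_gt0 sp p_gt0 w10; have pw2 := hornerp_gt0 sp p_gt0 w20.
have lt1 : p.[w1] < p.[w].
  rewrite !(horner_coef_wide _ sp) !big_ord_recl /= !expr0 ltrD2l.
  case: (d) d0 p_gt0 p_ge1 => // d' _ q0 q1; rewrite !big_ord_recl; apply: ltr_leD.
    rewrite ltr_pM2l ?q0 // !expr1 /w1; have := w0; lra.
  apply: ler_sum => i _; rewrite ler_wpM2l //.
    by rewrite (le_trans ler01) // q1 // /bump /= !add1n ltn_ord.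
  apply: lerXn2r; rewrite ?nnegrE ?ltW // /w1; have := w0; lra.
(* The constant coefficient of p gains a full factor 2^d on the right, which makes the inequality
   strict. *)
have lt2 : p.[w2] < 2 ^+ d * p.[w].
  rewrite !(horner_coef_wide _ sp) !big_ord_recl /= !expr0 !mulr1 mulrDr.
  apply: ltr_leD.
    rewrite -[X in X < _]mul1r ltr_pM2r ?p_gt0 // exprn_egt1 ?ltr1n //; lia.
  rewrite mulr_sumr; apply: ler_sum => i _; rewrite [X in _ <= X]mulrCA ler_wpM2l //.
    by rewrite (le_trans ler01) // p_ge1 // /bump /= add1n ltn_ord.
  rewrite /w2 exprMn ler_wpM2r // ?exprn_ge0 ?(ltW w0) //; apply: ler_weXn2l; first by rewrite ler1n.
  by rewrite /bump /= add1n ltn_ord.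
have x1 : 0 < p.[w] / p.[w1] - 1 by rewrite subr_gt0 ltr_pdivlMr // mul1r.
have x2 : 0 < 2 ^+ d * p.[w] / p.[w2] - 1 by rewrite subr_gt0 ltr_pdivlMr // mul1r.
have [e1 [n1 h1]] := exp2_zone x1; have [e2 [n2 h2]] := exp2_zone x2.
exists (maxn e1 e2), (maxn n1 n2) => n k; rewrite geq_max => /andP[hn1 hn2] g.
have kn := good_range g.
have wk : 0 < w ^+ k by rewrite exprn_gt0.
have key x : 0 < x -> (p.[w] / p.[x]) ^+ n * x ^+ k <= n.+1%:R ^+ 3 * w ^+ k.
  move=> x0; have px := hornerp_gt0 sp p_gt0 x0.
  rewrite expr_div_n mulrAC ler_pdivrMr ?exprn_gt0 // [X in _ <= X]mulrAC -mulrA.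
  rewrite [p.[w] ^+ n * _]mulrC.
  move: g; rewrite /good ler_pdivrMr // => g.
  apply: (@le_trans _ _ (x ^+ k * (n.+1%:R ^+ 3 * h n k * w ^+ k))).
    by rewrite ler_wpM2l // exprn_ge0 // ltW.
  have := coef_exp_le n k x0 => hh.
  rewrite [X in X <= _](_ : _ = n.+1%:R ^+ 3 * w ^+ k * (h n k * x ^+ k)); last by ring.
  by rewrite -mulrA [w ^+ k * _]mulrC ler_wpM2l ?exprn_ge0 // ler_wpM2r ?exprn_ge0 // ltW.
have a1 : (n <= e1 * k)%N.
  apply: h1 => //.
  have ew : w1 ^+ k = w ^+ k / 2 ^+ k by rewrite expr_div_n.
  rewrite addrC subrK; have := key w1 w10; rewrite ew mulrA ler_pdivrMr ?exprn_gt0 //.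
  by rewrite [X in _ <= X]mulrAC ler_pM2r.
have a2 : (n <= e2 * (n * d - k))%N.
  apply: h2 => //.
  have ew : w2 ^+ k = 2 ^+ k * w ^+ k by rewrite exprMn.
  rewrite addrC subrK.
  have := key w2 w20; rewrite ew mulrA ler_pM2r // => hk.
  rewrite -(@ler_pM2r _ (2 ^+ k)) ?exprn_gt0 // -[X in _ <= X]mulrA -exprD subnK //.
  have -> : (2 ^+ d * p.[w] / p.[w2]) ^+ n = (p.[w] / p.[w2]) ^+ n * 2 ^+ (n * d).
    by rewrite -mulrA exprMn -exprM mulrC [(d * n)%N]mulnC.
  by rewrite mulrAC ler_pM2r ?exprn_gt0.
split; first by apply: leq_trans a1 _; rewrite leq_mul2r leq_maxl orbT.
have : (n <= maxn e1 e2 * (n * d - k))%N.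
  by apply: leq_trans a2 _; rewrite leq_mul2r leq_maxr orbT.
rewrite mulnBr => hh; have : (maxn e1 e2 * k <= maxn e1 e2 * (n * d))%N by rewrite leq_mul2l kn orbT.
by move=> le; rewrite addnC -leq_subRL.
Qed.

(** The derivative p' has degree below d and the coefficients of p up to degree d are at least 1, so
    p' <= C p coefficientwise. *)
Lemma deriv_dominated : exists2 C, 0 < C & forall n k, (p^`() * p ^+ n)`_k <= C * h n.+1 k.
Proof.
exists (\sum_(j < d) p`_j.+1 *+ j.+1) => [|n k].
  rewrite (bigD1 (Ordinal d0)) //=; apply: ltr_wpDr; last by rewrite mulrn_wgt0 // p_gt0.
  by apply: sumr_ge0 => i _; rewrite mulrn_wge0 // ltW // p_gt0.
set C := \sum_(_ < _) _.
have C0 : 0 <= C by apply: sumr_ge0 => i _; rewrite mulrn_wge0 // ltW // p_gt0.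
rewrite exprS !coefM mulr_sumr; apply: ler_sum => i _.
rewrite mulrA ler_wpM2r ?(coef_exp_ge0 sp p_gt0) // coef_deriv.
case: (ltnP i d) => id; last first.
  by rewrite (@nth_default _ _ p) ?mul0rn ?mulr_ge0 ?(coefp_ge0 sp p_gt0) // (leq_trans sp).
apply: (@le_trans _ _ C); last by rewrite ler_peMr // p_ge1 // ltnW.
rewrite /C (bigD1 (Ordinal id)) //= lerDl.
by apply: sumr_ge0 => j _; rewrite mulrn_wge0 // ltW // p_gt0.
Qed.

(** The mirror image of [deriv_dominated]: d p - X p' has no term of degree d, so X times it still
    has degree at most d and is dominated by p. *)
Lemma coderiv_dominated : exists2 C, 0 < C &
  forall n k, ('X * (d%:R * p - 'X * p^`()) * p ^+ n)`_k <= C * h n.+1 k.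
Proof.
pose q := d%:R * p - 'X * p^`().
have qE j : q`_j = (d%:R - j%:R) * p`_j.
  rewrite /q coefB coef_XderivM -polyC_natr coefCM; ring.
exists (\sum_(j < d) (d%:R * p`_j)) => [|n k].
  rewrite (bigD1 (Ordinal d0)) //=; apply: ltr_wpDr; last by rewrite mulr_gt0 ?ltr0n // p_gt0.
  by apply: sumr_ge0 => i _; rewrite mulr_ge0 // ltW // p_gt0 // ltnW.
set C := \sum_(_ < _) _.
have t0 (i : 'I_d) : 0 <= d%:R * p`_i by rewrite mulr_ge0 // ltW // p_gt0 // ltnW.
have C0 : 0 <= C by apply: sumr_ge0 => i _.
rewrite exprS !coefM mulr_sumr; apply: ler_sum => i _.
rewrite mulrA ler_wpM2r ?(coef_exp_ge0 sp p_gt0) // coefXM.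
case: (nat_of_ord i) => [|j] /=; first by rewrite mulr_ge0 // (coefp_ge0 sp p_gt0).
rewrite qE; case: (ltnP j d) => jd; last first.
  rewrite (_ : _ * _ = 0) ?mulr_ge0 ?(coefp_ge0 sp p_gt0) //.
  case: (ltnP d j) => dj; first by rewrite (@nth_default _ _ p) ?mulr0 // (leq_trans sp).
  by rewrite (_ : j = d) ?subrr ?mul0r //; apply/eqP; rewrite eqn_leq dj jd.
apply: (@le_trans _ _ C); last by rewrite ler_peMr // p_ge1.
apply: (@le_trans _ _ (d%:R * p`_j)).
  by rewrite ler_wpM2r ?(coefp_ge0 sp p_gt0) // gerBl.
rewrite /C (bigD1 (Ordinal jd)) //= lerDl.
by apply: sumr_ge0.
Qed.

(** k h(n,k) is n times the coefficient of p' p^(n-1) at k - 1, and k is at least n / e. *)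
Lemma h_pred e : exists2 C, 1 <= C & forall n k, (n <= e * k)%N -> (0 < n)%N ->
  h n k <= C * h n k.-1.
Proof.
have [C C0 hC] := deriv_dominated; exists (1 + e%:R * C) => [|[//|n] [|k] hk _].
- by rewrite lerDl mulr_ge0 // ltW.
- by rewrite muln0 in hk.
rewrite /=; have H0 : 0 <= h n.+1 k by apply: coef_exp_ge0 sp p_gt0 _ _.
apply: (@le_trans _ _ (e%:R * C * h n.+1 k)); last by rewrite ler_wpM2r // lerDr.
have H1 : 0 <= h n.+1 k.+1 by apply: coef_exp_ge0 sp p_gt0 _ _.
have e1 : k.+1%:R * h n.+1 k.+1 = n.+1%:R * (p^`() * p ^+ n)`_k.
  have := coef_XderivM (p ^+ n.+1) k.+1; rewrite coefXM /= => <-.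
  by rewrite deriv_expS -polyC_natr coefCM.
have n0 : 0 < n.+1%:R :> F by rewrite ltr0n.
rewrite -(ler_pM2l n0); apply: (@le_trans _ _ ((e * k.+1)%:R * h n.+1 k.+1)).
  by rewrite ler_wpM2r // ler_nat.
rewrite natrM -mulrA e1 mulrCA ler_wpM2l ?ler0n //.
by rewrite -mulrA ler_wpM2l.
Qed.

(** As [h_pred], starting from (n d - k) h(n,k) and the polynomial d p - X p'. *)
Lemma h_succ e : exists2 C, 1 <= C & forall n k, (n + e * k <= e * (n * d))%N -> (0 < n)%N ->
  h n k <= C * h n k.+1.
Proof.
have [C C0 hC] := coderiv_dominated; exists (1 + e%:R * C) => [|[//|n] k hk _].
  by rewrite lerDl mulr_ge0 // ltW.
have H0 : 0 <= h n.+1 k.+1 by apply: coef_exp_ge0 sp p_gt0 _ _.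
apply: (@le_trans _ _ (e%:R * C * h n.+1 k.+1)); last by rewrite ler_wpM2r // lerDr.
have H1 : 0 <= h n.+1 k by apply: coef_exp_ge0 sp p_gt0 _ _.
have e1 : ((n.+1 * d)%:R - k%:R) * h n.+1 k = n.+1%:R * ('X * (d%:R * p - 'X * p^`()) * p ^+ n)`_k.+1.
  have -> : n.+1%:R * ('X * (d%:R * p - 'X * p^`()) * p ^+ n)`_k.+1 =
     ((n.+1%:R : F)%:P * ((d%:R * p - 'X * p^`()) * p ^+ n))`_k.
    by rewrite coefCM -[in LHS]mulrA coefXM.
  rewrite mulrBl -coef_XderivM deriv_expS -coefCM natrM polyCM !polyC_natr -coefB.
  by apply: (congr1 (fun g : {poly F} => g`_k)); rewrite exprS; ring.
have n0 : 0 < n.+1%:R :> F by rewrite ltr0n.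
rewrite -(ler_pM2l n0); apply: (@le_trans _ _ (e%:R * ((n.+1 * d)%:R - k%:R) * h n.+1 k)).
  rewrite ler_wpM2r // mulrBr -!natrM lerBrDr -natrD ler_nat //.
rewrite -mulrA e1 mulrCA ler_wpM2l ?ler0n //.
by rewrite -[X in _ <= X]mulrA ler_wpM2l.
Qed.

Lemma h_rec n k : (d <= k)%N -> h n.+1 k = \sum_(j < d.+1) p`_j * h n (k - j).
Proof.
move=> dk; rewrite exprS coefM.
rewrite [RHS](big_ord_widen k.+1 (fun j => p`_j * h n (k - j))) ?ltnS //.
rewrite [RHS]big_mkcond /=; apply: eq_bigr => i _; rewrite ltnS.
by case: (leqP i d) => // di; rewrite nth_default ?mul0r // (leq_trans sp).
Qed.

(** One level down the margins shrink by a bounded amount, which doubling e absorbs for large n. *)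
Lemma zone_step e n k i : zone e n.+1 k -> (2 * (e * d) <= n)%N -> (i <= d)%N ->
  zone (2 * e) n (k - i) /\ (d <= k)%N.
Proof.
case=> z1 z2 hn hi.
have e0 : (0 < e)%N by case: (e) z1.
have dk : (d <= k)%N by rewrite -(@leq_pmul2l e) //; clear -z1 hn; lia.
split=> //; split.
  have : (e * (k - i) + e * i = e * k)%N by rewrite -mulnDr subnK // (leq_trans hi).
  have : (e * i <= e * d)%N by rewrite leq_mul2l hi orbT.
  by clear -z1 z2 hn; nia.
have : (e * (k - i) <= e * k)%N by rewrite leq_mul2l leq_subr orbT.
by clear -z1 z2 hn; nia.
Qed.

(** h(n+1,k) is a combination of d + 1 neighbouring heights at level n, and neighbours are
    comparable inside the zone. *)
Lemma h_step e : exists2 C, 1 <= C & forall n k i, zone e n.+1 k ->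
  (2 * (e * d) < n)%N -> (i <= d)%N -> h n.+1 k <= C * h n (k - i).
Proof.
have [C1 C11 h1] := h_pred (2 * e); have [C2 C21 h2] := h_succ (2 * e).
have C1' := le_trans ler01 C11; have C2' := le_trans ler01 C21.
pose S := \sum_(j < d.+1) p`_j.
have S0 : 0 <= S by apply: sumr_ge0 => j _; rewrite (coefp_ge0 sp p_gt0).
exists (1 + S * (C1 ^+ d * C2 ^+ d)) => [|n k i z hn hi].
  by rewrite lerDl !mulr_ge0 ?exprn_ge0.
have n0 : (0 < n)%N by apply: leq_trans hn.
have hz j : (j <= d)%N -> zone (2 * e) n (k - j).
  by move=> hj; have [] := zone_step z (ltnW hn) hj.
have dk : (d <= k)%N by have [] := zone_step z (ltnW hn) hi.
have H m c : 0 <= h m c by apply: coef_exp_ge0 sp p_gt0 _ _.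
have up t j : (j + t <= d)%N -> h n (k - j) <= C1 ^+ t * h n (k - (j + t)).
  elim: t => [|t IH] le; first by rewrite addn0 expr0 mul1r.
  apply: le_trans (IH _) _; first by rewrite addnS in le; apply: ltnW.
  rewrite exprSr -mulrA ler_wpM2l ?exprn_ge0 //.
  have [z1 _] := hz (j + t)%N (ltnW (eq_ind _ (fun x => (x <= d)%N) le _ (addnS j t))).
  by have := h1 n _ z1 n0; rewrite addnS subnS.
have dn t j : (j + t <= d)%N -> h n (k - (j + t)) <= C2 ^+ t * h n (k - j).
  elim: t => [|t IH] le; first by rewrite addn0 expr0 mul1r.
  rewrite addnS in le.
  have [_ z2] := hz (j + t).+1 le.
  have := h2 n _ z2 n0; rewrite -subSn ?subSS; last by apply: leq_trans dk.
  rewrite addnS => /le_trans; apply; rewrite exprS -mulrA ler_wpM2l // IH // ltnW //.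
have cmp j : (j <= d)%N -> h n (k - j) <= C1 ^+ d * C2 ^+ d * h n (k - i).
  move=> hj.
  have q1 t : (t <= d)%N -> C1 ^+ t <= C1 ^+ d by move=> td; apply: ler_weXn2l.
  have q2 t : (t <= d)%N -> C2 ^+ t <= C2 ^+ d by move=> td; apply: ler_weXn2l.
  case: (leqP j i) => ji.
    have := up (i - j)%N j; rewrite subnKC // => /(_ hi) /le_trans; apply.
    rewrite ler_wpM2r //; apply: le_trans (q1 _ (leq_trans (leq_subr _ _) hi)) _.
    by rewrite ler_peMr ?exprn_ge0 // exprn_ege1.
  have := dn (j - i)%N i; rewrite subnKC ?(ltnW ji) // => /(_ hj) /le_trans; apply.
  rewrite ler_wpM2r //; apply: le_trans (q2 _ (leq_trans (leq_subr _ _) hj)) _.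
  by rewrite ler_peMl ?exprn_ge0 // exprn_ege1.
rewrite h_rec //; apply: (@le_trans _ _ (S * (C1 ^+ d * C2 ^+ d * h n (k - i)))).
  rewrite /S mulr_suml; apply: ler_sum => j _.
  by rewrite ler_wpM2l ?(coefp_ge0 sp p_gt0) // cmp // -ltnS.
by rewrite mulrA ler_wpM2r // lerDr.
Qed.

Lemma h_steps m e : exists C n0, 0 < C /\ forall n k i, (n0 <= n)%N -> zone e n k ->
  (i <= m * d)%N -> h n k <= C * h (n - m) (k - i).
Proof.
elim: m e => [|m IH] e.
  exists 1, 0%N; split=> // n k i _ _; rewrite mul0n leqn0 => /eqP ->.
  by rewrite !subn0 mul1r.
have [C [n0 [C0 hC]]] := IH (2 * e)%N; have [C' C1 hC'] := h_step e.
have C'0 := lt_le_trans ltr01 C1.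
exists (C' * C), (maxn n0 (2 * (e * d)).+1).+1; split=> [|[//|n] k i]; first exact: mulr_gt0.
rewrite ltnS geq_max => /andP[nn0 ne] z hi.
pose i1 := minn i d; have i1d : (i1 <= d)%N by rewrite geq_minr.
have [z' dk] := zone_step z (ltnW ne) i1d.
apply: le_trans (hC' _ _ _ z ne i1d) _; rewrite -mulrA ler_pM2l // subSS.
have -> : (k - i = k - i1 - (i - i1))%N by rewrite -subnDA subnKC // geq_minl.
apply: hC => //; rewrite /i1 minnE.
by move: hi; clear; rewrite mulSn; lia.
Qed.

End Heights.

(** * Decay relative to the oscillation D *)

Section Final.
Context {F : archiRealFieldType}.
Variables (d N : nat) (w gm : F) (p G : {poly F}).
Hypotheses (w0 : 0 < w) (d0 : (0 < d)%N) (sp : (size p <= d.+1)%N).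
Hypothesis p_ge1 : forall j, (j <= d)%N -> 1 <= p`_j.
Hypothesis gm0 : 0 <= gm.
Notation z := ('X - w%:P).
Notation Gam := (Gam N p G).
Notation h n k := ((p ^+ n)`_k).
Let p_gt0 := p_gt0 p_ge1.
Let pw : 0 < p.[w] := hornerp_gt0 sp p_gt0 w0.
Let pw' : 0 <= p.[w] := ltW pw.

Definition W := Num.max 1 (w ^+ d).
(** Descending one level along an edge of type i contributes w^i / p(w); this bounds it for all i <=
    d. *)
Definition theta := W / p.[w].

Lemma W_ge1 : 1 <= W. Proof. by rewrite le_max lexx. Qed.

(** The terms of degree 0 and d, distinct since d >= 1, already give p(w) >= 1 + w^d > W. *)
Lemma theta_bounds : 0 < theta < 1.
Proof.
have W0 := lt_le_trans ltr01 W_ge1.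
rewrite /theta divr_gt0 //= ltr_pdivrMr // mul1r /W.
have : 1 + w ^+ d <= p.[w].
  rewrite (horner_coef_wide _ sp) big_ord_recr /=; apply: lerD; last first.
    by rewrite ler_peMl ?exprn_ge0 ?p_ge1 // ltW.
  case: (d) d0 p_ge1 p_gt0 => // d' _ q1 q2; rewrite big_ord_recl expr0 mulr1.
  rewrite -[1]addr0; apply: lerD; first exact: q1.
  apply: sumr_ge0 => i _; rewrite mulr_ge0 ?exprn_ge0 ?(ltW w0) // ltW // q2 //.
  by apply: leqW; exact: ltn_ord.
have wd : 0 < w ^+ d by rewrite exprn_gt0.
by rewrite gt_max => hh; apply/andP; split; apply: lt_le_trans hh; rewrite ?ltrDl ?ltrDr.
Qed.

Lemma wexp_le m i : (i <= m * d)%N -> w ^+ i <= W ^+ m.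
Proof.
move=> im; have W1 := W_ge1; have W0 := le_trans ler01 W1; case: (lerP w 1) => hw.
  apply: (@le_trans _ _ 1); first by apply: exprn_ile1 => //; apply: ltW.
  by rewrite exprn_ege1.
apply: (@le_trans _ _ (w ^+ (m * d))); first by apply: ler_weXn2l => //; apply: ltW.
rewrite mulnC exprM; apply: lerXn2r; rewrite ?nnegrE ?exprn_ge0 ?(ltW w0) //.
by rewrite /W le_max lexx orbT.
Qed.

Lemma poly_exp_absorb (th : F) e : 0 < th < 1 -> exists rho K, [/\ 0 < rho < 1, 0 <= K &
  forall m, th ^+ m * m.+1%:R ^+ e <= K * rho ^+ m].
Proof.
case/andP=> t0 t1; pose rho := (1 + th) / 2.
have r1 : 0 < rho < 1 by rewrite /rho; apply/andP; split; lra.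
have x0 : 0 < rho / th - 1 by rewrite subr_gt0 ltr_pdivlMr // mul1r /rho; lra.
have [n0 hn] := exp_dominates 1 e x0.
exists rho, (n0.+1%:R ^+ e + 1); split=> // [|m]; first by rewrite addr_ge0 // exprn_ge0.
have y1 : 1 <= rho / th by rewrite -subr_ge0 ltW.
have key : m.+1%:R ^+ e <= (n0.+1%:R ^+ e + 1) * (rho / th) ^+ m.
  have y2 : 1 <= (rho / th) ^+ m by rewrite exprn_ege1.
  have c0 : 0 <= (n0.+1%:R : F) ^+ e by rewrite exprn_ge0.
  case: (leqP n0 m) => nm.
    have := hn m nm; rewrite mul1r addrC subrK => /ltW /le_trans; apply.
    by rewrite ler_peMl ?(le_trans ler01) // lerDr.
  apply: (@le_trans _ _ (n0.+1%:R ^+ e)).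
    by apply: lerXn2r; rewrite ?nnegrE // ler_nat ltnS ltnW.
  by rewrite -[X in X <= _]mulr1; apply: ler_pM => //; rewrite lerDl.
apply: le_trans (ler_wpM2l (exprn_ge0 m (ltW t0)) key) _.
rewrite mulrCA ler_wpM2l ?addr_ge0 ?exprn_ge0 // -exprMn mulrC divfK // gt_eqF //.
Qed.

Lemma theta_pow m i : (i <= m * d)%N -> p.[w]^-1 ^+ m * w ^+ i <= theta ^+ m.
Proof.
by move=> im; rewrite /theta exprMn mulrC ler_wpM2r ?exprn_ge0 ?invr_ge0 // wexp_le.
Qed.

(** Since k <= n d, the quantity p(w)^n w^(-k) is at least theta^(-n), which outgrows n^3. *)
Lemma good_large B : exists n0, forall n k, (n0 <= n)%N -> good w p n k -> B <= h n k.
Proof.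
have /andP[t0 t1] := theta_bounds.
have x0 : 0 < theta^-1 - 1 by rewrite subr_gt0 invf_gt1.
have [n0 hn] := exp_dominates B 3 x0; exists n0 => n k nn g.
have kn := good_range w0 sp p_ge1 g.
have N3 : 0 < (n.+1%:R : F) ^+ 3 by rewrite exprn_gt0 // ltr0n.
rewrite -(ler_pM2l N3); apply: le_trans g; rewrite mulrC.
apply: le_trans (ltW (hn _ nn)) _; rewrite addrC subrK.
rewrite /theta invf_div expr_div_n ler_wpM2l ?exprn_ge0 //.
by rewrite lef_pV2 ?posrE ?exprn_gt0 ?wexp_le // (lt_le_trans ltr01 W_ge1).
Qed.

Lemma coef_Xn_mul (f g : {poly F}) i k : (i <= k)%N -> (f * 'X^i * g)`_k = (f * g)`_(k - i).
Proof. by move=> ik; rewrite mulrAC coefMXn ltnNge ik. Qed.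

(** Expanding (X - w)^l turns these coefficients into combinations of neighbouring tower sums on one
    level. *)
Lemma lam_bound A : exists2 K, 0 <= K & forall f n k D, 0 <= D ->
  (forall i, (i <= 2 * A)%N -> `|(f * 'X^i * p ^+ n)`_k| <= 2 * D) ->
  forall l, (l < 2 * A)%N -> `|(f * z ^+ l * p ^+ n)`_k| <= K * D.
Proof.
pose K := \sum_(l < 2 * A) \sum_(i < (2 * A).+1) 2 * `|(z ^+ l)`_i|.
have t0 l : 0 <= \sum_(i < (2 * A).+1) 2 * `|(z ^+ l)`_i| by apply: sumr_ge0 => i _; rewrite mulr_ge0.
exists K => [|f n k D D0 H l lA]; first by apply: sumr_ge0.
apply: (@le_trans _ _ ((\sum_(i < (2 * A).+1) 2 * `|(z ^+ l)`_i|) * D)); last first.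
  by rewrite ler_wpM2r // /K (bigD1 (Ordinal lA)) //= lerDl sumr_ge0.
have ez : z ^+ l = \sum_(i < (2 * A).+1) (z ^+ l)`_i *: 'X^i.
  have sz : (size (z ^+ l)%R <= (2 * A).+1)%N by rewrite size_exp_XsubC leqW.
  apply/polyP => j; rewrite coef_sum; case: (ltnP j (2 * A).+1) => hj.
    rewrite (bigD1 (Ordinal hj)) //= coefZ coefXn eqxx mulr1 big1 ?addr0 // => i ne.
    rewrite coefZ coefXn; case: eqP => [e|]; rewrite ?mulr0 //.
    by case/eqP: ne; apply: val_inj.
  rewrite nth_default ?(leq_trans sz) // big1 // => i _; rewrite coefZ coefXn.
  by case: eqP => [e|]; rewrite ?mulr0 //; move: (ltn_ord i); rewrite -e ltnNge hj.
have -> : (f * z ^+ l * p ^+ n)`_k = \sum_(i < (2 * A).+1) (z ^+ l)`_i * (f * 'X^i * p ^+ n)`_k.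
  rewrite {1}ez mulr_sumr mulr_suml coef_sum; apply: eq_bigr => i _.
  by rewrite -coefZ; apply: (congr1 (fun g : {poly F} => g`_k)); rewrite -!mul_polyC; ring.
apply: le_trans (ler_norm_sum _ _ _) _; rewrite mulr_suml; apply: ler_sum => i _.
rewrite normrM [2 * _]mulrC -[X in _ <= X]mulrA ler_wpM2l //; apply: H; rewrite -ltnS //.
Qed.

Theorem block_decay : (forall c, G <> c *: p ^+ N) ->
  exists K rho M n0, [/\ 0 <= K, 0 < rho < 1, (N <= M)%N & forall n k s D, (n0 <= n)%N ->
   good w p n k -> `|s| <= gm -> (M + N <= n)%N /\
   ((forall i, (i <= M * d)%N -> (i <= k)%N -> `|(Gam s * p ^+ (n - M - N))`_(k - i)| <= 2 * D) ->
   [/\ 0 < D,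
     forall m i, (M <= m)%N -> (m + m <= n)%N -> (i <= m * d)%N -> (i <= k)%N ->
       `|(Gam s * p ^+ (n - m - N))`_(k - i)| <= K * rho ^+ m * D &
     forall m i, (n <= 4 * m)%N -> (m <= n)%N -> (i <= m * d)%N -> (i <= k)%N ->
       h (n - m) (k - i) <= K * rho ^+ m * D])].
Proof.
move=> hG.
have [r hr] := lower_bound (2 * d) w0 d0 sp p_gt0 gm0 hG.
(* r for the loss in [lower_bound], 3 for the exponent in [good], and one more power of n to win. *)
pose A := (r + 4)%N; have A0 : (0 < A)%N by rewrite /A addnC.
(* M >= 2 A puts all shifts X^i with i <= 2 A among the vertices M levels down; M >= N gives 2 (m -
   M) <= n - M - N below. *)
pose M := (2 * A + N)%N.
(* The factor p^(M+N) restores p^n from p^v, where v = n - M - N. *)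
have [K4 K40 h4] := hr A A0 (p ^+ (M + N)).
have [K1 K10 h1] := upper N G w0 d0 sp p_gt0 gm0 A0 1 (add0n (2 * A)%N).
have [K3 K30 h3] := lam_bound A.
have [rho [K5 [r01 K50 h5]]] := poly_exp_absorb (2 * A) theta_bounds.
have /andP[rho0 _] := r01.
have [n1 hn1] := nat_above (K4 * (M + N).+1%:R ^+ 3 / p.[w] ^+ (M + N)).
pose Ka := K1 * K3 * p.[w] ^+ M * (d.+1)%:R ^+ (2 * A) * K5.
pose Kb := p.[w] ^+ (M + N) * 4 ^+ A * K3 * K5.
have Ka0 : 0 <= Ka by rewrite !mulr_ge0 ?exprn_ge0.
have Kb0 : 0 <= Kb by rewrite !mulr_ge0 ?exprn_ge0.
exists (Ka + Kb), rho, M, (n1 + (M + N) + (M + N))%N; split=> // [||n k s D nn g hs]; first by rewrite addr_ge0.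
  by rewrite leq_addl.
have MN : (M + N <= n)%N by apply: leq_trans nn; rewrite leq_addl.
split=> // hD.
have D0 : 0 <= D.
  by have := hD 0%N (leq0n _) (leq0n _) => /(le_trans (normr_ge0 _)); rewrite pmulr_rge0.
pose v := (n - M - N)%N.
have nv : n = (v + (M + N))%N by rewrite /v -subnDA subnK.
have ev : (n - M - N)%N = v by [].
move: v nv ev => v nv ev; rewrite ev in hD.
have kn := good_range w0 sp p_ge1 g.
have v1 : (n1 <= v)%N by move: nn; rewrite nv leq_add2r => /(leq_trans (leq_addr _ _)).
have v2 : (M + N <= v)%N by move: nn; rewrite nv leq_add2r; apply: leq_trans; rewrite leq_addl.
have kv : (k <= 2 * d * v.+1)%N.
  apply: leq_trans kn _; rewrite nv [X in (_ <= X)%N]mulnAC leq_mul2r; apply/orP; right.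
  by clear -v2; lia.
have lam l : (l < 2 * A)%N -> `|(Gam s * z ^+ l * p ^+ v)`_k| <= K3 * D.
  apply: h3 => // i iA; case: (leqP i k) => ik.
    rewrite coef_Xn_mul // hD //; apply: leq_trans iA _; rewrite /M.
    by apply: leq_trans (leq_addr N _) _; rewrite leq_pmulr.
  by rewrite mulrAC coefMXn ik normr0 mulr_ge0.
have V0 : 0 < (v.+1%:R : F) by rewrite ltr0n.
have wk : 0 < w ^+ k by rewrite exprn_gt0.
have eP : p.[w] ^+ n / w ^+ k = p.[w] ^+ (M + N) * v.+1%:R ^+ A * rmd A w p v k.
  rewrite /rmd nv exprD; have := expf_neq0 A (lt0r_neq0 V0); have := lt0r_neq0 wk.
  by move: (v.+1%:R ^+ A) (w ^+ k) => x y y0 x0; field; rewrite x0 y0.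
(* Otherwise all coefficients in [small] are below rmd, and [lower_bound] makes
   h n k too small for a good vertex. *)
have rK : rmd A w p v k <= K3 * D.
  case: (lerP (rmd A w p v k) (K3 * D)) => // lt.
  have sm : small N A w gm p G v k s (rmd A w p v k).
    by split=> // l lA; apply: le_trans (lam l lA) (ltW lt).
  have := h4 s v k _ sm kv; rewrite -exprD addnC -nv ger0_norm ?(coef_exp_ge0 sp p_gt0) // => up.
  have : p.[w] ^+ n / w ^+ k <= n.+1%:R ^+ 3 * (K4 * v.+1%:R ^+ r * rmd A w p v k).
    by apply: le_trans g _; rewrite ler_wpM2l // exprn_ge0.
  rewrite eP.
  have -> : n.+1%:R ^+ 3 * (K4 * v.+1%:R ^+ r * rmd A w p v k) =
     n.+1%:R ^+ 3 * K4 * v.+1%:R ^+ r * rmd A w p v k by rewrite !mulrA.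
  rewrite ler_pM2r; last exact: (rmd_gt0 A w0 sp p_gt0).
  have -> : v.+1%:R ^+ A = v.+1%:R ^+ r * v.+1%:R ^+ 4 :> F by rewrite -exprD.
  rewrite mulrCA [X in _ <= X]mulrC.
  rewrite ler_pM2l ?exprn_gt0 // => up2.
  have n3 : (n.+1%:R : F) ^+ 3 <= (v.+1%:R * (M + N).+1%:R) ^+ 3.
    apply: lerXn2r; rewrite ?nnegrE ?mulr_ge0 // -natrM ler_nat nv; clear; nia.
  have {}up2 : p.[w] ^+ (M + N) * v.+1%:R ^+ 4 <= (v.+1%:R * (M + N).+1%:R) ^+ 3 * K4.
    by apply: le_trans up2 _; rewrite ler_wpM2r.
  have up3 : v.+1%:R <= K4 * (M + N).+1%:R ^+ 3 / p.[w] ^+ (M + N).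
    rewrite ler_pdivlMr ?exprn_gt0 // -(@ler_pM2r _ (v.+1%:R ^+ 3)) ?exprn_gt0 //.
    have -> : v.+1%:R * p.[w] ^+ (M + N) * v.+1%:R ^+ 3 = p.[w] ^+ (M + N) * v.+1%:R ^+ 4 by ring.
    by apply: le_trans up2 _; rewrite exprMn; rewrite le_eqVlt; apply/orP; left; apply/eqP; ring.
  by have := le_trans up3 hn1; rewrite ler_nat ltnNge v1.
have rm0 : 0 < rmd A w p v k by exact: (rmd_gt0 A w0 sp p_gt0).
have Dp : 0 < D.
  rewrite lt_neqAle D0 andbT; apply/negP => /eqP e; move: (lt_le_trans rm0 rK).
  by rewrite -e mulr0 ltxx.
have sm : small N A w gm p G v k s (K3 * D) by split.
split=> // m i.
  move=> Mm mn im ik; pose m' := (m - M)%N.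
  have em : m = (m' + M)%N by rewrite subnK.
  have m'v : (m' + m' <= v)%N.
    by move: mn; rewrite em nv; rewrite /M; clear; lia.
  have := h1 s v k m' i _ sm m'v; rewrite expr0 !mulr1 coef_Xn_mul //.
  have -> : (v - m' = n - m - N)%N by rewrite em nv; clear -m'v; lia.
  move/le_trans; apply.
  have c1 : p.[w]^-1 ^+ m' = p.[w]^-1 ^+ m * p.[w] ^+ M.
    by rewrite em exprD -mulrA -exprMn mulVf ?gt_eqF // expr1n mulr1.
  have c2 : (1 + m' + i)%:R ^+ (2 * A) <= (d.+1)%:R ^+ (2 * A) * (m.+1%:R : F) ^+ (2 * A).
    rewrite -exprMn; apply: lerXn2r; rewrite ?nnegrE ?mulr_ge0 // -natrM ler_nat.
    by move: im; rewrite em; clear; nia.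
  have t1 := theta_pow im; have t2 := h5 m.
  have q0 : 0 <= p.[w]^-1 by rewrite invr_ge0.
  apply: (@le_trans _ _ (Ka * rho ^+ m * D)); last first.
    by rewrite ler_wpM2r // ler_wpM2r ?exprn_ge0 ?(ltW rho0) // lerDl.
  rewrite /Ka c1.
  apply: (@le_trans _ _ (K1 * K3 * p.[w] ^+ M * D * ((p.[w]^-1 ^+ m * w ^+ i) * (d.+1%:R ^+ (2 * A) * m.+1%:R ^+ (2 * A))))).
    rewrite [X in X <= _](_ : _ = K1 * K3 * p.[w] ^+ M * D * ((p.[w]^-1 ^+ m * w ^+ i) * (1 + m' + i)%:R ^+ (2 * A))); last by ring.
    by rewrite ler_wpM2l ?ler_wpM2l ?mulr_ge0 ?exprn_ge0 ?(ltW w0).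
  rewrite [X in _ <= X](_ : _ = K1 * K3 * p.[w] ^+ M * D * (d.+1%:R ^+ (2 * A) * (K5 * rho ^+ m))); last by ring.
  rewrite ler_wpM2l ?mulr_ge0 ?exprn_ge0 // mulrCA ler_wpM2l ?exprn_ge0 //.
  by apply: le_trans t2; rewrite ler_wpM2r ?exprn_ge0.
(* The trivial bound p(w)^(n-m) w^(i-k) is at most theta^m p(w)^n w^(-k). Here p(w)^n w^(-k) is a
   constant times (v+1)^A times the remainder, which is at most K3 D, and n <= 4 m bounds (v+1)^A by
   a polynomial in m. *)
move=> nm mn im ik.
have t1 := theta_pow im; have t2 := h5 m.
have q0 : 0 <= p.[w]^-1 by rewrite invr_ge0.
apply: (@le_trans _ _ (Kb * rho ^+ m * D)); last first.
  by rewrite ler_wpM2r // ler_wpM2r ?exprn_ge0 ?(ltW rho0) // lerDr.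
apply: (@le_trans _ _ (p.[w]^-1 ^+ m * w ^+ i * (p.[w] ^+ n / w ^+ k))).
  have wki : 0 < w ^+ (k - i) by rewrite exprn_gt0.
  rewrite -(ler_pM2r wki); apply: le_trans (coef_exp_le sp p_ge1 _ _ w0) _.
  rewrite [X in X <= _](_ : _ = p.[w]^-1 ^+ m * p.[w] ^+ n); last first.
    by rewrite -[in RHS](subnK mn) exprD mulrCA -exprMn mulVf ?gt_eqF // expr1n mulr1.
  rewrite -[k in w ^- k](subnK ik) exprD le_eqVlt; apply/orP; left; apply/eqP.
  by field; rewrite !expf_neq0 // ?gt_eqF.
rewrite eP.
have vA : v.+1%:R ^+ A <= 4 ^+ A * m.+1%:R ^+ (2 * A) :> F.
  apply: (@le_trans _ _ (4 ^+ A * m.+1%:R ^+ A)).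
    rewrite -exprMn; apply: lerXn2r; rewrite ?nnegrE ?mulr_ge0 // -natrM ler_nat.
    by move: nm; rewrite nv; clear; lia.
  by rewrite ler_wpM2l ?exprn_ge0 //; apply: ler_weXn2l; rewrite ?ler1n //; clear; lia.
have PMN : 0 <= p.[w] ^+ (M + N) by rewrite exprn_ge0.
apply: (@le_trans _ _ (theta ^+ m * (p.[w] ^+ (M + N) * (4 ^+ A * m.+1%:R ^+ (2 * A)) * (K3 * D)))).
  have g1 : 0 <= p.[w]^-1 ^+ m * w ^+ i by rewrite mulr_ge0 // exprn_ge0 // ltW.
  have g3 : 0 <= p.[w] ^+ (M + N) * v.+1%:R ^+ A by rewrite mulr_ge0 // exprn_ge0.
  apply: (ler_pM g1 (mulr_ge0 g3 (ltW rm0)) t1); apply: (ler_pM g3 (ltW rm0) _ rK).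
  by rewrite ler_wpM2l.
rewrite [X in X <= _](_ : _ = p.[w] ^+ (M + N) * 4 ^+ A * K3 * D * (theta ^+ m * m.+1%:R ^+ (2 * A))); last by ring.
rewrite [X in _ <= X](_ : _ = p.[w] ^+ (M + N) * 4 ^+ A * K3 * D * (K5 * rho ^+ m)); last by rewrite /Kb; ring.
by rewrite ler_wpM2l // !mulr_ge0 ?exprn_ge0.
Qed.
End Final.

(** * From polynomials to arrays of real numbers *)

Section Bridge.
Variables (d : nat) (a : nat -> nat) (w : R).
Hypotheses (d1 : le 1 d) (a1 : forall j, le j d -> lt 0 (a j)) (w0 : Rlt 0 w).

Definition bp : {poly R} := \poly_(j < d.+1) INR (a j).

Let d0 : (0 < d)%N. Proof. by apply/ssrnat.leP. Qed.
Let w0' : 0 < w. Proof. by apply/RltP. Qed.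
Let sp : (size bp <= d.+1)%N. Proof. exact: size_poly. Qed.
Let p_ge1 j : (j <= d)%N -> 1 <= bp`_j.
Proof.
move=> jd; rewrite coef_poly ltnS jd INRE ler1n.
by apply/ssrnat.leP/a1/ssrnat.leP.
Qed.

Lemma bp_horner : bp.[w] = p_at d a w.
Proof.
rewrite (horner_coef_wide _ sp) /p_at sum_f_R0E big_mkord.
by apply: eq_bigr => j _; rewrite coef_poly ltn_ord RpowE.
Qed.

Lemma conv_poly (q : {poly R}) (f : nat -> R) : (forall k, f k = q`_k) ->
  forall k, conv d a f k = (bp * q)`_k.
Proof.
move=> fq k; rewrite /conv sum_f_R0E big_mkord coefM.
pose T j : R := bp`_j * q`_(k - j).
rewrite (eq_bigr (fun j : 'I_d.+1 => if (j < k.+1)%N then T j else 0)) => [|j _]; last first.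
  rewrite ltnS /T coef_poly ltn_ord -fq.
  by case: (PeanoNat.Nat.leb_spec j k) => [/ssrnat.leP -> //|/ssrnat.ltP]; rewrite ltnNge; case: (j <= k)%N.
rewrite (eq_bigr (fun j : 'I_k.+1 => if (j < d.+1)%N then T j else 0)) => [|j _]; last first.
  by rewrite /T coef_poly; case: ifP => // _; rewrite mul0r.
have e m n : (m <= n)%N -> \sum_(j < m) (if (j < n)%N then T j else 0) = \sum_(j < n | (j < m)%N) T j.
  move=> mn; rewrite -(big_ord_widen n T mn); apply: eq_bigr => j _.
  by rewrite (leq_trans (ltn_ord j) mn).
case: (leqP d.+1 k.+1) => h; first by rewrite e // big_mkcond.
by rewrite [RHS](e _ _ (ltnW h)) [RHS]big_mkcond.
Qed.

Section Arrays.
Variables (N : nat) (h H : nat -> nat -> R) (gm : R).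
Hypotheses (hh : height_array d a h) (hH : sum_array d a N H) (gm0 : Rle 0 gm).

Definition bG : {poly R} := \poly_(j < (N * d).+1) H N j.

Lemma heightE n k : h n k = (bp ^+ n)`_k.
Proof.
case: hh => h0 hS; elim: n k => [|n IH] k; first by rewrite h0 expr0 coef1; case: k.
by rewrite hS exprS; apply: conv_poly.
Qed.

Lemma sumE n k : H (N + n) k = (bG * bp ^+ n)`_k.
Proof.
case: hH => H0 HS; elim: n k => [|n IH] k.
  rewrite addn0 expr0 mulr1 coef_poly ltnS; case: leqP => // /ssrnat.ltP; exact: H0.
rewrite addnS HS; last by apply/ssrnat.leP; rewrite leq_addr.
rewrite (conv_poly (IH)) exprS; apply: (congr1 (fun g : {poly R} => g`_k)); ring.
Qed.

Lemma goodE n k : good_vertex (p_at d a w) w h n k -> good w bp n k.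
Proof.
move/RleP; rewrite /good -heightE bp_horner; congr (_ <= _).
  by rewrite RdivE !RpowE.
by rewrite RmultE RpowE INRE.
Qed.

Lemma gamE n m k i s : (m + N <= n)%N ->
  H (n - m)%N (k - i)%N - s * h (n - m)%N (k - i)%N = (Gam N bp bG s * bp ^+ (n - m - N))`_(k - i).
Proof.
move=> mn; have e : (n - m)%N = (N + (n - m - N))%N.
  by rewrite subnKC // leq_subRL ?(leq_trans (leq_addr _ _) mn).
rewrite {1 2}e sumE heightE /Gam mulrBl coefB -scalerAl coefZ -exprD //.
Qed.

Lemma decay : (forall c, exists k, H N k <> Rmult c (h N k)) ->
  decay_statement d N (p_at d a w) w gm h H.
Proof.
move=> hc.
have hG c : bG <> c *: bp ^+ N.
  move=> e; have [k hk] := hc c; apply: hk.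
  have := sumE 0 k; rewrite addn0 expr0 mulr1 e coefZ -heightE; apply.
have gm0' : 0 <= gm by apply/RleP.
have [K [rho [M [n0 [K0 /andP[r0 r1] NM key]]]]] := block_decay w0' d0 sp p_ge1 gm0' hG.
exists K, rho, M, n0; split; first exact/RleP.
split; first by split; apply/RltP.
move=> n k s D /ssrnat.leP nn /goodE g /RleP; rewrite RabsE => hs.
have [MN key2] := key n k s D nn g hs.
split=> [|hD]; first exact/ssrnat.leP.
have [|D0 k1 k2] := key2.
  move=> i /ssrnat.leP iM /ssrnat.leP ik; rewrite -gamE //; exact/RleP/(hD i iM ik).
split; first exact/RltP; split=> m i.
  move=> /ssrnat.leP mM /ssrnat.leP mn /ssrnat.leP im /ssrnat.leP ik.
  have mN : (m + N <= n)%N by apply: leq_trans mn; rewrite leq_add2l (leq_trans NM).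
  have /RleP := k1 m i mM mn im ik; rewrite -gamE //.
  by rewrite -RpowE.
move=> /ssrnat.leP nm /ssrnat.leP mn /ssrnat.leP im /ssrnat.leP ik.
have /RleP := k2 m i nm mn im ik; rewrite -heightE.
by rewrite -RpowE.
Qed.

Lemma ratio : ratio_statement d (p_at d a w) w h.
Proof.
have [e [n1 hz]] := good_zone w0' d0 sp p_ge1.
move=> m; have [C [n0 [C0 hC]]] := h_steps d0 sp p_ge1 m e.
exists C, (maxn n0 n1); split=> [|n k i]; first exact/RltP.
move=> /ssrnat.leP; rewrite geq_max => /andP[nn0 nn1] /goodE g /ssrnat.leP im; apply/RleP.
rewrite RmultE !heightE; apply: hC => //; exact: hz.
Qed.

Lemma large : large_statement (p_at d a w) w h.
Proof.
move=> B; have [n0 hn] := good_large w0' d0 sp p_ge1 B; exists n0 => n k /ssrnat.leP nn /goodE g.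
by apply/RleP; rewrite heightE; apply: hn.
Qed.
End Arrays.
End Bridge.
End Coefficients.

Import ListNotations.

(** * Lists with pairwise ordered entries *)

Lemma ForallOrdPairs_app {A} (R : A -> A -> Prop) l1 l2 :
  ForallOrdPairs R l1 -> ForallOrdPairs R l2 ->
  (forall x y, In x l1 -> In y l2 -> R x y) -> ForallOrdPairs R (l1 ++ l2).
Proof.
  induction 1 as [|x l Hx Hl IH]; intros H2 H; simpl; auto.
  constructor.
  - apply Forall_app. split; auto. apply Forall_forall. intros y Hy. apply H; simpl; auto.
  - apply IH; auto. intros. apply H; simpl; auto.
Qed.

Lemma ForallOrdPairs_map {A B} (f : A -> B) (R : B -> B -> Prop) l :
  ForallOrdPairs (fun x y => R (f x) (f y)) l -> ForallOrdPairs R (map f l).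
Proof.
  induction 1 as [|x l Hx Hl IH]; simpl; constructor; auto.
  apply Forall_map. auto.
Qed.

Lemma ForallOrdPairs_flat_map {A B} (f : A -> list B) (R : B -> B -> Prop) l :
  ForallOrdPairs (fun x y => forall u v, In u (f x) -> In v (f y) -> R u v) l ->
  (forall x, In x l -> ForallOrdPairs R (f x)) -> ForallOrdPairs R (flat_map f l).
Proof.
  induction 1 as [|x l Hx Hl IH]; intros H; simpl; [constructor|].
  apply ForallOrdPairs_app.
  - apply H; simpl; auto.
  - apply IH. intros; apply H; simpl; auto.
  - intros u v Hu Hv. apply in_flat_map in Hv. destruct Hv as [y [Hy Hv]].
    rewrite Forall_forall in Hx. eapply Hx; eauto.
Qed.

Lemma ForallOrdPairs_impl {A} (R S : A -> A -> Prop) l :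
  (forall x y, In x l -> In y l -> R x y -> S x y) -> ForallOrdPairs R l -> ForallOrdPairs S l.
Proof.
  intros H F. induction F as [|x l Hx Hl IH]; constructor.
  - rewrite Forall_forall in *. intros y Hy. apply H; simpl; auto.
  - apply IH. intros; apply H; simpl; auto.
Qed.

Lemma ForallOrdPairs_nth {A} (R : A -> A -> Prop) l x0 i j :
  ForallOrdPairs R l -> (i < j < length l)%nat -> R (nth i l x0) (nth j l x0).
Proof.
  intros F. revert i j. induction F as [|x l Hx Hl IH]; simpl; intros i j Hij; [lia|].
  destruct j; [lia|]. destruct i.
  - rewrite Forall_forall in Hx. apply Hx. apply nth_In. lia.
  - apply IH. lia.
Qed.

(** * Towers and the adic map *)

Section Towers.
Variables (d : nat) (a : nat -> nat).

Fixpoint edges_upto (j : nat) : list edge :=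
  map (pair j) (seq 0 (a j)) ++ match j with O => [] | S j' => edges_upto j' end.

Definition elist : list edge := edges_upto d.

Lemma in_edges_upto j e :
  In e (edges_upto j) <-> (fst e <= j)%nat /\ (snd e < a (fst e))%nat.
Proof.
  induction j as [|j IH]; simpl; rewrite in_app_iff, in_map_iff.
  - split.
    + intros [[m [<- H]]|[]]. apply in_seq in H. simpl. lia.
    + intros [H1 H2]. left. exists (snd e). destruct e as [i m]. simpl in *.
      assert (i = O) by lia. subst. split; auto. apply in_seq. lia.
  - rewrite IH. split.
    + intros [[m [<- H]]|H]; [|lia]. apply in_seq in H. simpl. lia.
    + intros [H1 H2]. destruct (Nat.eq_dec (fst e) (S j)) as [E|E]; [left|right; lia].
      exists (snd e). destruct e as [i m]. simpl in *. subst. split; auto. apply in_seq. lia.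
Qed.

Lemma in_elist e : In e elist <-> valid_edge d a e.
Proof. apply in_edges_upto. Qed.

Lemma edges_upto_sorted j : ForallOrdPairs edge_prec (edges_upto j).
Proof.
  assert (S : forall i n s, ForallOrdPairs edge_prec (map (pair i) (seq s n))).
  { intros i n. induction n as [|n IH]; intros s; simpl; constructor; auto.
    apply Forall_map, Forall_forall. intros m Hm. apply in_seq in Hm. right. simpl. lia. }
  induction j as [|j IH]; cbn [edges_upto].
  - rewrite app_nil_r. apply S.
  - apply ForallOrdPairs_app; auto. intros x y Hx Hy.
    apply in_map_iff in Hx. destruct Hx as [m [<- _]].
    apply in_edges_upto in Hy. left. simpl. lia.
Qed.

Lemma edge_prec_neq e f : edge_prec e f -> e <> f.
Proof. unfold edge_prec. intros H ->. lia. Qed.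

Lemma edge_prec_total e f : e <> f -> edge_prec e f \/ edge_prec f e.
Proof.
  unfold edge_prec. destruct e as [i m], f as [j n]. simpl. intros H.
  destruct (Nat.lt_trichotomy i j) as [|[->|]]; auto.
  destruct (Nat.lt_trichotomy m n) as [|[->|]]; auto. congruence.
Qed.

(** The recursion of [tw] for arbitrary lists: one block per edge, in tower order. *)
Definition fm {X} (F : nat -> list X) (k : nat) : list X :=
  flat_map (fun e : edge => if (fst e <=? k)%nat then F (k - fst e)%nat else []) elist.

(* Words from the root to (n,k); edges of larger type come first, so T runs
   through this list in order. *)
Fixpoint tw (n k : nat) : list (list edge) :=
  match n with
  | O => if (k =? 0)%nat then [[]] else []
  | S n' => flat_map (fun e : edge =>
      if (fst e <=? k)%nat then map (fun c => c ++ [e]) (tw n' (k - fst e)%nat) else []) elist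
  end.

Definition sw (c : list edge) (x : path) : path :=
  fun i => if (i <? length c)%nat then nth i c (O, O) else x i.

Definition wsum (c : list edge) : nat := list_sum (map fst c).

Lemma wsum_app c c' : wsum (c ++ c') = (wsum c + wsum c')%nat.
Proof. unfold wsum. rewrite map_app, list_sum_app. reflexivity. Qed.

Lemma in_tw n k c : In c (tw n k) <->
  length c = n /\ wsum c = k /\ Forall (valid_edge d a) c.
Proof.
  revert k c. induction n as [|n IH]; intros k c; cbn [tw].
  - destruct (Nat.eqb_spec k 0) as [->|Hk]; simpl.
    + split.
      * intros [<-|[]]. repeat split; auto.
      * intros [H _]. left. destruct c; auto. discriminate.
    + split; [tauto|]. intros [H [H2 _]]. destruct c; [|discriminate]. unfold wsum in H2. simpl in H2. congruence.
  - rewrite in_flat_map. split.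
    + intros [e [He H]]. destruct (Nat.leb_spec (fst e) k) as [Hk|]; [|destruct H].
      apply in_map_iff in H. destruct H as [c' [<- H]]. apply IH in H.
      destruct H as [H1 [H2 H3]]. rewrite length_app, wsum_app. unfold wsum at 2. simpl.
      split; [lia|]. split; [lia|]. apply Forall_app. split; auto. constructor; auto.
      apply in_elist; auto.
    + intros [H1 [H2 H3]]. destruct (exists_last (l := c)) as [c' [e ->]].
      { intros ->. discriminate. }
      apply Forall_app in H3. destruct H3 as [H3 H4]. inversion H4; subst.
      rewrite length_app in H1. simpl in H1. rewrite wsum_app. unfold wsum at 2. simpl.
      exists e. split; [apply in_elist; auto|].
      destruct (Nat.leb_spec (fst e) (wsum c' + (fst e + 0))); [|lia].
      apply in_map_iff. exists c'. split; auto. apply IH. split; [lia|]. split; [|auto].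
      unfold wsum at 3. simpl. lia.
Qed.

Lemma sw_lt c x i : (i < length c)%nat -> sw c x i = nth i c (O, O).
Proof. intros H. unfold sw. destruct (Nat.ltb_spec i (length c)); auto; lia. Qed.

Lemma sw_ge c x i : (length c <= i)%nat -> sw c x i = x i.
Proof. intros H. unfold sw. destruct (Nat.ltb_spec i (length c)); auto; lia. Qed.

Lemma sw_snoc c e x :
  sw (c ++ [e]) x = sw c (fun i => if (i =? length c)%nat then e else x i).
Proof.
  apply functional_extensionality. intros i. unfold sw. rewrite length_app. simpl.
  destruct (Nat.ltb_spec i (length c)) as [H|H];
  destruct (Nat.ltb_spec i (length c + 1)) as [H'|H']; try lia.
  - rewrite app_nth1; auto.
  - assert (i = length c) by lia. subst. rewrite Nat.eqb_refl, app_nth2, Nat.sub_diag; auto.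
  - destruct (Nat.eqb_spec i (length c)); auto; lia.
Qed.

Lemma vtx_ext x y n : (forall i, (i < n)%nat -> x i = y i) -> vtx x n = vtx y n.
Proof.
  induction n as [|n IH]; simpl; intros H; auto. rewrite IH; [rewrite H; auto|auto].
Qed.

Lemma vtx_sw_len c x : vtx (sw c x) (length c) = wsum c.
Proof.
  induction c as [|e c IH] using rev_ind; auto.
  rewrite length_app, wsum_app, Nat.add_comm. simpl. f_equal.
  - rewrite <- IH. apply vtx_ext. intros i Hi. rewrite !sw_lt; auto.
    + rewrite app_nth1; auto.
    + rewrite length_app. simpl. lia.
  - rewrite sw_lt; [|rewrite length_app; simpl; lia].
    rewrite app_nth2, Nat.sub_diag; [unfold wsum; simpl; lia|auto].
Qed.

Lemma vtx_tail x y m : vtx x m = vtx y m -> forall n, (m <= n)%nat ->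
  (forall i, (m <= i)%nat -> (i < n)%nat -> x i = y i) -> vtx x n = vtx y n.
Proof.
  intros E n H. induction H as [|n H IH]; auto. intros Hi. simpl. rewrite IH; auto. f_equal.
  rewrite Hi; auto.
Qed.

Lemma vtx_tail_inv x y m n : (m <= n)%nat -> vtx x n = vtx y n ->
  (forall i, (m <= i)%nat -> (i < n)%nat -> x i = y i) -> vtx x m = vtx y m.
Proof.
  intros H. induction H as [|n H IH]; auto. intros E Hi. apply IH; auto.
  simpl in E. rewrite Hi in E; auto. lia.
Qed.

Definition wprec (c c' : list edge) : Prop := forall y, path_prec (sw c y) (sw c' y).

(** Words with different last edges are ordered by these. A common last edge is moved into the
    continuation, which is why [wprec] quantifies over all continuations. *)
Lemma tw_sorted n k : ForallOrdPairs wprec (tw n k).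
Proof.
  revert k. induction n as [|n IH]; intros k; cbn [tw].
  - destruct (k =? 0)%nat; repeat constructor.
  - apply ForallOrdPairs_flat_map.
    + eapply ForallOrdPairs_impl; [|apply edges_upto_sorted].
      intros e f He Hf Hef u v Hu Hv y.
      destruct (Nat.leb_spec (fst e) k) as [Le|]; [|destruct Hu].
      destruct (Nat.leb_spec (fst f) k) as [Lf|]; [|destruct Hv].
      apply in_map_iff in Hu. destruct Hu as [c [<- Hc]].
      apply in_map_iff in Hv. destruct Hv as [c' [<- Hc']].
      apply in_tw in Hc. destruct Hc as [Hc1 [Hc2 _]].
      apply in_tw in Hc'. destruct Hc' as [Hc1' [Hc2' _]].
      assert (E1 : sw (c ++ [e]) y n = e).
      { rewrite sw_lt; [|rewrite length_app; simpl; lia].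
        rewrite app_nth2, Hc1, Nat.sub_diag; auto. lia. }
      assert (E2 : sw (c' ++ [f]) y n = f).
      { rewrite sw_lt; [|rewrite length_app; simpl; lia].
        rewrite app_nth2, Hc1', Nat.sub_diag; auto. lia. }
      exists n. rewrite E1, E2. split; [apply edge_prec_neq; auto|]. split.
      * intros i Hi. rewrite !sw_ge; auto; rewrite length_app; simpl; lia.
      * split; auto.
        replace (S n) with (length (c ++ [e])) at 1 by (rewrite length_app; simpl; lia).
        replace (S n) with (length (c' ++ [f])) by (rewrite length_app; simpl; lia).
        rewrite !vtx_sw_len, !wsum_app. unfold wsum at 2 4. simpl. lia.
    + intros e He. destruct (fst e <=? k)%nat; [|constructor].
      apply ForallOrdPairs_map. eapply ForallOrdPairs_impl; [|apply IH].
      intros c c' Hc Hc' H y. rewrite !sw_snoc.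
      apply in_tw in Hc. apply in_tw in Hc'.
      replace (length c') with (length c) by (destruct Hc, Hc'; congruence). apply H.
Qed.

Lemma path_prec_asym x y : path_prec x y -> path_prec y x -> False.
Proof.
  intros [i [H1 [H2 [_ H3]]]] [j [K1 [K2 [_ K3]]]].
  destruct (Nat.lt_trichotomy i j) as [L|[<-|L]].
  - apply K1. symmetry. apply H2. auto.
  - unfold edge_prec in *. lia.
  - apply H1. symmetry. apply K2. auto.
Qed.

Lemma tw_NoDup n k : NoDup (tw n k).
Proof.
  generalize (tw_sorted n k). induction 1 as [|c l Hc Hl IH]; constructor; auto.
  intros I. rewrite Forall_forall in Hc. specialize (Hc c I (fun _ => (O, O))).
  exact (path_prec_asym _ _ Hc Hc).
Qed.

Definition pre (n : nat) (x : path) : list edge := map x (seq 0 n).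

Lemma pre_length n x : length (pre n x) = n.
Proof. unfold pre. rewrite length_map, length_seq. auto. Qed.

Lemma pre_nth n x i : (i < n)%nat -> nth i (pre n x) (O, O) = x i.
Proof.
  intros H. unfold pre. rewrite nth_indep with (d' := x O); [|rewrite length_map, length_seq; auto].
  rewrite map_nth, seq_nth; auto.
Qed.

Lemma sw_pre n x : sw (pre n x) x = x.
Proof.
  apply functional_extensionality. intros i.
  destruct (Nat.lt_ge_cases i n).
  - rewrite sw_lt; [apply pre_nth; auto|rewrite pre_length; auto].
  - rewrite sw_ge; auto. rewrite pre_length; auto.
Qed.

Lemma pre_sw c x : pre (length c) (sw c x) = c.
Proof.
  apply nth_ext with (d := (O, O)) (d' := (O, O)); [apply pre_length|].
  intros i Hi. rewrite pre_length in Hi. rewrite pre_nth; auto. apply sw_lt; auto.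
Qed.

Lemma pre_S n x : pre (S n) x = pre n x ++ [x n].
Proof. unfold pre. rewrite seq_S, map_app. reflexivity. Qed.

Lemma wsum_pre n x : wsum (pre n x) = vtx x n.
Proof. rewrite <- (sw_pre n x) at 2. rewrite <- (pre_length n x) at 3. rewrite vtx_sw_len. auto. Qed.

Lemma pre_in_tw n x : valid_path d a x -> In (pre n x) (tw n (vtx x n)).
Proof.
  intros H. apply in_tw. rewrite pre_length, wsum_pre. repeat split; auto.
  apply Forall_forall. intros e He. apply in_map_iff in He. destruct He as [i [<- _]]. apply H.
Qed.

Lemma valid_sw c x : Forall (valid_edge d a) c -> valid_path d a x -> valid_path d a (sw c x).
Proof.
  intros Hc Hx i. unfold sw. destruct (Nat.ltb_spec i (length c)) as [H|]; [|apply Hx].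
  rewrite Forall_forall in Hc. apply Hc. apply nth_In. auto.
Qed.

(** A path strictly between the two would agree with y from level n on and pass through (n,k), so
    its prefix would stand between two consecutive words of the sorted tower. *)
Lemma tw_succ n k i y : valid_path d a y -> (S i < length (tw n k))%nat ->
  is_succ d a (sw (nth i (tw n k) []) y) (sw (nth (S i) (tw n k) []) y).
Proof.
  intros Hy Hi. set (c := nth i (tw n k) []). set (c' := nth (S i) (tw n k) []).
  assert (Hc : In c (tw n k)) by (apply nth_In; lia).
  assert (Hc' : In c' (tw n k)) by (apply nth_In; lia).
  apply in_tw in Hc. destruct Hc as [L [Wc Vc]].
  apply in_tw in Hc'. destruct Hc' as [L' [Wc' Vc']].
  split; [apply valid_sw; auto|]. split.
  { apply (ForallOrdPairs_nth wprec); [apply tw_sorted|lia]. }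
  intros z Hz [P1 P2].
  assert (P1' := P1). assert (P2' := P2).
  destruct P1 as [i1 [D1 [A1 [V1 E1]]]]. destruct P2 as [i2 [D2 [A2 [V2 E2]]]].
  assert (Hy1 : forall j, (n <= j)%nat -> sw c y j = y j) by (intros; apply sw_ge; lia).
  assert (Hy2 : forall j, (n <= j)%nat -> sw c' y j = y j) by (intros; apply sw_ge; lia).
  (* From index n on both ends equal y, so i1 >= n would place the same edge of z both after and
     before that of y. *)
  assert (i1n : (i1 < n)%nat).
  { destruct (Nat.lt_ge_cases i1 n) as [|G]; auto. exfalso.
    assert (i1 = i2).
    { destruct (Nat.lt_trichotomy i1 i2) as [l|[e|l]]; auto; exfalso.
      - apply D2. rewrite <- A1; auto. rewrite Hy1, Hy2; auto; lia.
      - apply D1. rewrite A2; auto. rewrite Hy1, Hy2; auto; lia. }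
    subst i2. rewrite Hy1 in E1; auto. rewrite Hy2 in E2; auto. unfold edge_prec in *. lia. }
  assert (zt : forall j, (n <= j)%nat -> z j = y j).
  { intros j Hj. rewrite <- A1; [apply Hy1; auto|lia]. }
  assert (vz : vtx z n = k).
  { rewrite <- Wc, <- (vtx_sw_len c y), L. symmetry. apply vtx_tail with (m := S i1); auto. }
  assert (Iz : In (pre n z) (tw n k)) by (rewrite <- vz; apply pre_in_tw; auto).
  apply In_nth with (d := []) in Iz. destruct Iz as [l [Hl El]].
  assert (ez : z = sw (nth l (tw n k) []) y).
  { rewrite El. apply functional_extensionality. intros j. unfold sw. rewrite pre_length.
    destruct (Nat.ltb_spec j n); [rewrite pre_nth; auto|apply zt; auto]. }
  assert (O : forall i j, (i < length (tw n k))%nat -> (j < length (tw n k))%nat ->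
     path_prec (sw (nth i (tw n k) []) y) (sw (nth j (tw n k) []) y) -> (i < j)%nat).
  { intros i' j' Hi' Hj' P. destruct (Nat.lt_trichotomy i' j') as [|[<-|G]]; auto; exfalso.
    - exact (path_prec_asym _ _ P P).
    - apply (path_prec_asym _ _ P). apply (ForallOrdPairs_nth wprec); [apply tw_sorted|lia]. }
  rewrite ez in P1', P2'. apply O in P1'; [|lia|lia]. apply O in P2'; lia.
Qed.

(** Two successors agree eventually with x and hence with each other, so they are comparable, and
    the smaller would lie strictly between x and the larger. *)
Lemma succ_unique x y y' : is_succ d a x y -> is_succ d a x y' -> y = y'.
Proof.
  intros [V [P M]] [V' [P' M']].
  destruct (classic (y = y')) as [|N]; auto. exfalso.
  assert (Q := P). assert (Q' := P').
  destruct Q as [i [_ [A [Vi _]]]]. destruct Q' as [i' [_ [A' [Vi' _]]]].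
  set (m := S (Nat.max i i')).
  assert (T : forall j, (m <= j)%nat -> y j = y' j).
  { intros j Hj. rewrite <- A, <- A'; auto; lia. }
  assert (Vm : vtx y m = vtx y' m).
  { transitivity (vtx x m).
    - symmetry. apply vtx_tail with (m := S i); auto; try lia; intros; apply A; lia.
    - apply vtx_tail with (m := S i'); auto; try lia; intros; apply A'; lia. }
  assert (exists j, y j <> y' j /\ forall l, (j < l)%nat -> y l = y' l).
  { clear - N T.
    induction m as [|m IH].
    - exfalso. apply N. apply functional_extensionality. intros j. apply T. lia.
    - destruct (classic (y m = y' m)) as [E|E].
      + apply IH. intros j Hj. destruct (Nat.eq_dec j m); [subst; auto|apply T; lia].
      + exists m. split; auto. }
  destruct H as [j [Dj Aj]].
  assert (Vj : vtx y (S j) = vtx y' (S j)).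
  { destruct (Nat.le_gt_cases (S j) m).
    - apply vtx_tail_inv with (n := m); auto; intros; apply Aj; lia.
    - apply vtx_tail with (m := m); auto; try lia; intros; apply T; lia. }
  destruct (edge_prec_total _ _ Dj) as [E|E].
  - apply (M' y V). split; auto. exists j. auto.
  - apply (M y' V'). split; auto. exists j. repeat split; auto. intros; symmetry; auto.
Qed.

Lemma Tp_step n k i y : valid_path d a y -> (S i < length (tw n k))%nat ->
  Tp d a (sw (nth i (tw n k) []) y) = sw (nth (S i) (tw n k) []) y.
Proof.
  intros Hy Hi. assert (S := tw_succ n k i y Hy Hi).
  eapply succ_unique; [|exact S]. unfold Tp. apply epsilon_spec. eexists; exact S.
Qed.

Lemma Tp_iter n k i j y : valid_path d a y -> (i + j < length (tw n k))%nat ->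
  Nat.iter j (Tp d a) (sw (nth i (tw n k) []) y) = sw (nth (i + j) (tw n k) []) y.
Proof.
  intros Hy. induction j as [|j IH]; intros H; simpl; [rewrite Nat.add_0_r; auto|].
  rewrite IH; [|lia]. rewrite <- plus_n_Sm. apply Tp_step; auto. lia.
Qed.
End Towers.

(** * Partial sums along lists and oscillation of concatenations *)

Definition lsum (l : list R) : R := fold_right Rplus 0 l.
Definition psum (l : list R) (j : nat) : R := lsum (firstn j l).

Lemma lsum_app l l' : lsum (l ++ l') = lsum l + lsum l'.
Proof. induction l as [|x l IH]; simpl; [lra|]. unfold lsum in *. rewrite IH. lra. Qed.

Lemma psum_S l j : (j < length l)%nat -> psum l (S j) = psum l j + nth j l 0.
Proof.
  unfold psum. revert j. induction l as [|x l IH]; simpl; intros j H; [lia|].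
  destruct j; simpl; [lra|]. simpl in IH. rewrite IH; [|lia]. lra.
Qed.

Lemma psum_len l : psum l (length l) = lsum l.
Proof. unfold psum. rewrite firstn_all. auto. Qed.

Definition curve (s : R) (l : list R) (j : nat) : R := psum l j - s * INR j.

Lemma curve_0 s l : curve s l 0 = 0.
Proof. unfold curve, psum. simpl. lra. Qed.

Lemma curve_app1 s l l' j : (j <= length l)%nat -> curve s (l ++ l') j = curve s l j.
Proof.
  intros H. unfold curve, psum. rewrite firstn_app.
  replace (j - length l)%nat with O by lia. simpl. rewrite app_nil_r. auto.
Qed.

Lemma curve_app2 s l l' j :
  curve s (l ++ l') (length l + j) = curve s l (length l) + curve s l' j.
Proof.
  unfold curve, psum. rewrite firstn_app_2, firstn_all, lsum_app, plus_INR. lra.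
Qed.

Definition curve_bounded (s : R) (l : list R) (P : R) : Prop :=
  forall j, (j <= length l)%nat -> Rabs (curve s l j) <= P.

(** Up to a given position the curve is the sum of the end values of the completed blocks plus a
    value inside one block. *)
Lemma curve_bounded_concat s bs v P : 0 <= v -> 0 <= P ->
  (forall b, In b bs -> Rabs (curve s b (length b)) <= v /\ curve_bounded s b P) ->
  curve_bounded s (concat bs) (INR (length bs) * v + P).
Proof.
  intros Hv HP. induction bs as [|b bs IH]; intros H j Hj.
  - simpl in *. assert (j = O) by lia. subst. rewrite curve_0, Rabs_R0. lra.
  - cbn [concat] in *. rewrite length_app in Hj.
    destruct (H b (or_introl eq_refl)) as [H1 H2].
    change (length (b :: bs)) with (S (length bs)). rewrite S_INR.
    assert (Z := pos_INR (length bs)).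
    destruct (Nat.le_gt_cases j (length b)) as [L|L].
    + rewrite curve_app1; auto. specialize (H2 j L). nra.
    + replace j with (length b + (j - length b))%nat by lia. rewrite curve_app2.
      eapply Rle_trans; [apply Rabs_triang|].
      assert (I := IH (fun b' Hb => H b' (or_intror Hb)) (j - length b)%nat).
      assert (I' : (j - length b <= length (concat bs))%nat) by lia. specialize (I I'). lra.
Qed.

(** Positions at most eta apart lie in one block or in two adjacent ones. *)
Lemma curve_concat_equicont s bs (eta : nat) P : 0 <= P ->
  (forall b, In b bs -> (eta <= length b)%nat /\ curve_bounded s b P) ->
  forall j j', (j <= j')%nat -> (j' <= length (concat bs))%nat -> (j' <= j + eta)%nat ->
  Rabs (curve s (concat bs) j' - curve s (concat bs) j) <= 4 * P.
Proof.
  intros P0. induction bs as [|b bs IH]; intros H j j' H1 H2 H3.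
  - simpl in *. replace j' with O by lia. replace j with O by lia.
    rewrite Rminus_diag, Rabs_R0. lra.
  - cbn [concat] in *. rewrite length_app in H2.
    destruct (H b (or_introl eq_refl)) as [L1 B1].
    assert (T : forall u v, Rabs u <= P -> Rabs v <= P -> Rabs (u - v) <= 2 * P).
    { intros u v Hu Hv. eapply Rle_trans; [apply Rabs_triang|]. rewrite Rabs_Ropp. lra. }
    destruct (Nat.le_gt_cases j' (length b)) as [C|C].
    + rewrite !curve_app1; try lia.
      assert (B2 := B1 j' C). assert (B3 := B1 j ltac:(lia)). specialize (T _ _ B2 B3). lra.
    + replace j' with (length b + (j' - length b))%nat by lia. rewrite curve_app2.
      destruct (Nat.le_gt_cases j (length b)) as [C'|C'].
      * rewrite curve_app1; auto.
        assert (B2 := B1 (length b) (le_n _)). assert (B3 := B1 j C').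
        specialize (T _ _ B2 B3).
        assert (Q : Rabs (curve s (concat bs) (j' - length b)) <= P).
        { destruct bs as [|b' bs].
          - simpl in *. replace (j' - length b)%nat with O by lia. rewrite curve_0, Rabs_R0. lra.
          - destruct (H b' (or_intror (or_introl eq_refl))) as [L2 B4].
            cbn [concat]. rewrite curve_app1; [|lia]. apply B4. lia. }
        match goal with |- Rabs ?x <= _ =>
          replace x with ((curve s b (length b) - curve s b j) + curve s (concat bs) (j' - length b)) by lra end.
        eapply Rle_trans; [apply Rabs_triang|]. lra.
      * replace j with (length b + (j - length b))%nat by lia. rewrite curve_app2.
        match goal with |- Rabs ?x <= _ =>
          replace x with (curve s (concat bs) (j' - length b) - curve s (concat bs) (j - length b)) by lra end.
        apply IH; try lia. intros; apply H; simpl; auto.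
Qed.

(** * Values of g along towers and their block structure *)

Section Blocks.
Variables (d : nat) (a : nat -> nat) (g : path -> R) (N : nat).
Hypothesis d1 : (1 <= d)%nat.
Hypothesis a1 : forall j, (j <= d)%nat -> (0 < a j)%nat.
Hypothesis cylg : cylindric d a g N.

(** Lengths and sums of lists are both additive, so one recursion serves both arrays. *)
Lemma flat_map_measure {X} (phi : list X -> R) (psi : nat -> R) (f : edge -> list X) k :
  phi [] = 0 -> (forall l l', phi (l ++ l') = phi l + phi l') ->
  (forall e, phi (f e) = if (fst e <=? k)%nat then psi (k - fst e)%nat else 0) ->
  phi (flat_map f (elist d a)) = conv d a psi k.
Proof.
  intros P0 PA Pf. unfold elist, conv.
  assert (R : forall j n s, phi (flat_map f (map (pair j) (seq s n))) =
     INR n * (if (j <=? k)%nat then psi (k - j)%nat else 0)).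
  { intros j n. induction n as [|n IH]; intros s; cbn [seq map flat_map].
    - rewrite P0. simpl. lra.
    - rewrite PA, Pf, IH, S_INR. simpl fst. lra. }
  assert (Q : forall j, phi (flat_map f (map (pair j) (seq 0 (a j)))) =
     if (j <=? k)%nat then INR (a j) * psi (k - j)%nat else 0).
  { intros j. rewrite R. destruct (j <=? k)%nat; lra. }
  clear - Q P0 PA. induction d as [|d' IH]; cbn [edges_upto].
  - rewrite app_nil_r, Q. reflexivity.
  - rewrite flat_map_app, PA, Q. cbn [sum_f_R0]. rewrite Rplus_comm. f_equal. exact IH.
Qed.

Definition hA (n k : nat) : R := INR (length (tw d a n k)).

Lemma tw_height_array : height_array d a hA.
Proof.
  split.
  - intros k. unfold hA. simpl. destruct (k =? 0)%nat; reflexivity.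
  - intros n k. unfold hA. cbn [tw].
    apply (flat_map_measure (fun l => INR (length l)) (fun k => INR (length (tw d a n k)))).
    + reflexivity.
    + intros. rewrite length_app, plus_INR. auto.
    + intros e. destruct (fst e <=? k)%nat; [rewrite length_map|]; reflexivity.
Qed.

Definition path0 : path := fun _ => (O, O).

Lemma valid_path0 : valid_path d a path0.
Proof. intros i. split; simpl; [lia|apply a1; lia]. Qed.

(* For words of length at least N the continuation [path0] is irrelevant. *)
Definition gval (c : list edge) : R := g (sw c path0).
Definition gl (n k : nat) : list R := map gval (tw d a n k).

Lemma g_sw c y : (N <= length c)%nat -> Forall (valid_edge d a) c -> valid_path d a y ->
  g (sw c y) = gval c.
Proof.
  intros L V Hy. apply cylg; try (apply valid_sw; auto; apply valid_path0).
  intros i Hi. rewrite !sw_lt; auto; lia.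
Qed.

Lemma gval_app c c' : (N <= length c)%nat -> Forall (valid_edge d a) c ->
  Forall (valid_edge d a) c' -> gval (c ++ c') = gval c.
Proof.
  intros L V V'. apply cylg; try (apply valid_sw; auto; try apply valid_path0).
  - apply Forall_app; auto.
  - intros i Hi. rewrite !sw_lt; [|lia|rewrite length_app; lia]. rewrite app_nth1; auto. lia.
Qed.

(** From level N on an appended edge no longer influences g, so the lists of the subtowers are
    simply concatenated. *)
Lemma gl_S n k : (N <= n)%nat -> gl (S n) k = fm d a (gl n) k.
Proof.
  intros H. unfold gl, fm. cbn [tw]. rewrite !flat_map_concat_map, concat_map, map_map.
  f_equal. apply map_ext_in. intros e He. destruct (fst e <=? k)%nat; auto.
  rewrite map_map. apply map_ext_in. intros c Hc. apply in_tw in Hc. destruct Hc as [L [_ V]].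
  apply gval_app; auto; [lia|]. constructor; auto. apply in_elist; auto.
Qed.

Lemma gl_pred n k : (N < n)%nat -> gl n k = fm d a (gl (n - 1)) k.
Proof. intros H. rewrite <- gl_S; [|lia]. f_equal; lia. Qed.

Lemma length_gl n k : length (gl n k) = length (tw d a n k).
Proof. apply length_map. Qed.

Lemma tw_nil n k : (n * d < k)%nat -> tw d a n k = [].
Proof.
  intros H. destruct (tw d a n k) as [|c l] eqn:E; auto. exfalso.
  assert (I : In c (tw d a n k)) by (rewrite E; simpl; auto).
  apply in_tw in I. destruct I as [L [W V]]. subst. clear E.
  assert (wsum c <= length c * d)%nat; [|lia]. clear H.
  induction V as [|e c [He _] V IH]; unfold wsum in *; simpl in *; lia.
Qed.

Lemma gl_sum_array : sum_array d a N (fun n k => lsum (gl n k)).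
Proof.
  split.
  - intros k H. unfold gl. rewrite tw_nil; auto.
  - intros n k H. rewrite gl_S; auto. unfold fm.
    apply (flat_map_measure lsum (fun k => lsum (gl n k))).
    + reflexivity.
    + apply lsum_app.
    + intros e. destruct (fst e <=? k)%nat; reflexivity.
Qed.

Lemma gl_blocks_gen m n es k : (N <= n - S m)%nat -> (S m <= n)%nat ->
  (forall e, In e es -> valid_edge d a e) ->
  (forall k, exists bs, gl (n - 1) k = concat bs /\
     forall b, In b bs -> exists i, (i <= m * d)%nat /\ (i <= k)%nat /\ b = gl (n - 1 - m) (k - i)) ->
  exists bs, flat_map (fun e : edge => if (fst e <=? k)%nat then gl (n - 1) (k - fst e)%nat else []) es
     = concat bs /\
  forall b, In b bs -> exists i, (i <= S m * d)%nat /\ (i <= k)%nat /\ b = gl (n - S m) (k - i).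
Proof.
  intros HN Hn V IH. induction es as [|e es IHe]; [exists []; simpl; tauto|].
  destruct IHe as [bs [E H]]; [intros; apply V; simpl; auto|].
  cbn [flat_map]. destruct (Nat.leb_spec (fst e) k) as [L|L]; [|exists bs; auto].
  destruct (IH (k - fst e)%nat) as [bs' [E' H']].
  exists (bs' ++ bs). rewrite concat_app, E, E'. split; auto.
  intros b Hb. apply in_app_iff in Hb. destruct Hb as [Hb|Hb]; auto.
  destruct (H' b Hb) as [i [H1 [H2 ->]]]. exists (fst e + i)%nat.
  destruct (V e (or_introl eq_refl)) as [Ve _]. split; [simpl; lia|]. split; [lia|].
  f_equal; lia.
Qed.

Lemma gl_blocks m n k : (N + m <= n)%nat ->
  exists bs, gl n k = concat bs /\
  forall b, In b bs -> exists i, (i <= m * d)%nat /\ (i <= k)%nat /\ b = gl (n - m) (k - i).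
Proof.
  revert n k. induction m as [|m IH]; intros n k H.
  - exists [gl n k]. simpl. rewrite app_nil_r. split; auto.
    intros b [<-|[]]. exists O. rewrite !Nat.sub_0_r. repeat split; lia.
  - rewrite gl_pred; [|lia]. apply gl_blocks_gen; try lia.
    + intros e. apply in_elist.
    + intros k'. apply IH. lia.
Qed.

Lemma gl_blocks_step n k : (N <= n)%nat ->
  exists bs, gl (S n) k = concat bs /\ (length bs <= length (elist d a))%nat /\
  forall b, In b bs -> exists i, (i <= d)%nat /\ (i <= k)%nat /\ b = gl n (k - i).
Proof.
  intros H. rewrite gl_S; auto. unfold fm.
  assert (V : forall e, In e (elist d a) -> valid_edge d a e) by (intros e; apply in_elist).
  revert V. generalize (elist d a) as es. induction es as [|e es IH]; intros V.
  - exists []. split; [reflexivity|]. split; [simpl; lia|]. intros b [].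
  - destruct IH as [bs [E [L B]]]; [intros; apply V; simpl; auto|].
    cbn [flat_map]. destruct (Nat.leb_spec (fst e) k) as [Le|Le].
    + exists (gl n (k - fst e) :: bs). cbn [concat]. rewrite E. split; auto. split; [simpl; lia|].
      intros b [<-|Hb]; auto. exists (fst e). destruct (V e (or_introl eq_refl)); auto.
    + exists bs. split; auto. split; [simpl; lia|auto].
Qed.

(** Every edge type occurs, so the total i can be spread over m levels, each taking as much as d
    allows. *)
Lemma gl_infix m n k i : (N + m <= n)%nat -> (i <= m * d)%nat -> (i <= k)%nat ->
  exists l1 l2, gl n k = l1 ++ gl (n - m) (k - i) ++ l2.
Proof.
  revert n k i. induction m as [|m IH]; intros n k i H Hi Hk.
  - simpl in Hi. exists [], []. rewrite app_nil_r. simpl. f_equal; lia.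
  - set (j := Nat.min i d). simpl in Hi.
    assert (I : In (j, O) (elist d a)).
    { apply in_elist. split; simpl; [lia|apply a1; lia]. }
    apply in_split in I. destruct I as [e1 [e2 E]].
    destruct (IH (n - 1)%nat (k - j)%nat (i - j)%nat) as [l1 [l2 E']]; try lia.
    rewrite gl_pred; [|lia]. unfold fm. rewrite E, flat_map_app.
    cbn [flat_map fst]. destruct (Nat.leb_spec j k); [|lia]. rewrite E'.
    replace (n - 1 - m)%nat with (n - S m)%nat by lia.
    replace (k - j - (i - j))%nat with (k - i)%nat by lia.
    match goal with |- exists _ _, ?u ++ (l1 ++ _ ++ l2) ++ ?v = _ => exists (u ++ l1), (l2 ++ v) end.
    rewrite !app_assoc. reflexivity.
Qed.

(** The edge (d,0) heads [elist], so the words ending in m such edges open the tower. *)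
Lemma tw_first m n k : (m <= n)%nat -> (m * d <= k)%nat ->
  exists rest, tw d a n k = map (fun c => c ++ repeat (d, O) m) (tw d a (n - m) (k - m * d)) ++ rest.
Proof.
  revert n k. induction m as [|m IH]; intros n k Hn Hk.
  - exists []. rewrite app_nil_r. simpl. rewrite !Nat.sub_0_r.
    rewrite map_ext with (g := fun c => c); [rewrite map_id; auto|]. intros c; apply app_nil_r.
  - destruct n as [|n]; [lia|]. cbn [tw].
    assert (E : exists es, elist d a = (d, O) :: es).
    { unfold elist. assert (A := a1 d (le_n _)). destruct d; simpl; destruct (a _); try lia;
      simpl; eexists; reflexivity. }
    destruct E as [es ->]. cbn [flat_map fst]. simpl in Hk.
    destruct (Nat.leb_spec d k); [|lia].
    destruct (IH n (k - d)%nat) as [rest E]; [lia|lia|]. rewrite E, map_app, map_map, <- app_assoc.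
    replace (S n - S m)%nat with (n - m)%nat by lia.
    replace (k - S m * d)%nat with (k - d - m * d)%nat by (simpl; lia).
    eexists. f_equal. apply map_ext. intros c. rewrite <- app_assoc. f_equal.
    simpl. symmetry. apply repeat_cons.
Qed.

Lemma pre_repeat m n0 x : (forall i, (i < m)%nat -> x (n0 + i)%nat = (d, O)) ->
  pre (n0 + m) x = pre n0 x ++ repeat (d, O) m /\ vtx x (n0 + m) = (vtx x n0 + m * d)%nat.
Proof.
  induction m as [|m IH]; intros H.
  - rewrite Nat.add_0_r. simpl repeat. rewrite app_nil_r. split; simpl; lia || auto.
  - destruct IH as [E1 E2]; [intros; apply H; lia|].
    rewrite <- plus_n_Sm. split.
    + rewrite pre_S, E1, H, <- app_assoc; [|lia]. f_equal. symmetry. apply repeat_cons.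
    + simpl vtx. rewrite E2, H; [|lia]. simpl. lia.
Qed.

Lemma first_block_position m n x : valid_path d a x -> (N + m <= n)%nat ->
  (forall i, (n - m <= i < n)%nat -> x i = (d, O)) ->
  (m * d <= vtx x n)%nat /\
  exists i rest, (i < length (tw d a (n - m) (vtx x n - m * d)))%nat /\
    nth i (tw d a n (vtx x n)) [] = pre n x /\
    gl n (vtx x n) = gl (n - m) (vtx x n - m * d) ++ rest.
Proof.
  intros V Hn Hx.
  destruct (pre_repeat m (n - m) x) as [E1 E2]; [intros; apply Hx; lia|].
  replace (n - m + m)%nat with n in E1, E2 by lia. split; [lia|].
  destruct (tw_first m n (vtx x n)) as [rest E]; [lia|lia|].
  replace (vtx x n - m * d)%nat with (vtx x (n - m)) in * by lia.
  assert (I := pre_in_tw d a (n - m) x V). apply In_nth with (d := []) in I.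
  destruct I as [i [Hi Ei]]. exists i, (map gval rest). split; auto. split.
  - rewrite E, app_nth1; [|rewrite length_map; auto].
    rewrite nth_indep with (d' := [] ++ repeat (d, O) m); [|rewrite length_map; auto].
    etransitivity; [exact (map_nth (fun c => c ++ repeat (d, O) m) _ [] i)|].
    rewrite E1. exact (f_equal (fun c => c ++ repeat (d, O) m) Ei).
  - unfold gl. rewrite E, map_app, map_map. f_equal. apply map_ext_in.
    intros c Hc. apply in_tw in Hc. destruct Hc as [L [_ Vc]]. apply gval_app; auto; [lia|].
    apply Forall_forall. intros e He. apply repeat_spec in He. subst. split; simpl; auto.
Qed.

(** A sum of j terms applies T only j - 1 times, so it may run up to the very end of the tower. *)
Lemma Ssum_tower n k i j y : (N <= n)%nat -> valid_path d a y ->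
  (i + j <= length (tw d a n k))%nat ->
  Ssum (Tp d a) g (sw (nth i (tw d a n k) []) y) j = psum (gl n k) (i + j) - psum (gl n k) i.
Proof.
  intros Hn Hy. induction j as [|j IH]; intros H; simpl.
  - rewrite Nat.add_0_r. lra.
  - rewrite IH; [|lia]. rewrite <- plus_n_Sm, psum_S; [|rewrite length_gl; lia].
    rewrite (Tp_iter d a n k); auto; [|lia].
    assert (I : In (nth (i + j) (tw d a n k) []) (tw d a n k)) by (apply nth_In; lia).
    apply in_tw in I. destruct I as [L [_ V]]. rewrite g_sw; auto; [|lia].
    unfold gl at 4. rewrite nth_indep with (d' := gval []); [|rewrite length_map; lia].
    rewrite map_nth. lra.
Qed.
End Blocks.

(** * Elementary estimates for real numbers *)

Lemma lsum_ge0 l : (forall x, In x l -> 0 <= x) -> 0 <= lsum l.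
Proof.
  induction l as [|x l IH]; intros H; simpl; [lra|].
  assert (0 <= x) by (apply H; simpl; auto).
  assert (0 <= lsum l) by (apply IH; intros; apply H; simpl; auto). unfold lsum in *. lra.
Qed.

Lemma sum_f_R0_mono f M M' : (forall n, 0 <= f n) -> (M <= M')%nat ->
  sum_f_R0 f M <= sum_f_R0 f M'.
Proof. intros H. induction 1; [lra|]. simpl. specialize (H (S m)). lra. Qed.

Lemma sum_half_pow e M : 0 <= e -> sum_f_R0 (fun n => e / 2 ^ (S n)) M <= e.
Proof.
  intros He. assert (E : sum_f_R0 (fun n => e / 2 ^ (S n)) M = e - e / 2 ^ (S M)).
  { induction M as [|M IH]; [simpl; lra|]. rewrite tech5, IH.
    assert (0 < 2 ^ M) by (apply pow_lt; lra). simpl. field. lra. }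
  rewrite E. assert (0 < 2 ^ S M) by (apply pow_lt; lra).
  assert (0 <= e / 2 ^ S M) by (apply Rmult_le_pos; [lra|left; apply Rinv_0_lt_compat; auto]). lra.
Qed.

Lemma Rdiv_le_iff x y z : 0 < y -> x / y <= z <-> x <= z * y.
Proof.
  intros Hy. assert (E : x = x / y * y) by (field; lra). rewrite E at 2. split; intros H.
  - apply Rmult_le_compat_r; lra.
  - apply Rmult_le_reg_r with y; auto.
Qed.

Lemma Rdiv_lt_iff x y z : 0 < y -> x / y < z <-> x < z * y.
Proof.
  intros Hy. assert (E : x = x / y * y) by (field; lra). rewrite E at 2. split; intros H.
  - apply Rmult_lt_compat_r; lra.
  - apply Rmult_lt_reg_r with y; auto.
Qed.

Lemma Rabs_div_pos x y : 0 < y -> Rabs (x / y) = Rabs x / y.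
Proof.
  intros H. unfold Rdiv. rewrite Rabs_mult, (Rabs_right (/ y)); auto. left. apply Rinv_0_lt_compat. auto.
Qed.

Lemma small_pow x e : 0 < x < 1 -> 0 < e -> exists n, x ^ n <= e.
Proof.
  intros Hx He. destruct (pow_lt_1_zero x ltac:(rewrite Rabs_right; lra) e He) as [n Hn].
  exists n. specialize (Hn n (le_n _)). rewrite Rabs_right in Hn; [lra|].
  apply Rle_ge, pow_le. lra.
Qed.

(** * The measure *)

Section Measure.
Variables (d : nat) (a : nat -> nat) (q t : R).
Hypothesis d1 : (1 <= d)%nat.
Hypothesis a1 : forall j, (j <= d)%nat -> (0 < a j)%nat.
Hypothesis q0 : 0 < q.
Hypothesis qa : q < / INR (a O).
Hypothesis t01 : 0 < t < 1.
Hypothesis qt : sum_f_R0 (fun j => INR (a j) * q ^ (d - j) * t ^ j) d = q ^ (d - 1).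

Notation OM := (OM_le d a q t).
Notation wt := (weight q t).
Notation ae := (ae d a q t).
Let w := t / q.

Lemma w_pos : 0 < w.
Proof. apply Rdiv_lt_0_compat; lra. Qed.

Lemma q_lt1 : q < 1.
Proof.
  eapply Rlt_le_trans; [exact qa|]. rewrite <- Rinv_1. apply Rinv_le_contravar; [lra|].
  apply (le_INR 1). apply a1. lia.
Qed.

Lemma p_at_q : p_at d a w = / q.
Proof.
  assert (E : q ^ d * p_at d a w = q ^ (d - 1)).
  { rewrite <- qt. unfold p_at. rewrite scal_sum. apply sum_eq. intros j Hj.
    replace (q ^ d) with (q ^ (d - j) * q ^ j) by (rewrite <- pow_add; f_equal; lia).
    unfold w, Rdiv. rewrite Rpow_mult_distr, pow_inv. field. apply pow_nonzero. lra. }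
  replace d with (S (d - 1)) in E at 1 by lia. simpl in E.
  assert (0 < q ^ (d - 1)) by (apply pow_lt; auto).
  apply Rmult_eq_reg_l with (q * q ^ (d - 1)); [|nra].
  rewrite E. field. lra.
Qed.

Lemma weight_eq c : wt c = q ^ length c * w ^ wsum c.
Proof.
  induction c as [|e c IH]; simpl; [lra|]. unfold weight in *. simpl. rewrite IH.
  unfold pe, wsum. simpl. fold w. rewrite pow_add. unfold wsum. ring.
Qed.

Lemma weight_pos c : 0 < wt c.
Proof.
  rewrite weight_eq. apply Rmult_lt_0_compat; apply pow_lt; auto. apply w_pos.
Qed.

Lemma weight_app c c' : wt (c ++ c') = wt c * wt c'.
Proof. rewrite !weight_eq, length_app, wsum_app, !pow_add. ring. Qed.

Definition lw (l : list (list edge)) : R := lsum (map wt l).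

Lemma lw_app l l' : lw (l ++ l') = lw l + lw l'.
Proof. unfold lw. rewrite map_app, lsum_app. auto. Qed.

Lemma lw_ge0 l : 0 <= lw l.
Proof.
  apply lsum_ge0. intros x H. apply in_map_iff in H. destruct H as [c [<- _]].
  left. apply weight_pos.
Qed.

Lemma lw_concat_seq L n : lw (concat (map L (seq 0 (S n)))) = sum_f_R0 (fun i => lw (L i)) n.
Proof.
  induction n as [|n IH].
  - simpl. rewrite app_nil_r. auto.
  - rewrite seq_S, map_app, concat_app, lw_app, IH. simpl. rewrite app_nil_r. auto.
Qed.

Lemma lw_firstn n l : lw (firstn n l) <= lw l.
Proof.
  rewrite <- (firstn_skipn n l) at 2. rewrite lw_app. assert (H := lw_ge0 (skipn n l)). lra.
Qed.

Lemma lw_firstn_sum l n : (S n <= length l)%nat ->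
  sum_f_R0 (fun i => wt (nth i l [])) n = lw (firstn (S n) l).
Proof.
  revert l. induction n as [|n IH]; intros l H.
  - destruct l as [|c l]; simpl in *; [lia|]. unfold lw. simpl. lra.
  - rewrite tech5, IH; [|lia].
    assert (E : firstn (S (S n)) l = firstn (S n) l ++ [nth (S n) l []]).
    { clear IH. revert l H. generalize (S n) as m. induction m as [|m IHm]; intros [|c l] H; simpl in *; try lia; auto.
      f_equal. apply IHm. lia. }
    rewrite E, lw_app. unfold lw at 3. simpl. lra.
Qed.

Lemma OM_mono A B r r' : (forall x, valid_path d a x -> B x -> A x) -> r <= r' -> OM A r -> OM B r'.
Proof.
  intros HA Hr H eps He. destruct (H eps He) as [cs [C S]]. exists cs. split; [auto|].
  intros M. specialize (S M). lra.
Qed.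

Lemma OM_ge0 A r : OM A r -> 0 <= r.
Proof.
  intros H. destruct (Rle_or_lt 0 r) as [|L]; auto. exfalso.
  destruct (H (- r / 2)) as [cs [_ S]]; [lra|]. specialize (S O). simpl in S.
  assert (P := weight_pos (cs O)). lra.
Qed.

(* [OM_le] wants exactly one word per index, so every row is padded with a word
   of tiny weight. *)
Lemma OM_rows A r (L : nat -> list (list edge)) :
  (forall x, valid_path d a x -> A x -> exists n c, In c (L n) /\ cyl c x) ->
  (forall M, sum_f_R0 (fun n => lw (L n)) M <= r) -> OM A r.
Proof.
  intros C S eps He.
  assert (P : forall n, exists m, q ^ m <= eps / 2 ^ (Datatypes.S n)).
  { intros n. apply small_pow; [split; [auto|apply q_lt1]|]. apply Rdiv_lt_0_compat; auto.
    apply pow_lt. lra. }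
  apply choice in P. destruct P as [m Hm].
  set (L' := fun n => L n ++ [repeat (O, O) (m n)]).
  set (F := fun n => concat (map L' (seq 0 n))).
  assert (FS : forall n, F (Datatypes.S n) = F n ++ L' n).
  { intros n. unfold F. rewrite seq_S, map_app, concat_app. simpl. rewrite app_nil_r. auto. }
  assert (FL : forall n, (n <= length (F n))%nat).
  { induction n as [|n IH]; [simpl; lia|]. rewrite FS, length_app. unfold L' at 1.
    rewrite length_app. simpl. lia. }
  assert (FE : forall n k, exists l, F (n + k)%nat = F n ++ l).
  { intros n k. induction k as [|k [l IH]]; [exists []; rewrite Nat.add_0_r, app_nil_r; auto|].
    rewrite <- plus_n_Sm, FS, IH, <- app_assoc. eexists; reflexivity. }
  assert (FN : forall n n' i, (i < length (F n))%nat -> (i < length (F n'))%nat ->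
     nth i (F n) [] = nth i (F n') []).
  { assert (W : forall n k i, (i < length (F n))%nat -> nth i (F n) [] = nth i (F (n + k)%nat) []).
    { intros n k i Hi. destruct (FE n k) as [l ->]. rewrite app_nth1; auto. }
    intros n n' i H H'. destruct (Nat.le_ge_cases n n').
    - replace n' with (n + (n' - n))%nat by lia. apply W; auto.
    - symmetry. replace n with (n' + (n - n'))%nat by lia. apply W; auto. }
  exists (fun k => nth k (F (Datatypes.S k)) []). split.
  - intros x Vx Ax. destruct (C x Vx Ax) as [n [c [Hc Hx]]].
    assert (I : In c (F (Datatypes.S n))).
    { rewrite FS. apply in_app_iff. right. unfold L'. apply in_app_iff. auto. }
    apply In_nth with (d := []) in I. destruct I as [k [Hk Ek]]. exists k.
    rewrite (FN _ (Datatypes.S n)); [rewrite Ek; auto| |auto].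
    specialize (FL (Datatypes.S k)). lia.
  - intros M. assert (E : sum_f_R0 (fun k => wt (nth k (F (Datatypes.S k)) [])) M =
       sum_f_R0 (fun k => wt (nth k (F (Datatypes.S M)) [])) M).
    { apply sum_eq. intros k Hk. f_equal. apply FN.
      - specialize (FL (Datatypes.S k)). lia.
      - specialize (FL (Datatypes.S M)). lia. }
    rewrite E, lw_firstn_sum; [|apply FL].
    eapply Rle_trans; [apply lw_firstn|]. unfold F. rewrite lw_concat_seq.
    eapply Rle_trans; [|apply (Rplus_le_compat _ _ _ _ (S M) (sum_half_pow eps M (Rlt_le _ _ He)))].
    rewrite <- sum_plus. apply sum_Rle. intros n _. unfold L'. rewrite lw_app.
    apply Rplus_le_compat_l. unfold lw. simpl. rewrite weight_eq, repeat_length.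
    replace (wsum (repeat (O, O) (m n))) with O.
    + simpl. specialize (Hm n). simpl in Hm. lra.
    + clear. induction (m n) as [|k IH]; auto.
Qed.

Lemma null_of_small A : (forall eps, 0 < eps -> OM A eps) -> OM A 0.
Proof.
  intros H eps He. destruct (H (eps / 2) ltac:(lra) (eps / 2) ltac:(lra)) as [cs [C S]].
  exists cs. split; auto. intros M. specialize (S M). lra.
Qed.

Lemma null_Union (A : nat -> path -> Prop) :
  (forall m, OM (A m) 0) -> OM (fun x => exists m, A m x) 0.
Proof.
  intros H. apply null_of_small. intros eps He.
  assert (P : forall m, exists cs : nat -> list edge,
    (forall x, valid_path d a x -> A m x -> exists n, cyl (cs n) x) /\
    (forall M, sum_f_R0 (fun n => wt (cs n)) M <= eps / 2 ^ (S m))).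
  { intros m. destruct (H m (eps / 2 ^ (S m))) as [cs [C S']].
    - apply Rdiv_lt_0_compat; auto. apply pow_lt. lra.
    - exists cs. split; auto. intros M. specialize (S' M). lra. }
  apply choice in P. destruct P as [cs P].
  (* Row n is the finite antidiagonal of the double family of words. *)
  apply OM_rows with (L := fun n => map (fun i => cs i (n - i)%nat) (seq 0 (S n))).
  - intros x Vx [m Ax]. destruct (P m) as [C _]. destruct (C x Vx Ax) as [n Hn].
    exists (m + n)%nat, (cs m n). split; auto. apply in_map_iff. exists m. split.
    + f_equal. lia.
    + apply in_seq. lia.
  - intros M.
    assert (E : forall M, sum_f_R0 (fun n => lw (map (fun i => cs i (n - i)%nat) (seq 0 (S n)))) M
       = sum_f_R0 (fun i => sum_f_R0 (fun n => wt (cs i n)) (M - i)) M).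
    { clear M. induction M as [|M IH].
      - unfold lw. simpl. lra.
      - rewrite tech5, IH, (tech5 (fun i => sum_f_R0 (fun n => wt (cs i n)) (S M - i)) M).
        assert (E2 : sum_f_R0 (fun i => sum_f_R0 (fun n => wt (cs i n)) (S M - i)) M =
          sum_f_R0 (fun i => sum_f_R0 (fun n => wt (cs i n)) (M - i)) M +
          sum_f_R0 (fun i => wt (cs i (S M - i)%nat)) M).
        { rewrite <- sum_plus. apply sum_eq. intros i Hi.
          replace (S M - i)%nat with (S (M - i)) by lia. reflexivity. }
        assert (E3 : forall K f, lsum (map f (seq 0 (S K))) = sum_f_R0 f K).
        { intros K f. induction K as [|K IHK]; [simpl; lra|].
          rewrite seq_S, map_app, lsum_app, IHK. simpl. lra. }
        assert (E4 : lw (map (fun i => cs i (S M - i)%nat) (seq 0 (S (S M)))) =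
          sum_f_R0 (fun i => wt (cs i (S M - i)%nat)) M + wt (cs (S M) O)).
        { unfold lw. rewrite map_map, E3, tech5, Nat.sub_diag. reflexivity. }
        rewrite E2, E4, Nat.sub_diag.
        change (sum_f_R0 (fun n => wt (cs (S M) n)) 0) with (wt (cs (S M) O)). lra. }
    rewrite E. eapply Rle_trans; [|apply (sum_half_pow eps M); lra].
    apply sum_Rle. intros i _. apply P.
Qed.

Lemma null_or A B : OM A 0 -> OM B 0 -> OM (fun x => A x \/ B x) 0.
Proof.
  intros HA HB. eapply OM_mono; [| |apply (null_Union (fun m => match m with O => A | _ => B end))].
  - intros x _ [H|H]; [exists O|exists 1%nat]; auto.
  - lra.
  - intros [|m]; auto.
Qed.

Lemma ae_impl P Q : (forall x, valid_path d a x -> P x -> Q x) -> ae P -> ae Q.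
Proof.
  intros H. apply OM_mono; [|lra]. intros x V NQ NP. apply NQ. auto.
Qed.

Lemma ae_all (P : nat -> path -> Prop) : (forall m, ae (P m)) -> ae (fun x => forall m, P m x).
Proof.
  intros H. eapply OM_mono; [| |apply (null_Union (fun m x => ~ P m x)); exact H]; [|lra].
  intros x _ N. apply not_all_ex_not. auto.
Qed.

Lemma ae_and P Q : ae P -> ae Q -> ae (fun x => P x /\ Q x).
Proof.
  intros HP HQ. eapply OM_mono; [| |apply (null_or _ _ HP HQ)]; [|lra].
  intros x _ N. destruct (classic (P x)); [right|left]; tauto.
Qed.

Fixpoint allw (n : nat) : list (list edge) :=
  match n with
  | O => [[]]
  | S n' => flat_map (fun c => map (fun e => c ++ [e]) (elist d a)) (allw n')
  end.

Lemma in_allw n c : In c (allw n) <-> length c = n /\ Forall (valid_edge d a) c.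
Proof.
  revert c. induction n as [|n IH]; intros c; simpl.
  - split.
    + intros [<-|[]]. auto.
    + intros [H _]. left. destruct c; auto. discriminate.
  - rewrite in_flat_map. split.
    + intros [c' [H1 H2]]. apply in_map_iff in H2. destruct H2 as [e [<- He]].
      apply IH in H1. destruct H1. rewrite length_app. simpl. split; [lia|].
      apply Forall_app. split; auto. constructor; auto. apply in_elist; auto.
    + intros [H1 H2]. destruct (exists_last (l := c)) as [c' [e ->]].
      { intros ->. discriminate. }
      rewrite length_app in H1. simpl in H1. apply Forall_app in H2. destruct H2 as [H2 H3].
      exists c'. split; [apply IH; split; auto; lia|]. apply in_map_iff. exists e. split; auto.
      apply in_elist. inversion H3; auto.
Qed.

Lemma lw_map_app c l : lw (map (app c) l) = wt c * lw l.
Proof.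
  unfold lw. induction l as [|c' l IH]; simpl; [lra|]. rewrite weight_app.
  unfold lsum in *. rewrite IH. ring.
Qed.

Lemma lw_edges : lw (map (fun e => [e]) (elist d a)) = 1.
Proof.
  unfold lw. rewrite map_map.
  assert (E : lsum (map (fun e => wt [e]) (elist d a)) = q * p_at d a w).
  { unfold elist, p_at.
    assert (R : forall j n s, lsum (map (fun e => wt [e]) (map (pair j) (seq s n)))
       = INR n * (q * w ^ j)).
    { intros j n. induction n as [|n IH]; intros s; cbn [seq map].
      - simpl. lra.
      - change (lsum (wt [(j, s)] :: map (fun e => wt [e]) (map (pair j) (seq (S s) n))) =
          INR (S n) * (q * w ^ j)).
        unfold lsum in *. cbn [fold_right]. rewrite IH, S_INR. unfold weight, pe. simpl. fold w. lra. }
    clear - R. induction d as [|d' IH]; cbn [edges_upto].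
    - rewrite app_nil_r, R. simpl. ring.
    - rewrite map_app, lsum_app, R. cbn [sum_f_R0]. rewrite Rmult_plus_distr_l.
      rewrite Rplus_comm. f_equal; [exact IH|ring]. }
  rewrite E, p_at_q. field. lra.
Qed.

Lemma lw_allw n : lw (allw n) = 1.
Proof.
  induction n as [|n IH]; [unfold lw, weight; simpl; lra|]. cbn [allw]. rewrite <- IH.
  generalize (allw n) as l. induction l as [|c l IHl]; [reflexivity|].
  cbn [flat_map]. rewrite lw_app, IHl. change (lw (c :: l)) with (wt c + lw l). f_equal.
  rewrite <- (Rmult_1_r (wt c)), <- lw_edges, <- lw_map_app, map_map. reflexivity.
Qed.

Lemma cyl_pre n x : cyl (pre n x) x.
Proof. intros i Hi. rewrite pre_length in Hi. symmetry. apply pre_nth; auto. Qed.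

Lemma Forall_pre n x : valid_path d a x -> Forall (valid_edge d a) (pre n x).
Proof.
  intros V. apply Forall_forall. intros e He. apply in_map_iff in He.
  destruct He as [i [<- _]]. apply V.
Qed.

(** Only the disjoint windows of length m after n0 are tested: missing u in r of them has
    probability (1 - [wt u])^r. *)
Lemma recurrent_pattern u : Forall (valid_edge d a) u -> (0 < length u)%nat ->
  ae (fun x => forall n0, exists n, (n0 <= n)%nat /\
     forall i, (i < length u)%nat -> x (n + i)%nat = nth i u (O, O)).
Proof.
  intros Vu Lu. apply ae_all. intros n0. set (m := length u) in *.
  assert (Iu : In u (allw m)) by (apply in_allw; auto).
  apply in_split in Iu. destruct Iu as [l1 [l2 E]].
  set (L := l1 ++ l2).
  assert (EL : lw L = 1 - wt u).
  { assert (H := lw_allw m). rewrite E, lw_app in H. change (lw (u :: l2)) with (wt u + lw l2) in H.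
    unfold L. rewrite lw_app. lra. }
  assert (IL : forall c, In c (allw m) -> c <> u -> In c L).
  { intros c Hc N. rewrite E in Hc. unfold L. apply in_app_iff in Hc. apply in_app_iff.
    destruct Hc as [|[|]]; auto. congruence. }
  (* [W r]: words of length n0 + r m none of whose r final blocks is u *)
  set (W := fix W r := match r with O => allw n0 | S r' => flat_map (fun c => map (app c) L) (W r') end).
  assert (LW : forall r, lw (W r) = (1 - wt u) ^ r).
  { induction r as [|r IH]; [apply lw_allw|]. cbn [W]. simpl pow. rewrite <- IH, <- EL.
    generalize (W r) as l. induction l as [|c l IHl]; [unfold lw at 1 3; simpl; lra|].
    cbn [flat_map]. rewrite lw_app, IHl, lw_map_app. change (lw (c :: l)) with (wt c + lw l). ring. }
  assert (PU := weight_pos u).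
  assert (U1 : 0 <= 1 - wt u) by (rewrite <- EL; apply lw_ge0).
  apply null_of_small. intros eps He.
  assert (R : exists r, (1 - wt u) ^ r <= eps).
  { destruct (Req_dec (1 - wt u) 0) as [Z|Z].
    - exists 1%nat. rewrite Z. simpl. lra.
    - apply small_pow; lra. }
  destruct R as [r Hr].
  apply OM_rows with (L := fun n => match n with O => W r | _ => [] end).
  - intros x Vx Nx. exists O, (pre (n0 + r * m) x). split; [|apply cyl_pre]. clear Hr.
    induction r as [|r IH].
    + simpl. rewrite Nat.add_0_r. apply in_allw. rewrite pre_length. split; auto. apply Forall_pre; auto.
    + cbn [W]. apply in_flat_map. exists (pre (n0 + r * m) x). split; auto.
      apply in_map_iff. exists (map x (seq (n0 + r * m) m)). split.
      * replace (n0 + S r * m)%nat with ((n0 + r * m) + m)%nat by (simpl; lia).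
        unfold pre. rewrite (seq_app (n0 + r * m) m 0), map_app. reflexivity.
      * apply IL.
        -- apply in_allw. rewrite length_map, length_seq. split; auto. apply Forall_forall.
           intros e H. apply in_map_iff in H. destruct H as [i [<- _]]. apply Vx.
        -- intros Eu. apply Nx. exists (n0 + r * m)%nat. split; [lia|]. intros i Hi. rewrite <- Eu.
           rewrite nth_indep with (d' := x O); [|rewrite length_map, length_seq; auto].
           rewrite map_nth, seq_nth; auto.
  - intros M. assert (E0 : sum_f_R0 (fun n => lw (match n with O => W r | _ => [] end)) M = lw (W r)).
    { induction M as [|M IH]; simpl; auto. rewrite IH. unfold lw at 2. simpl. lra. }
    rewrite E0, LW. auto.
Qed.

Lemma lw_tw n k : lw (tw d a n k) = hA d a n k * (q ^ n * w ^ k).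
Proof.
  assert (H : forall c, In c (tw d a n k) -> wt c = q ^ n * w ^ k).
  { intros c Hc. apply in_tw in Hc. destruct Hc as [H1 [H2 _]]. rewrite weight_eq, H1, H2. auto. }
  unfold hA. revert H. generalize (tw d a n k) as l. induction l as [|c l IH]; intros H.
  - unfold lw. simpl. lra.
  - change (lw (c :: l)) with (wt c + lw l). rewrite IH; [|intros; apply H; simpl; auto].
    rewrite H; [|simpl; auto]. change (length (c :: l)) with (S (length l)). rewrite S_INR. lra.
Qed.

Lemma lw_flat_map_le {X} (F : X -> list (list edge)) l B :
  (forall x, In x l -> lw (F x) <= B) -> lw (flat_map F l) <= INR (length l) * B.
Proof.
  induction l as [|x l IH]; intros H.
  - unfold lw. simpl. lra.
  - cbn [flat_map]. rewrite lw_app. change (length (x :: l)) with (S (length l)). rewrite S_INR.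
    assert (H1 := H x (or_introl eq_refl)). assert (H2 := IH (fun y Hy => H y (or_intror Hy))). lra.
Qed.

(* Borel-Cantelli: the words ending at level n in vertices that are not good
   have total weight at most d / (n + 1)^2. *)
Lemma ae_eventually_good :
  ae (fun x => exists n1, forall n, (n1 <= n)%nat -> good_vertex (/ q) w (hA d a) n (vtx x n)).
Proof.
  assert (W := w_pos). apply null_of_small. intros eps He.
  destruct (INR_unbounded (INR d / eps)) as [n0' H0]. set (n0 := S n0').
  assert (Hn0 : INR d / INR n0 <= eps).
  { assert (0 < INR n0) by (apply lt_0_INR; unfold n0; lia).
    assert (INR d / eps < INR n0) by (unfold n0; rewrite S_INR; lra).
    apply Rmult_le_reg_r with (INR n0); auto. unfold Rdiv. rewrite Rmult_assoc, Rinv_l; [|lra].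
    apply Rmult_lt_compat_r with (r := eps) in H1; auto. unfold Rdiv in H1.
    rewrite Rmult_assoc, Rinv_l in H1; lra. }
  set (F := fun n k => if excluded_middle_informative (good_vertex (/ q) w (hA d a) n k)
     then [] else tw d a n k).
  apply OM_rows with (L := fun n => flat_map (F (n0 + n)%nat) (seq 0 (S ((n0 + n) * d)))).
  - intros x Vx Nx.
    destruct (classic (exists n, (n0 <= n)%nat /\ ~ good_vertex (/ q) w (hA d a) n (vtx x n)))
      as [[n [Hn G]]|N].
    + exists (n - n0)%nat, (pre n x). split; [|apply cyl_pre].
      replace (n0 + (n - n0))%nat with n by lia. apply in_flat_map. exists (vtx x n).
      assert (I := pre_in_tw d a n x Vx). split.
      * apply in_seq. split; [lia|]. destruct (Nat.lt_ge_cases (n * d) (vtx x n)) as [L|]; [|lia].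
        rewrite tw_nil in I; auto. destruct I.
      * unfold F. destruct (excluded_middle_informative _); tauto.
    + exfalso. apply Nx. exists n0. intros n Hn. apply NNPP. intros G. apply N. exists n. auto.
  - intros M.
    (* 1 / (m + 1)^2 is majorized by the telescoping difference 1 / m - 1 / (m + 1). *)
    assert (B : forall n, lw (flat_map (F (n0 + n)%nat) (seq 0 (S ((n0 + n) * d)))) <=
       INR d * (/ INR (n0 + n) - / INR (S (n0 + n)))).
    { intros n. set (m := (n0 + n)%nat). assert (m0 : 0 < INR m) by (apply lt_0_INR; unfold m, n0; lia).
      assert (Z : 0 < INR (S m)) by (rewrite S_INR; lra).
      eapply Rle_trans; [apply (lw_flat_map_le (F m) _ (/ INR (S m) ^ 3))|].
      - intros k _. unfold F. destruct (excluded_middle_informative _) as [G|G].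
        + left. apply Rinv_0_lt_compat. apply pow_lt; auto.
        + rewrite lw_tw. unfold good_vertex in G. apply Rnot_le_lt in G.
          assert (Q : 0 < q ^ m) by (apply pow_lt; auto). assert (Wk : 0 < w ^ k) by (apply pow_lt; auto).
          assert (Z3 : 0 < INR (S m) ^ 3) by (apply pow_lt; auto).
          apply Rmult_le_reg_l with (INR (S m) ^ 3); auto. rewrite Rinv_r; [|lra].
          rewrite pow_inv in G.
          apply Rmult_lt_compat_r with (r := q ^ m * w ^ k) in G; [|nra].
          replace (/ q ^ m / w ^ k * (q ^ m * w ^ k)) with 1 in G; [lra|field; lra].
      - rewrite length_seq.
        assert (E : INR (S (m * d)) <= INR d * INR (S m)).
        { rewrite <- mult_INR. apply le_INR. nia. }
        assert (I3 : 0 < / INR (S m) ^ 3) by (apply Rinv_0_lt_compat; apply pow_lt; auto).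
        eapply Rle_trans; [apply Rmult_le_compat_r; [lra|exact E]|].
        replace (INR d * INR (S m) * / INR (S m) ^ 3) with (INR d * (/ INR (S m) * / INR (S m)))
          by (field; lra).
        apply Rmult_le_compat_l; [apply pos_INR|].
        replace (/ INR m - / INR (S m)) with (/ INR m * / INR (S m))
          by (rewrite S_INR; field; rewrite S_INR in Z; lra).
        apply Rmult_le_compat_r; [left; apply Rinv_0_lt_compat; auto|].
        apply Rinv_le_contravar; auto. rewrite S_INR. lra. }
    eapply Rle_trans; [apply sum_Rle; intros n _; apply B|].
    assert (E : sum_f_R0 (fun n => INR d * (/ INR (n0 + n) - / INR (S (n0 + n)))) M =
      INR d * (/ INR n0 - / INR (S (n0 + M)))).
    { induction M as [|M IH]; [cbn [sum_f_R0]; rewrite !Nat.add_0_r; reflexivity|].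
      rewrite tech5, IH, <- plus_n_Sm. ring. }
    rewrite E. assert (0 < / INR (S (n0 + M))) by (apply Rinv_0_lt_compat, lt_0_INR; lia).
    assert (P := pos_INR d). unfold Rdiv in Hn0. nra.
Qed.

Lemma weight_le1 c : Forall (valid_edge d a) c -> wt c <= 1.
Proof.
  intros V. assert (I : In c (allw (length c))) by (apply in_allw; auto).
  rewrite <- (lw_allw (length c)). apply in_split in I. destruct I as [l1 [l2 ->]].
  rewrite lw_app. change (lw (c :: l2)) with (wt c + lw l2).
  assert (H1 := lw_ge0 l1). assert (H2 := lw_ge0 l2). lra.
Qed.

Lemma cyl_sw c x : cyl c (sw c x).
Proof. intros i Hi. apply sw_lt. auto. Qed.

(* c and c' end at the same vertex and so have equal weight: exchanging these
   prefixes in a cover does not increase its total weight. *)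
Lemma swap_null A c c' : length c = length c' -> wsum c = wsum c' ->
  Forall (valid_edge d a) c' -> OM A 0 -> OM (fun x => cyl c x /\ A (sw c' x)) 0.
Proof.
  intros L S V H eps He. destruct (H eps He) as [cs [C B]].
  (* A cover word compatible with c' is replaced by c if it is shorter; otherwise its prefix c'
     becomes c. In the first case it is a prefix of c', so it weighs at least as much as c. *)
  set (f := fun b => if excluded_middle_informative (exists y, cyl b y /\ cyl c' y) then
     if (length b <? length c)%nat then c else c ++ skipn (length c) b else b).
  exists (fun n => f (cs n)). split.
  - intros x Vx [Hc Ax]. destruct (C _ (valid_sw d a c' x V Vx) Ax) as [n Hn]. exists n.
    unfold f. destruct (excluded_middle_informative _) as [_|N].
    2: { exfalso. apply N. exists (sw c' x). split; auto. apply cyl_sw. }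
    destruct (Nat.ltb_spec (length (cs n)) (length c)); auto.
    intros i Hi. destruct (Nat.lt_ge_cases i (length c)) as [Li|Li].
    + rewrite app_nth1; auto.
    + rewrite app_nth2; auto. rewrite nth_skipn. replace (length c + (i - length c))%nat with i by lia.
      rewrite length_app, length_skipn in Hi. rewrite <- Hn; [|lia]. rewrite sw_ge; auto. lia.
  - intros M. eapply Rle_trans; [|apply (B M)]. apply sum_Rle. intros n _. generalize (cs n) as b. intros b.
    unfold f. destruct (excluded_middle_informative _) as [[y [Y1 Y2]]|_]; [|lra].
    assert (E : wt c = wt c') by (rewrite !weight_eq, L, S; auto).
    destruct (Nat.ltb_spec (length b) (length c)) as [Lb|Lb].
    + assert (E' : c' = b ++ skipn (length b) c').
      { rewrite <- (firstn_skipn (length b) c') at 1. f_equal.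
        apply nth_ext with (d := (O, O)) (d' := (O, O)); [rewrite length_firstn; lia|].
        intros i Hi. rewrite length_firstn in Hi. rewrite nth_firstn.
        destruct (Nat.ltb_spec i (length b)); [|lia]. rewrite <- Y1, <- Y2; auto. lia. }
      rewrite E, E', weight_app.
      assert (W1 : wt (skipn (length b) c') <= 1).
      { apply weight_le1. rewrite E' in V. apply Forall_app in V. tauto. }
      assert (P := weight_pos b). nra.
    + assert (E' : b = c' ++ skipn (length c) b).
      { rewrite <- (firstn_skipn (length c) b) at 1. f_equal.
        apply nth_ext with (d := (O, O)) (d' := (O, O)); [rewrite length_firstn; lia|].
        intros i Hi. rewrite length_firstn in Hi. rewrite nth_firstn.
        destruct (Nat.ltb_spec i (length c)); [|lia]. rewrite <- Y1, <- Y2; auto; lia. }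
      rewrite weight_app, E, <- weight_app, <- E'. lra.
Qed.

(** Witnesses that T acts on x by exchanging its prefix of length n, see [Tp_nonmaximal]. *)
Definition nonmaximal_at (x : path) (n k i : nat) : Prop :=
  (S i < length (tw d a n k))%nat /\ nth i (tw d a n k) [] = pre n x.

(** Exchanging the two edges keeps the end vertex and gives a later word, so the prefix is not the
    last word of its tower. *)
Lemma pattern_nonmaximal x i0 : valid_path d a x -> x i0 = (O, O) -> x (S i0) = (d, O) ->
  exists k i, nonmaximal_at x (S (S i0)) k i.
Proof.
  intros V H0 H1. set (n := S (S i0)). set (k := vtx x n). exists k.
  assert (I := pre_in_tw d a n x V). fold k in I.
  assert (E : pre n x = pre i0 x ++ [(O, O); (d, O)]).
  { unfold n. rewrite !pre_S, H0, H1, <- app_assoc. reflexivity. }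
  set (c' := pre i0 x ++ [(d, O); (O, O)]).
  assert (Vu : Forall (valid_edge d a) (pre i0 x)) by (apply Forall_pre; auto).
  assert (I' : In c' (tw d a n k)).
  { apply in_tw. apply in_tw in I. destruct I as [_ [S _]]. rewrite E in S.
    rewrite wsum_app in S. unfold c'. rewrite length_app, pre_length, wsum_app. simpl.
    unfold wsum at 2 in S. unfold wsum at 2. simpl in *. split; [unfold n; lia|]. split; [lia|].
    apply Forall_app. split; auto. repeat constructor; simpl; auto; try apply a1; lia. }
  assert (P : path_prec (sw (pre n x) path0) (sw c' path0)).
  { assert (Q1 : forall u v : edge, nth (S i0) (pre i0 x ++ [u; v]) (O, O) = v).
    { intros u v. rewrite app_nth2, pre_length; [|rewrite pre_length; lia].
      replace (S i0 - i0)%nat with 1%nat by lia. reflexivity. }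
    assert (L' : length c' = n) by (unfold c'; rewrite length_app, pre_length; unfold n; simpl; lia).
    exists (S i0).
    assert (E1 : sw (pre n x) path0 (S i0) = (d, O)).
    { rewrite sw_lt; [rewrite E; apply Q1|rewrite pre_length; unfold n; lia]. }
    assert (E2 : sw c' path0 (S i0) = (O, O)).
    { rewrite sw_lt; [apply Q1|rewrite L'; unfold n; lia]. }
    rewrite E1, E2. split; [intros X; injection X; lia|]. split.
    - intros j Hj. rewrite !sw_ge; auto; [rewrite L'|rewrite pre_length]; unfold n; lia.
    - split; [|left; simpl; lia].
      apply in_tw in I. apply in_tw in I'. destruct I as [La [Sa _]]. destruct I' as [Lb [Sb _]].
      assert (Va := vtx_sw_len (pre n x) path0). assert (Vb := vtx_sw_len c' path0).
      rewrite La in Va. rewrite Lb in Vb. fold n. congruence. }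
  apply In_nth with (d := []) in I. destruct I as [i [Hi Ei]]. exists i. split; auto.
  apply In_nth with (d := []) in I'. destruct I' as [l [Hl El]].
  destruct (Nat.lt_trichotomy i l) as [|[->|G]]; [lia| |]; exfalso.
  - rewrite <- Ei, <- El in P. exact (path_prec_asym _ _ P P).
  - apply (path_prec_asym _ _ P). rewrite <- Ei, <- El.
    apply (ForallOrdPairs_nth (wprec)); [apply tw_sorted|lia].
Qed.

Lemma Tp_nonmaximal x n k i : valid_path d a x -> nonmaximal_at x n k i ->
  Tp d a x = sw (nth (S i) (tw d a n k) []) x.
Proof.
  intros V [H E]. rewrite <- (Tp_step d a n k i x V H), E, sw_pre. auto.
Qed.

Lemma ae_nonmaximal_from N : ae (fun x => exists n k i, (N <= n)%nat /\ nonmaximal_at x n k i).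
Proof.
  assert (R := recurrent_pattern [(O, O); (d, O)]).
  apply ae_impl with (2 := R ltac:(repeat constructor; simpl; auto; try apply a1; lia) ltac:(simpl; lia)).
  intros x V H. destruct (H N) as [n [Hn P]].
  destruct (pattern_nonmaximal x n V) as [k [i Q]].
  - specialize (P O). simpl in P. rewrite Nat.add_0_r in P. apply P. lia.
  - specialize (P 1%nat). simpl in P. rewrite Nat.add_1_r in P. apply P. lia.
  - exists (S (S n)), k, i. split; auto.
Qed.

Lemma ae_nonmaximal : ae (fun x => exists n k i, nonmaximal_at x n k i).
Proof.
  eapply ae_impl; [|apply (ae_nonmaximal_from 0)].
  intros x _ [n [k [i [_ H]]]]. exists n, k, i. auto.
Qed.

(** Almost everywhere T is one of countably many exchanges of prefixes with the same end vertex, and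
    null sets pull back under each of them by [swap_null]. *)
Lemma null_preimage A : OM A 0 -> OM (fun x => A (Tp d a x)) 0.
Proof.
  intros HA.
  assert (HU : OM (fun x => exists n k i, nonmaximal_at x n k i /\
    A (sw (nth (S i) (tw d a n k) []) x)) 0).
  { apply null_Union. intros n. apply null_Union. intros k. apply null_Union. intros i.
    destruct (Nat.lt_ge_cases (S i) (length (tw d a n k))) as [L|L].
    - assert (I : In (nth i (tw d a n k) []) (tw d a n k)) by (apply nth_In; lia).
      assert (I' : In (nth (S i) (tw d a n k) []) (tw d a n k)) by (apply nth_In; lia).
      apply in_tw in I. apply in_tw in I'. destruct I as [I1 [I2 _]]. destruct I' as [I1' [I2' I3']].
      eapply OM_mono; [|apply Rle_refl|
        apply (swap_null A (nth i (tw d a n k) []) (nth (S i) (tw d a n k) [])); auto; congruence].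
      intros x _ [[_ E] H]. split; auto. rewrite E. apply cyl_pre.
    - eapply OM_mono; [|apply Rle_refl|exact HA]. intros x _ [[H _] _]. lia. }
  eapply OM_mono; [|apply Rle_refl|apply (null_or _ _ ae_nonmaximal HU)].
  intros x V H. destruct (classic (exists n k i, nonmaximal_at x n k i)) as [[n [k [i Q]]]|]; auto.
  right. exists n, k, i. split; auto. rewrite <- (Tp_nonmaximal x n k i); auto.
Qed.

Lemma ae_Tp P : ae P -> ae (fun x => P (Tp d a x)).
Proof. intros H. apply (null_preimage (fun x => ~ P x)). auto. Qed.

Lemma ae_orbit P : ae P -> ae (fun x => forall j, P (Nat.iter j (Tp d a) x)).
Proof.
  intros H. apply ae_all. induction m as [|m IH]; auto.
  assert (E := ae_Tp _ IH). eapply ae_impl; [|exact E]. intros x _ Q.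
  rewrite Nat.iter_succ_r. auto.
Qed.

Definition ext (N : nat) (c : list edge) : list (list edge) := map (app c) (allw (N - length c)).

Lemma lw_ext N c : lw (ext N c) = wt c.
Proof. unfold ext. rewrite lw_map_app, lw_allw. ring. Qed.

Lemma ext_cover N c x : valid_path d a x -> cyl c x -> exists b, In b (ext N c) /\
  cyl b x /\ (N <= length b)%nat.
Proof.
  intros V H. set (m := (N - length c)%nat).
  exists (c ++ map x (seq (length c) m)). split; [|split].
  - apply in_map. apply in_allw. rewrite length_map, length_seq. split; auto.
    apply Forall_forall. intros e He. apply in_map_iff in He. destruct He as [i [<- _]]. apply V.
  - intros i Hi. rewrite length_app, length_map, length_seq in Hi.
    destruct (Nat.lt_ge_cases i (length c)).
    + rewrite app_nth1; auto.
    + rewrite app_nth2; auto. rewrite nth_indep with (d' := x O); [|rewrite length_map, length_seq; lia].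
      rewrite map_nth, seq_nth; [|lia]. f_equal. lia.
  - rewrite length_app, length_map, length_seq. unfold m. lia.
Qed.

(* Extending the words of a cover to length at least N splits the cover into one
   of the part in E and one of the rest. *)
Lemma cmeas_cylindric N (E : path -> Prop) :
  (forall x y, valid_path d a x -> valid_path d a y -> (forall i, (i < N)%nat -> x i = y i) ->
     E x -> E y) -> cmeas d a q t E.
Proof.
  intros HE A r HA.
  set (A1 := fun x => A x /\ E x). set (A2 := fun x => A x /\ ~ E x).
  set (cE := fun c => exists x, valid_path d a x /\ cyl c x /\ E x).
  set (dec := fun c => if excluded_middle_informative (cE c) then true else false).
  set (L1 := fun (cs : nat -> list edge) n => filter dec (ext N (cs n))).
  set (L2 := fun (cs : nat -> list edge) n => filter (fun c => negb (dec c)) (ext N (cs n))).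
  assert (L12 : forall cs n, lw (L1 cs n) + lw (L2 cs n) = wt (cs n)).
  { intros cs n. rewrite <- (lw_ext N). unfold L1, L2. generalize (ext N (cs n)) as l.
    induction l as [|c l IH]; [unfold lw; simpl; lra|]. cbn [filter].
    change (lw (c :: l)) with (wt c + lw l).
    destruct (dec c); cbn [negb]; [change (lw (c :: filter dec l)) with (wt c + lw (filter dec l))|
      change (lw (c :: filter (fun c => negb (dec c)) l)) with (wt c + lw (filter (fun c => negb (dec c)) l))]; lra. }
  assert (S12 : forall cs M, sum_f_R0 (fun n => lw (L1 cs n)) M + sum_f_R0 (fun n => lw (L2 cs n)) M
     = sum_f_R0 (fun n => wt (cs n)) M).
  { intros cs M. rewrite <- sum_plus. apply sum_eq. intros; apply L12. }
  assert (C1 : forall cs, (forall x, valid_path d a x -> A x -> exists n, cyl (cs n) x) ->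
    forall x, valid_path d a x -> A1 x -> exists n c, In c (L1 cs n) /\ cyl c x).
  { intros cs C x V [Ax Ex]. destruct (C x V Ax) as [n Hn].
    destruct (ext_cover N _ x V Hn) as [b [Hb [Cb _]]]. exists n, b. split; auto.
    apply filter_In. split; auto. unfold dec. destruct (excluded_middle_informative (cE b)) as [|F]; auto.
    exfalso. apply F. exists x. auto. }
  assert (C2 : forall cs, (forall x, valid_path d a x -> A x -> exists n, cyl (cs n) x) ->
    forall x, valid_path d a x -> A2 x -> exists n c, In c (L2 cs n) /\ cyl c x).
  { intros cs C x V [Ax Ex]. destruct (C x V Ax) as [n Hn].
    destruct (ext_cover N _ x V Hn) as [b [Hb [Cb Lb]]]. exists n, b. split; auto.
    apply filter_In. split; auto. unfold dec. destruct (excluded_middle_informative (cE b)) as [F|]; auto.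
    exfalso. apply Ex. destruct F as [y [Vy [Cy Ey]]]. apply (HE y x Vy V); auto.
    intros i Hi. rewrite Cy, Cb; auto; lia. }
  (* -m is the infimum of the bounds for the part of A in E and serves as r1. *)
  destruct (completeness (fun m => OM A1 (- m))) as [m [UB LUB]].
  { exists 0. intros m Hm. apply OM_ge0 in Hm. lra. }
  { exists (- r). rewrite Ropp_involutive. eapply OM_mono; [|apply Rle_refl|exact HA].
    unfold A1. tauto. }
  assert (Low : forall rho, OM A1 rho -> - m <= rho).
  { intros rho H. assert (- rho <= m); [|lra]. apply UB. rewrite Ropp_involutive. auto. }
  assert (Inf : OM A1 (- m)).
  { intros eps He. destruct (classic (exists m', OM A1 (- m') /\ m - eps / 2 < m')) as [[m' [H1 H2]]|N1].
    - destruct (H1 (eps / 2) ltac:(lra)) as [cs [C S]]. exists cs. split; auto.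
      intros M. specialize (S M). lra.
    - exfalso. assert (m <= m - eps / 2); [|lra]. apply LUB. intros m' Hm'.
      apply Rnot_lt_le. intros L. apply N1. exists m'. auto. }
  exists (- m), (r + m). split; [lra|]. split; auto.
  intros eps He. destruct (HA (eps / 2) ltac:(lra)) as [cs [C S]].
  (* Were the part [L2] of the cover heavier than this, the part [L1] would cover A1 below the
     infimum. *)
  assert (B2 : OM A2 (r + m + eps / 2)).
  { apply OM_rows with (L := L2 cs); [apply C2; auto|]. intros M0. apply Rnot_lt_le. intros L.
    set (s0 := sum_f_R0 (fun n => lw (L2 cs n)) M0) in *.
    assert (O1 : OM A1 (r + eps / 2 - s0)).
    { apply OM_rows with (L := L1 cs); [apply C1; auto|]. intros M.
      assert (S' := S (Nat.max M M0)). rewrite <- S12 in S'.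
      assert (X1 := sum_f_R0_mono (fun n => lw (L1 cs n)) M (Nat.max M M0) (fun n => lw_ge0 _) ltac:(lia)).
      assert (X2 := sum_f_R0_mono (fun n => lw (L2 cs n)) M0 (Nat.max M M0) (fun n => lw_ge0 _) ltac:(lia)).
      unfold s0. lra. }
    apply Low in O1. lra. }
  destruct (B2 (eps / 2) ltac:(lra)) as [cs' [C' S']]. exists cs'. split; auto.
  intros M. specialize (S' M). lra.
Qed.
End Measure.

Lemma Rabs_le_inv x b : Rabs x <= b -> - b <= x <= b.
Proof. intros H. assert (H1 := Rle_abs x). assert (H2 := Rle_abs (- x)). rewrite Rabs_Ropp in H2. lra. Qed.

(** * Selecting infinite sets of indices *)

Definition infinite (I : nat -> Prop) : Prop := forall m, exists n, (m <= n)%nat /\ I n.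

(** Pigeonhole on K cells of length eps: either the top cell is visited infinitely often, or all
    indices from some m0 on avoid it. *)
Lemma infinite_cluster_cells (v : nat -> R) eps lo K (I : nat -> Prop) : 0 < eps -> infinite I ->
  (forall i, I i -> lo <= v i <= lo + INR K * eps) ->
  exists J, infinite J /\ (forall i, J i -> I i) /\ forall i j, J i -> J j -> Rabs (v i - v j) <= eps.
Proof.
  intros He. revert I. induction K as [|K IH]; intros I HI Hv.
  - exists I. repeat split; auto. intros i j Hi Hj. apply Hv in Hi. apply Hv in Hj.
    simpl in *. apply Rabs_le. lra.
  - rewrite S_INR in Hv.
    destruct (classic (infinite (fun i => I i /\ lo + INR K * eps <= v i))) as [H|H].
    + exists (fun i => I i /\ lo + INR K * eps <= v i). repeat split; auto; [tauto|].
      intros i j [Hi Hi'] [Hj Hj']. apply Hv in Hi. apply Hv in Hj. apply Rabs_le. lra.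
    + apply not_all_ex_not in H. destruct H as [m0 H].
      destruct (IH (fun i => I i /\ (m0 <= i)%nat)) as [J [J1 [J2 J3]]].
      * intros m. destruct (HI (Nat.max m m0)) as [n [Hn In]]. exists n. split; [lia|]. split; auto. lia.
      * intros i [Hi Hm]. split; [apply Hv; auto|]. apply Rlt_le, Rnot_le_lt. intros L.
        apply H. exists i. auto.
      * exists J. split; auto. split; [intros i Hi; apply J2; auto|auto].
Qed.

Lemma infinite_cluster (v : nat -> R) eps (I : nat -> Prop) : 0 < eps -> infinite I ->
  (forall i, -1 <= v i <= 1) ->
  exists J, infinite J /\ (forall i, J i -> I i) /\ forall i j, J i -> J j -> Rabs (v i - v j) <= eps.
Proof.
  intros He HI Hv. destruct (INR_unbounded (2 / eps)) as [K HK].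
  apply (infinite_cluster_cells v eps (-1) K I He HI). intros i _. split; [apply Hv|].
  apply Rdiv_lt_iff in HK; auto. specialize (Hv i). lra.
Qed.

(** * Arzela-Ascoli on the unit interval *)

Section Ascoli.
Variable phi : nat -> R -> R.
Hypothesis bounded : forall i s, 0 <= s <= 1 -> -1 <= phi i s <= 1.
Hypothesis equicont : forall eps, 0 < eps -> exists delta i0, 0 < delta /\
  forall i s s', (i0 <= i)%nat -> 0 <= s <= 1 -> 0 <= s' <= 1 -> Rabs (s - s') <= delta ->
  Rabs (phi i s - phi i s') <= eps.

(** Thin out at the points p / K of a grid finer than delta, one after the other; equicontinuity
    controls the points in between. *)
Lemma uniform_cluster eps (I : nat -> Prop) : 0 < eps -> infinite I ->
  exists J, infinite J /\ (forall i, J i -> I i) /\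
  forall i j s, 0 <= s <= 1 -> J i -> J j -> Rabs (phi i s - phi j s) <= eps.
Proof.
  intros He HI. destruct (equicont (eps / 3) ltac:(lra)) as [delta [i0 [Hd Hc]]].
  destruct (INR_unbounded (1 / delta)) as [K HK].
  assert (K0 : 0 < INR K).
  { eapply Rlt_trans; [|exact HK]. apply Rdiv_lt_0_compat; lra. }
  assert (G : forall p, (p <= K)%nat -> 0 <= INR p / INR K <= 1).
  { intros p Hp. assert (0 <= INR p) by apply pos_INR. assert (INR p <= INR K) by (apply le_INR; auto).
    split; [apply Rmult_le_pos; auto; left; apply Rinv_0_lt_compat; auto|].
    apply Rdiv_le_iff; lra. }
  assert (P : forall m, (m <= S K)%nat -> exists J, infinite J /\ (forall i, J i -> I i /\ (i0 <= i)%nat) /\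
    forall p i j, (p < m)%nat -> J i -> J j ->
      Rabs (phi i (INR p / INR K) - phi j (INR p / INR K)) <= eps / 3).
  { induction m as [|m IH]; intros Hm.
    - exists (fun i => I i /\ (i0 <= i)%nat). split; [|split; [auto|intros; lia]].
      intros m. destruct (HI (Nat.max m i0)) as [n [Hn In]]. exists n. split; [lia|]. split; auto. lia.
    - destruct IH as [J [J1 [J2 J3]]]; [lia|].
      destruct (infinite_cluster (fun i => phi i (INR m / INR K)) (eps / 3) J) as [J' [J1' [J2' J3']]];
        auto; [lra| |].
      + intros i. apply bounded. apply G. lia.
      + exists J'. split; auto. split; [intros i Hi; apply J2; auto|].
        intros p i j Hp Hi Hj. destruct (Nat.eq_dec p m) as [->|]; [apply J3'; auto|].
        apply J3; auto. lia. }
  destruct (P (S K) (le_n _)) as [J [J1 [J2 J3]]]. exists J. split; auto. split; [intros i Hi; apply J2; auto|].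
  intros i j s Hs Hi Hj.
  destruct (archimed (s * INR K)) as [A1 A2]. set (z := up (s * INR K)) in *.
  assert (z0 : (0 < z)%Z). { apply lt_IZR. assert (0 <= s * INR K) by (apply Rmult_le_pos; lra). lra. }
  set (p := Z.to_nat (z - 1)).
  assert (Ep : INR p = IZR z - 1).
  { unfold p. rewrite INR_IZR_INZ, Z2Nat.id, minus_IZR; [auto|lia]. }
  assert (Hp : (p <= K)%nat).
  { apply INR_le. rewrite Ep. assert (s * INR K <= 1 * INR K) by (apply Rmult_le_compat_r; lra). lra. }
  assert (D : Rabs (s - INR p / INR K) <= delta).
  { assert (E : s - INR p / INR K = (s * INR K - INR p) / INR K) by (field; lra).
    rewrite E, Rabs_div_pos; auto. apply Rdiv_le_iff; auto. apply Rdiv_lt_iff in HK; auto.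
    assert (H1 : Rabs (s * INR K - INR p) <= 1) by (apply Rabs_le; lra). lra. }
  assert (Q1 := Hc i s (INR p / INR K) (proj2 (J2 i Hi)) Hs (G p Hp) D).
  assert (Q2 := Hc j s (INR p / INR K) (proj2 (J2 j Hj)) Hs (G p Hp) D).
  assert (Q3 := J3 p i j ltac:(lia) Hi Hj).
  apply Rabs_le_inv in Q1, Q2, Q3. apply Rabs_le. lra.
Qed.

Lemma nested_clusters : exists Is : nat -> nat -> Prop, (forall m, infinite (Is m)) /\
  (forall m i, Is (S m) i -> Is m i) /\
  forall m i j s, 0 <= s <= 1 -> Is (S m) i -> Is (S m) j -> Rabs (phi i s - phi j s) <= (/ 2) ^ m.
Proof.
  (* Infinitude is carried in a sigma type so that the choice function can be iterated. *)
  assert (St : forall m (I : {I | infinite I}), exists J : {J | infinite J},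
    (forall i, proj1_sig J i -> proj1_sig I i) /\
    forall i j s, 0 <= s <= 1 -> proj1_sig J i -> proj1_sig J j -> Rabs (phi i s - phi j s) <= (/ 2) ^ m).
  { intros m [I HI]. destruct (uniform_cluster ((/ 2) ^ m) I) as [J [J1 [J2 J3]]]; auto.
    - apply pow_lt. lra.
    - exists (exist _ J J1). auto. }
  assert (Ch : exists f : nat -> {I | infinite I} -> {I | infinite I}, forall m I,
    (forall i, proj1_sig (f m I) i -> proj1_sig I i) /\
    forall i j s, 0 <= s <= 1 -> proj1_sig (f m I) i -> proj1_sig (f m I) j ->
      Rabs (phi i s - phi j s) <= (/ 2) ^ m).
  { assert (Q : forall mI : nat * {I | infinite I}, exists J : {J | infinite J},
      (forall i, proj1_sig J i -> proj1_sig (snd mI) i) /\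
      forall i j s, 0 <= s <= 1 -> proj1_sig J i -> proj1_sig J j -> Rabs (phi i s - phi j s) <= (/ 2) ^ (fst mI)).
    { intros [m I]. apply St. }
    apply choice in Q. destruct Q as [f Hf]. exists (fun m I => f (m, I)). intros m I. apply (Hf (m, I)). }
  destruct Ch as [f Hf].
  assert (I0 : infinite (fun _ => True)) by (intros m; exists m; auto).
  set (Is := fix Is m := match m with O => exist _ _ I0 | S m' => f m' (Is m') end).
  exists (fun m => proj1_sig (Is m)). split; [intros m; apply (proj2_sig (Is m))|].
  split; intros m; apply (Hf m (Is m)).
Qed.

(** Diagonal choice: the m-th index is taken from the m-th of the nested sets, which makes the
    sequence uniformly Cauchy. *)
Theorem ascoli : exists (sigma : nat -> nat) (f : R -> R), (forall m, (m <= sigma m)%nat) /\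
  (forall s, 0 <= s <= 1 -> forall eps, 0 < eps -> exists delta, 0 < delta /\
        forall s', 0 <= s' <= 1 -> Rabs (s' - s) < delta -> Rabs (f s' - f s) < eps) /\
  (forall eps, 0 < eps -> exists N0, forall n, (N0 <= n)%nat ->
        forall s, 0 <= s <= 1 -> Rabs (phi (sigma n) s - f s) < eps).
Proof.
  destruct nested_clusters as [Is [I1 [I2 I3]]].
  assert (Sg : forall m, exists n, (m <= n)%nat /\ Is m n) by (intros m; apply I1).
  apply choice in Sg. destruct Sg as [sigma Hs].
  assert (Sub : forall m k i, Is (m + k)%nat i -> Is m i).
  { intros m k. induction k as [|k IH]; intros i; [rewrite Nat.add_0_r; auto|].
    rewrite <- plus_n_Sm. intros H. apply IH, I2. auto. }
  assert (Cau : forall m n n' s, 0 <= s <= 1 -> (S m <= n)%nat -> (S m <= n')%nat ->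
    Rabs (phi (sigma n) s - phi (sigma n') s) <= (/ 2) ^ m).
  { intros m n n' s H Hn Hn'. apply I3; auto.
    - apply (Sub (S m) (n - S m)%nat). replace (S m + (n - S m))%nat with n by lia. apply Hs.
    - apply (Sub (S m) (n' - S m)%nat). replace (S m + (n' - S m))%nat with n' by lia. apply Hs. }
  assert (half : forall eps, 0 < eps -> exists m, (/ 2) ^ m < eps).
  { intros eps He. destruct (pow_lt_1_zero (/ 2) ltac:(rewrite Rabs_right; lra) eps He) as [m Hm].
    exists m. specialize (Hm m (le_n _)). rewrite Rabs_right in Hm; auto. apply Rle_ge, pow_le. lra. }
  assert (Lim : forall s, exists y, 0 <= s <= 1 ->
    forall m n, (S m <= n)%nat -> Rabs (phi (sigma n) s - y) <= (/ 2) ^ m).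
  { intros s. destruct (classic (0 <= s <= 1)) as [H|]; [|exists 0; tauto].
    destruct (R_complete (fun n => phi (sigma n) s)) as [y Hy].
    - intros eps He. destruct (half eps He) as [m Hm]. exists (S m). intros n n' Hn Hn'.
      unfold Rdist. eapply Rle_lt_trans; [apply (Cau m)|]; auto.
    - exists y. intros _ m n Hn. apply Rnot_lt_le. intros L.
      destruct (Hy (Rabs (phi (sigma n) s - y) - (/ 2) ^ m) ltac:(lra)) as [N HN].
      specialize (HN (Nat.max N (S m)) ltac:(lia)). unfold Rdist in HN.
      assert (C := Cau m n (Nat.max N (S m)) s H Hn ltac:(lia)).
      set (u := phi (sigma (Nat.max N (S m))) s) in *.
      assert (T := Rabs_triang (phi (sigma n) s - u) (u - y)).
      replace (phi (sigma n) s - u + (u - y)) with (phi (sigma n) s - y) in T by lra. lra. }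
  apply choice in Lim. destruct Lim as [f Hf].
  exists sigma, f. split; [intros m; apply Hs|]. split.
  - intros s H eps He. destruct (half (eps / 3) ltac:(lra)) as [m Hm].
    destruct (equicont (eps / 3) ltac:(lra)) as [delta [i0 [Hd Hc]]].
    exists delta. split; auto. intros s' H' D. set (n := Nat.max (S m) i0).
    assert (Q1 := Hf s H m n ltac:(unfold n; lia)). assert (Q2 := Hf s' H' m n ltac:(unfold n; lia)).
    assert (i0 <= sigma n)%nat by (destruct (Hs n); unfold n in *; lia).
    assert (Q3 := Hc (sigma n) s' s H0 H' H ltac:(lra)).
    apply Rabs_le_inv in Q1, Q2, Q3. apply Rabs_def1; lra.
  - intros eps He. destruct (half eps He) as [m Hm]. exists (S m). intros n Hn s H.
    eapply Rle_lt_trans; [apply (Hf s H m n Hn)|auto].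
Qed.
End Ascoli.

(** * Deviations at integer times *)

Section Interpolation.
Variables (T : path -> path) (g : path -> R) (x : path).
Notation Sm := (Ssum T g x).

(** The deviation at the time j / l, by [dev_node]; it is linear in between, so only these values
    matter. *)
Definition node (l j : nat) : R := Sm j - INR j / INR l * Sm l.

Lemma floor_nat s : 0 <= s -> let n := Z.to_nat (Int_part s) in INR n <= s < INR n + 1.
Proof.
  intros H n. destruct (base_Int_part s) as [A1 A2].
  assert (Z : (0 <= Int_part s)%Z).
  { apply Z.lt_succ_r, lt_IZR. rewrite succ_IZR. lra. }
  unfold n. rewrite INR_IZR_INZ, Z2Nat.id; auto. lra.
Qed.

Lemma Fg_INR l : Fg T g x (INR l) = Sm l.
Proof.
  unfold Fg. assert (F := floor_nat (INR l) (pos_INR l)). simpl in F.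
  set (n := Z.to_nat (Int_part (INR l))) in *.
  assert (n = l).
  { destruct F as [F1 F2]. apply INR_le in F1. rewrite <- S_INR in F2. apply INR_lt in F2. lia. }
  rewrite H. lra.
Qed.

Lemma dev_interpolates l s : (0 < l)%nat -> 0 <= s <= 1 -> exists n th,
  (n <= l)%nat /\ 0 <= th < 1 /\ ((S n <= l)%nat \/ th = 0) /\ s * INR l = INR n + th /\
  dev T g x l s = (1 - th) * node l n + th * node l (S n).
Proof.
  intros Hl Hs. assert (L : 0 < INR l) by (apply lt_0_INR; auto).
  assert (P : 0 <= s * INR l) by (apply Rmult_le_pos; lra).
  assert (F := floor_nat _ P). simpl in F. set (n := Z.to_nat (Int_part (s * INR l))) in *.
  assert (U : s * INR l <= INR l) by nra.
  exists n, (s * INR l - INR n).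
  assert (nl : (n <= l)%nat) by (apply INR_le; lra).
  split; auto. split; [lra|]. split.
  (* At s = 1 the node l + 1 is out of range, but its weight [th] is 0. *)
  - destruct (Nat.eq_dec n l) as [->|]; [right|left; lia]. lra.
  - split; [lra|]. unfold dev. rewrite Fg_INR. unfold Fg. fold n. unfold node.
    cbn [Ssum]. rewrite S_INR.
    assert (E : s = (s * INR l) / INR l) by (field; lra).
    rewrite E at 2. field. lra.
Qed.

Lemma dev_node l j : (0 < l)%nat -> (j <= l)%nat -> dev T g x l (INR j / INR l) = node l j.
Proof.
  intros Hl Hj. assert (L : 0 < INR l) by (apply lt_0_INR; auto). unfold dev, node.
  replace (INR j / INR l * INR l) with (INR j) by (field; lra). rewrite !Fg_INR. auto.
Qed.

Lemma ratio_unit j l : (0 < l)%nat -> (j <= l)%nat -> 0 <= INR j / INR l <= 1.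
Proof.
  intros Hl Hj. assert (L : 0 < INR l) by (apply lt_0_INR; auto).
  assert (INR j <= INR l) by (apply le_INR; auto). assert (0 <= INR j) by apply pos_INR.
  split; [apply Rmult_le_pos; auto; left; apply Rinv_0_lt_compat; auto|].
  apply Rdiv_le_iff; lra.
Qed.

Lemma dev_le_of_node l b : (0 < l)%nat -> (forall j, (j <= l)%nat -> Rabs (node l j) <= b) ->
  forall s, 0 <= s <= 1 -> Rabs (dev T g x l s) <= b.
Proof.
  intros Hl H s Hs. destruct (dev_interpolates l s Hl Hs) as [n [th [A1 [A2 [A3 [_ ->]]]]]].
  assert (Q1 := H n A1). apply Rabs_le_inv in Q1. apply Rabs_le. destruct A3 as [A3| ->]; [|lra].
  assert (Q2 := H (S n) A3). apply Rabs_le_inv in Q2. nra.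
Qed.

Lemma argmax_nat (u : nat -> R) l : exists j, (j <= l)%nat /\ forall j', (j' <= l)%nat -> u j' <= u j.
Proof.
  induction l as [|l [j [H1 H2]]].
  - exists O. split; auto. intros j' H. replace j' with O by lia. lra.
  - destruct (Rle_or_lt (u (S l)) (u j)).
    + exists j. split; auto. intros j' Hj'. destruct (Nat.eq_dec j' (S l)) as [->|]; auto. apply H2. lia.
    + exists (S l). split; auto. intros j' Hj'. destruct (Nat.eq_dec j' (S l)) as [->|]; [lra|].
      specialize (H2 j' ltac:(lia)). lra.
Qed.

Lemma is_R_exists l : (0 < l)%nat -> exists j, (j <= l)%nat /\ is_R T g x l (Rabs (node l j)).
Proof.
  intros Hl. destruct (argmax_nat (fun j => Rabs (node l j)) l) as [j [H1 H2]].
  exists j. split; auto. split.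
  - apply dev_le_of_node; auto.
  - exists (INR j / INR l). split; [apply ratio_unit; auto|]. rewrite dev_node; auto.
Qed.

Lemma is_R_node_le l r j : (0 < l)%nat -> is_R T g x l r -> (j <= l)%nat -> Rabs (node l j) <= r.
Proof.
  intros Hl [H _] Hj. rewrite <- dev_node; auto. apply H. apply ratio_unit; auto.
Qed.

(** D i stands in for the normalizing R, which is known only as a maximum: R >= D i / 2 and a
    modulus of continuity relative to D i at integer times suffice. *)
Theorem limit_curve_of_equicontinuous (l : nat -> nat) (D : nat -> R) :
  (forall i, (0 < l i)%nat) ->
  (forall M, exists N0, forall n, (N0 <= n)%nat -> (M <= l n)%nat) ->
  (forall i, 0 < D i) ->
  (forall i, exists j, (j <= l i)%nat /\ D i <= 2 * Rabs (node (l i) j)) ->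
  (forall eps, 0 < eps -> exists delta i0, 0 < delta /\ forall i j j', (i0 <= i)%nat ->
     (j <= j')%nat -> (j' <= l i)%nat -> INR (j' - j) <= delta * INR (l i) ->
     Rabs (node (l i) j' - node (l i) j) <= eps * D i) ->
  limit_curve_exists T g x.
Proof.
  intros l0 linf D0 DR EC.
  assert (RR : forall i, exists r, is_R T g x (l i) r /\ D i <= 2 * r).
  { intros i. destruct (is_R_exists (l i) (l0 i)) as [j [Hj HR]]. exists (Rabs (node (l i) j)).
    split; auto. destruct (DR i) as [j' [Hj' HD]].
    assert (Q := is_R_node_le _ _ _ (l0 i) HR Hj'). lra. }
  apply choice in RR. destruct RR as [r Hr].
  assert (r0 : forall i, 0 < r i) by (intros i; destruct (Hr i); specialize (D0 i); lra).
  assert (EQ : forall eps, 0 < eps -> exists delta i0, 0 < delta /\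
    forall i s s', (i0 <= i)%nat -> 0 <= s <= 1 -> 0 <= s' <= 1 -> Rabs (s - s') <= delta ->
    Rabs (phi T g x (l i) (r i) s - phi T g x (l i) (r i) s') <= eps).
  { intros eps He. destruct (EC (eps / 6) ltac:(lra)) as [delta [i1 [Hd Hc]]].
    (* Rounding to integer times lengthens the increment by at most 1, for which delta l / 2 >= 1
       leaves room. *)
    destruct (INR_unbounded (2 / delta)) as [M HM]. destruct (linf M) as [i2 Hi2].
    exists (delta / 2), (Nat.max i1 i2). split; [lra|].
    assert (W : forall i s s', (Nat.max i1 i2 <= i)%nat -> 0 <= s <= 1 -> 0 <= s' <= 1 ->
      s <= s' -> s' - s <= delta / 2 ->
      Rabs (phi T g x (l i) (r i) s - phi T g x (l i) (r i) s') <= eps).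
    { intros i s s' Hi Hs Hs' Le Hd'.
      assert (L : 0 < INR (l i)) by (apply lt_0_INR; auto).
      assert (B : 2 <= delta * INR (l i)).
      { assert (INR M <= INR (l i)) by (apply le_INR, Hi2; lia).
        apply Rdiv_lt_iff in HM; auto. nra. }
      destruct (dev_interpolates (l i) s (l0 i) Hs) as [n [th [A1 [A2 [A3 [A4 A5]]]]]].
      destruct (dev_interpolates (l i) s' (l0 i) Hs') as [n' [th' [B1 [B2 [B3 [B4 B5]]]]]].
      assert (nn : (n <= n')%nat).
      { apply Nat.lt_succ_r, INR_lt. rewrite S_INR. nra. }
      assert (C1 : Rabs (node (l i) n' - node (l i) n) <= eps / 6 * D i).
      { apply Hc; auto; [lia|]. rewrite minus_INR; auto. nra. }
      assert (C2 : forall n th, 0 <= th < 1 -> ((S n <= l i)%nat \/ th = 0) ->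
        Rabs ((1 - th) * node (l i) n + th * node (l i) (S n) - node (l i) n) <= eps / 6 * D i).
      { intros m c Hc' [Hm| ->].
        - replace ((1 - c) * node (l i) m + c * node (l i) (S m) - node (l i) m)
            with (c * (node (l i) (S m) - node (l i) m)) by ring.
          rewrite Rabs_mult, (Rabs_right c); [|lra].
          assert (Q : Rabs (node (l i) (S m) - node (l i) m) <= eps / 6 * D i).
          { apply Hc; auto; [lia|]. replace (S m - m)%nat with 1%nat by lia. simpl. lra. }
          assert (0 <= Rabs (node (l i) (S m) - node (l i) m)) by apply Rabs_pos. nra.
        - replace ((1 - 0) * node (l i) m + 0 * node (l i) (S m) - node (l i) m) with 0 by ring.
          rewrite Rabs_R0. specialize (D0 i). nra. }
      assert (C3 := C2 n th A2 A3). assert (C4 := C2 n' th' B2 B3).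
      rewrite <- A5 in C3. rewrite <- B5 in C4.
      assert (C5 : Rabs (dev T g x (l i) s - dev T g x (l i) s') <= eps / 2 * D i).
      { apply Rabs_le_inv in C1, C3, C4. apply Rabs_le. lra. }
      unfold phi. replace (dev T g x (l i) s / r i - dev T g x (l i) s' / r i) with
        ((dev T g x (l i) s - dev T g x (l i) s') / r i) by (field; specialize (r0 i); lra).
      rewrite Rabs_div_pos; auto. apply Rdiv_le_iff; auto.
      destruct (Hr i) as [_ Hr2]. nra. }
    intros i s s' Hi Hs Hs' Hd'. apply Rabs_le_inv in Hd'.
    destruct (Rle_or_lt s s').
    - apply W; auto; lra.
    - rewrite Rabs_minus_sym. apply W; auto; lra. }
  destruct (ascoli (fun i => phi T g x (l i) (r i))) as [sigma [f [S1 [S2 S3]]]]; auto.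
  { intros i s Hs. apply Rabs_le_inv. unfold phi.
    rewrite Rabs_div_pos; auto. apply Rdiv_le_iff; auto.
    destruct (Hr i) as [[Hb _] _]. specialize (Hb s Hs). lra. }
  exists (fun n => l (sigma n)), (fun n => r (sigma n)), f.
  split; [auto|]. split.
  - intros M. destruct (linf M) as [N0 H]. exists N0. intros n Hn. apply H.
    eapply Nat.le_trans; [exact Hn|apply S1].
  - split; [intros n; split; [apply Hr|auto]|]. split; auto.
Qed.
End Interpolation.

(** R is at most 2 B. For fixed j the times j / l_n tend to 0, where f vanishes, so the deviation at
    j tends to 0; but its limit is S_j - c j. Hence all of these are 0 and R = 0. *)
Lemma bounded_no_limit_curve (T : path -> path) (g : path -> R) (x : path) c B :
  (forall j, Rabs (Ssum T g x j - c * INR j) <= B) -> ~ limit_curve_exists T g x.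
Proof.
  intros HB [l [Rs [f [l0 [linf [HR [Hf Hu]]]]]]].
  assert (B0 : 0 <= B).
  { eapply Rle_trans; [apply Rabs_pos|apply (HB O)]. }
  assert (NB : forall l j, (0 < l)%nat -> (j <= l)%nat -> Rabs (node T g x l j) <= 2 * B).
  { intros m j Hm Hj. assert (M : 0 < INR m) by (apply lt_0_INR; auto).
    assert (E : node T g x m j = (Ssum T g x j - c * INR j) - INR j / INR m * (Ssum T g x m - c * INR m)).
    { unfold node. field. lra. }
    rewrite E. assert (U := ratio_unit j m Hm Hj). assert (H1 := HB j). assert (H2 := HB m).
    apply Rabs_le_inv in H1, H2. apply Rabs_le. set (u := INR j / INR m) in *. nra. }
  assert (RB : forall n, Rs n <= 2 * B).
  { intros n. destruct (HR n) as [[_ [s [Hs Es]]] _]. rewrite <- Es.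
    apply dev_le_of_node; auto. }
  assert (phi0 : forall n, phi T g x (l n) (Rs n) 0 = 0).
  { intros n. unfold phi.
    assert (E : dev T g x (l n) 0 = node T g x (l n) 0).
    { rewrite <- (dev_node T g x (l n) 0 (l0 n)); [|lia]. f_equal. simpl. unfold Rdiv. ring. }
    rewrite E. unfold node. simpl. unfold Rdiv. ring. }
  assert (f0 : f 0 = 0).
  { apply cond_eq. intros eps He. destruct (Hu eps He) as [N0 HN].
    specialize (HN N0 (le_n _) 0 ltac:(lra)). rewrite phi0, Rabs_minus_sym in HN. auto. }
  assert (Z : forall j, Ssum T g x j = c * INR j).
  { intros j. apply cond_eq. intros eps He.
    (* The node contributes at most 4 B e and the linear correction at most B e. *)
    set (e := eps / (5 * B + 2)). assert (e0 : 0 < e) by (apply Rdiv_lt_0_compat; lra).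
    assert (Ee : e * (5 * B + 2) = eps) by (unfold e; field; lra).
    destruct (Hf 0 ltac:(lra) e e0) as [delta [Hd Hc]]. destruct (Hu e e0) as [N0 HN].
    destruct (INR_unbounded (INR j / delta)) as [M1 HM1].
    destruct (INR_unbounded (INR j / e)) as [M2 HM2].
    destruct (linf (S (j + M1 + M2))) as [N1 HN1].
    set (n := Nat.max N0 N1). assert (Hn0 : (N0 <= n)%nat) by (unfold n; lia).
    assert (Hl : (S (j + M1 + M2) <= l n)%nat) by (apply HN1; unfold n; lia).
    assert (Hl' : INR M1 + INR M2 <= INR (l n)).
    { rewrite <- plus_INR. apply le_INR. lia. }
    assert (L : 0 < INR (l n)) by (apply lt_0_INR; auto).
    assert (P1 := pos_INR M1). assert (P2 := pos_INR M2).
    assert (U := ratio_unit j (l n) (l0 n) ltac:(lia)).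
    assert (V1 : INR j / INR (l n) < delta).
    { apply Rdiv_lt_iff; auto. apply Rdiv_lt_iff in HM1; auto. nra. }
    assert (V2 : INR j / INR (l n) < e).
    { apply Rdiv_lt_iff; auto. apply Rdiv_lt_iff in HM2; auto. nra. }
    set (u := INR j / INR (l n)) in *.
    specialize (Hc u U). rewrite f0, !Rminus_0_r in Hc.
    specialize (Hc ltac:(rewrite Rabs_right; lra)).
    specialize (HN n Hn0 u U). destruct (HR n) as [_ R0].
    assert (PB : Rabs (phi T g x (l n) (Rs n) u) < 2 * e).
    { apply Rabs_def2 in Hc, HN. apply Rabs_def1; lra. }
    unfold phi in PB. unfold u in PB at 1. rewrite dev_node in PB; auto; [|lia].
    assert (NBj : Rabs (node T g x (l n) j) <= 2 * e * (2 * B)).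
    { rewrite Rabs_div_pos in PB; auto. apply (proj1 (Rdiv_lt_iff _ _ _ R0)) in PB. specialize (RB n). nra. }
    assert (E : Ssum T g x j - c * INR j = node T g x (l n) j + u * (Ssum T g x (l n) - c * INR (l n))).
    { unfold node, u. field. lra. }
    rewrite E. assert (H2 := HB (l n)).
    assert (X : Rabs (u * (Ssum T g x (l n) - c * INR (l n))) <= e * B).
    { rewrite Rabs_mult, (Rabs_right u); [|lra].
      assert (0 <= Rabs (Ssum T g x (l n) - c * INR (l n))) by apply Rabs_pos. nra. }
    eapply Rle_lt_trans; [apply Rabs_triang|]. nra. }
  destruct (HR O) as [[_ [s [Hs Es]]] R0].
  assert (Rs O <= 0); [|lra]. rewrite <- Es. apply dev_le_of_node; auto. intros j _. unfold node. rewrite !Z.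
  assert (L : 0 < INR (l O)) by (apply lt_0_INR; auto).
  replace (c * INR j - INR j / INR (l O) * (c * INR (l O))) with 0 by (field; lra). rewrite Rabs_R0. lra.
Qed.

(** * Existence and absence of limiting curves *)

Section Main.
Variables (d : nat) (a : nat -> nat) (q t : R) (g : path -> R) (N : nat).
Hypothesis d1 : (1 <= d)%nat.
Hypothesis a1 : forall j, (j <= d)%nat -> (0 < a j)%nat.
Hypothesis q0 : 0 < q.
Hypothesis qa : q < / INR (a O).
Hypothesis t01 : 0 < t < 1.
Hypothesis qt : sum_f_R0 (fun j => INR (a j) * q ^ (d - j) * t ^ j) d = q ^ (d - 1).
Hypothesis cylg : cylindric d a g N.
Notation ae := (ae d a q t).
Notation T := (Tp d a).

(** The bound on h and the coboundary equation are needed along the whole orbit, hence [ae_orbit];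
    the sums then telescope. *)
Lemma no_limit_curve : cohom_const d a q t g -> ae (fun x => ~ limit_curve_exists T g x).
Proof.
  intros [c [h [[_ [B HB]] Hc]]].
  assert (H := ae_orbit d a q t d1 a1 q0 qa t01 qt _ (ae_and d a q t d1 a1 q0 qa t01 _ _ HB Hc)).
  eapply ae_impl; [|exact H]. clear H HB Hc. intros x _ P. cbn beta in P.
  apply (bounded_no_limit_curve T g x c (2 * B)). intros j.
  assert (E : Ssum T g x j = c * INR j + h (Nat.iter j T x) - h x).
  { induction j as [|j IH]; [simpl; lra|]. cbn [Ssum]. rewrite IH, S_INR.
    destruct (P j) as [_ Q]. rewrite Q. simpl. lra. }
  rewrite E. destruct (P j) as [Q1 _]. destruct (P O) as [Q2 _]. simpl in Q2.
  apply Rabs_le_inv in Q1, Q2. apply Rabs_le. lra.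
Qed.

Definition gam (c : R) (u : list edge) : R := gval g u - c.

(* The partial sum of g - c over the words before v in its tower, for words v of
   length N (arbitrary for other words). *)
Definition transfer (c : R) (v : list edge) : R :=
  epsilon (inhabits 0) (fun r => exists l1 l2, tw d a N (wsum v) = l1 ++ v :: l2 /\ r = lsum (map (gam c) l1)).

(** The property that survives concatenation: as every block sums to zero, the partial sum before a
    word depends only on its first N edges. *)
Definition balanced (c : R) (L : list (list edge)) : Prop :=
  lsum (map (gam c) L) = 0 /\
  forall l1 u l2, L = l1 ++ u :: l2 -> transfer c (firstn N u) = lsum (map (gam c) l1).

Lemma NoDup_pivot {A} (v : A) l1 l2 l1' l2' :
  NoDup (l1 ++ v :: l2) -> l1 ++ v :: l2 = l1' ++ v :: l2' -> l1 = l1'.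
Proof.
  revert l1'. induction l1 as [|x l1 IH]; intros [|y l1'] ND E; simpl in *; auto.
  - exfalso. injection E as -> E. inversion ND; subst. apply H1. apply in_app_iff. simpl; auto.
  - exfalso. injection E as -> E. inversion ND; subst. apply H1. apply in_app_iff. simpl; auto.
  - injection E as -> E. f_equal. apply IH; auto. inversion ND; auto.
Qed.

Lemma balanced_app c L1 L2 : balanced c L1 -> balanced c L2 -> balanced c (L1 ++ L2).
Proof.
  intros [Z1 H1] [Z2 H2]. split; [rewrite map_app, lsum_app; lra|].
  intros l1 u l2 E. apply app_eq_app in E. destruct E as [l [[E1 E2]|[E1 E2]]].
  - destruct l as [|y l].
    + simpl in E2. rewrite app_nil_r in E1. subst L1. rewrite (H2 [] u l2); auto.
    + injection E2 as <- E2. apply (H1 l1 u l). auto.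
  - rewrite E1, map_app, lsum_app, Z1. rewrite (H2 l u l2); auto. lra.
Qed.

Lemma balanced_nil c : balanced c [].
Proof. split; auto. intros [|? ?] ? ? E; discriminate. Qed.

Lemma balanced_snoc c e L : valid_edge d a e ->
  (forall u, In u L -> (N <= length u)%nat /\ Forall (valid_edge d a) u) ->
  balanced c L -> balanced c (map (fun u => u ++ [e]) L).
Proof.
  intros Ve HL [Z H].
  assert (G : forall l, incl l L -> map (gam c) (map (fun u => u ++ [e]) l) = map (gam c) l).
  { intros l I. rewrite map_map. apply map_ext_in. intros u Hu. destruct (HL u (I u Hu)).
    unfold gam. rewrite (gval_app d a g N); auto. }
  split; [rewrite G; auto; apply incl_refl|].
  intros l1 u l2 E. apply map_eq_app in E. destruct E as [k1 [k2 [-> [E1 E2]]]].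
  apply map_eq_cons in E2. destruct E2 as [v [k3 [-> [E2 E3]]]]. subst.
  rewrite G; [|intros y Hy; apply in_app_iff; auto].
  rewrite <- (H k1 v k3 eq_refl). f_equal.
  destruct (HL v) as [Lv _]; [apply in_app_iff; simpl; auto|].
  rewrite firstn_app. replace (N - length v)%nat with O by lia. simpl. apply app_nil_r.
Qed.

Lemma balanced_tw c : (forall k, lsum (gl d a g N k) = c * hA d a N k) ->
  forall n k, (N <= n)%nat -> balanced c (tw d a n k).
Proof.
  intros Hc n k Hn. revert k. induction Hn as [|n Hn IH]; intros k.
  - split.
    + specialize (Hc k). unfold gl, hA in Hc.
      assert (E : forall l, lsum (map (gam c) l) = lsum (map (gval g) l) - c * INR (length l)).
      { induction l as [|u l IHl]; [simpl; lra|].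
        change (lsum (map (gam c) (u :: l))) with (gam c u + lsum (map (gam c) l)).
        change (lsum (map (gval g) (u :: l))) with (gval g u + lsum (map (gval g) l)).
        change (length (u :: l)) with (S (length l)). rewrite IHl, S_INR. unfold gam. lra. }
      rewrite E, Hc. lra.
    + intros l1 u l2 E.
      assert (I : In u (tw d a N k)) by (rewrite E; apply in_app_iff; simpl; auto).
      apply in_tw in I. destruct I as [Lu [Wu _]]. rewrite firstn_all2; [|lia].
      unfold transfer. set (P := fun r => _).
      assert (S : P (epsilon (inhabits 0) P)).
      { apply epsilon_spec. exists (lsum (map (gam c) l1)), l1, l2. rewrite Wu. auto. }
      destruct S as [l1' [l2' [E' ->]]]. f_equal. f_equal. rewrite Wu in E'.
      symmetry. apply (NoDup_pivot u l1 l2 l1' l2'); [rewrite <- E; apply tw_NoDup|congruence].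
  - cbn [tw]. assert (V : forall e, In e (elist d a) -> valid_edge d a e) by (intros e; apply in_elist).
    revert V. generalize (elist d a) as es. induction es as [|e es IHe]; intros V; [apply balanced_nil|].
    cbn [flat_map]. apply balanced_app; [|apply IHe; intros; apply V; simpl; auto].
    destruct (fst e <=? k)%nat; [|apply balanced_nil].
    apply balanced_snoc; auto; [apply V; simpl; auto|].
    intros u Hu. apply in_tw in Hu. destruct Hu as [Lu [_ Vu]]. split; auto. lia.
Qed.

Lemma lsum_ge_in x l : (forall y, In y l -> 0 <= y) -> In x l -> x <= lsum l.
Proof.
  intros H I. apply in_split in I. destruct I as [l1 [l2 ->]]. rewrite lsum_app.
  change (lsum (x :: l2)) with (x + lsum l2).
  assert (0 <= lsum l1) by (apply lsum_ge0; intros; apply H; apply in_app_iff; auto).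
  assert (0 <= lsum l2) by (apply lsum_ge0; intros; apply H; apply in_app_iff; simpl; auto). lra.
Qed.

Lemma allw_bound (f : list edge -> R) :
  exists B, 0 <= B /\ forall c, Forall (valid_edge d a) c -> length c = N -> Rabs (f c) <= B.
Proof.
  exists (lsum (map (fun c => Rabs (f c)) (allw d a N))).
  assert (P : forall y, In y (map (fun c => Rabs (f c)) (allw d a N)) -> 0 <= y).
  { intros y Hy. apply in_map_iff in Hy. destruct Hy as [c [<- _]]. apply Rabs_pos. }
  split; [apply lsum_ge0; auto|]. intros c V L. apply lsum_ge_in; auto.
  apply (in_map (fun c => Rabs (f c))). apply in_allw; auto.
Qed.

Lemma firstn_pre n x : (N <= n)%nat -> firstn N (pre n x) = pre N x.
Proof.
  intros H. replace n with (N + (n - N))%nat by lia. unfold pre.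
  rewrite seq_app, map_app, firstn_app, length_map, length_seq, Nat.sub_diag. simpl.
  rewrite app_nil_r. apply firstn_all2. rewrite length_map, length_seq. lia.
Qed.

Lemma ae_of_valid (P : path -> Prop) : (forall x, valid_path d a x -> P x) -> ae P.
Proof.
  intros H. apply (OM_rows d a q t) with (L := fun _ => []); auto.
  - intros x V NP. exfalso. apply NP. auto.
  - intros M. assert (E : sum_f_R0 (fun _ => lw q t []) M = 0).
    { induction M as [|M IH]; simpl; [reflexivity|]. rewrite IH. unfold lw. simpl. lra. }
    rewrite E. lra.
Qed.

(** Going from one word of a tower to the next adds the value of g - c on the former to the partial
    sum, and by [balanced_tw] these partial sums are read off from the first N edges. *)
Lemma cohom_of_balanced c : (forall k, lsum (gl d a g N k) = c * hA d a N k) -> cohom_const d a q t g.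
Proof.
  intros Hc. exists c, (fun x => transfer c (pre N x)). split; [split|].
  - intros b. apply (cmeas_cylindric d a q t d1 a1 q0 qa t01 qt N). intros x y _ _ E.
    replace (pre N y) with (pre N x); auto. apply map_ext_in. intros i Hi.
    apply in_seq in Hi. apply E. lia.
  - destruct (allw_bound (transfer c)) as [B [_ HB]]. exists B. apply ae_of_valid.
    intros x V. apply HB; [apply Forall_pre; auto|apply pre_length].
  - eapply ae_impl; [|exact (ae_nonmaximal_from d a q t d1 a1 q0 qa t01 qt N)].
    intros x V [n [k [i [Hn Hi]]]]. rewrite (Tp_nonmaximal d a x n k i V Hi). destruct Hi as [Hi Ei].
    destruct (nth_split (tw d a n k) [] (Nat.lt_succ_l _ _ Hi)) as [l1 [l2 [E L1]]].
    destruct l2 as [|v l3].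
    { exfalso. apply (f_equal (@length _)) in E. rewrite length_app in E. simpl in E. lia. }
    assert (Ev : nth (S i) (tw d a n k) [] = v).
    { rewrite E, app_nth2, L1; [|lia]. replace (S i - i)%nat with 1%nat by lia. reflexivity. }
    rewrite Ev. rewrite Ei in E.
    destruct (balanced_tw c Hc n k Hn) as [_ Bal].
    assert (I : In v (tw d a n k)) by (rewrite E; apply in_app_iff; simpl; auto).
    apply in_tw in I. destruct I as [Lv _].
    assert (B1 := Bal _ _ _ E). rewrite firstn_pre in B1; auto.
    assert (B2 := Bal (l1 ++ [pre n x]) v l3 ltac:(rewrite <- app_assoc; exact E)).
    assert (Pv : pre N (sw v x) = firstn N v).
    { rewrite <- (firstn_pre n); auto. rewrite <- Lv at 1. rewrite pre_sw. auto. }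
    rewrite Pv, B1, B2, map_app, lsum_app.
    assert (G : gam c (pre n x) = g x - c).
    { unfold gam. rewrite <- (g_sw d a g N d1 a1 cylg (pre n x) x); auto.
      - rewrite sw_pre. auto.
      - rewrite pre_length. auto.
      - apply Forall_pre; auto. }
    simpl. rewrite G. lra.
Qed.

Lemma lsum_abs_le gm l : (forall y, In y l -> Rabs y <= gm) -> Rabs (lsum l) <= gm * INR (length l).
Proof.
  induction l as [|y l IH]; intros H; [simpl; rewrite Rabs_R0; lra|].
  change (lsum (y :: l)) with (y + lsum l). change (length (y :: l)) with (S (length l)).
  rewrite S_INR. eapply Rle_trans; [apply Rabs_triang|].
  assert (H1 := H y (or_introl eq_refl)). assert (H2 := IH (fun z Hz => H z (or_intror Hz))). lra.
Qed.

Lemma curve_bounded_trivial gm s l : 0 <= gm -> Rabs s <= gm -> (forall y, In y l -> Rabs y <= gm) ->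
  curve_bounded s l (2 * gm * INR (length l)).
Proof.
  intros G Hs H j Hj. unfold curve, psum.
  assert (H1 : Rabs (lsum (firstn j l)) <= gm * INR (length (firstn j l))).
  { apply lsum_abs_le. intros y Hy. apply H. rewrite <- (firstn_skipn j l). apply in_app_iff; auto. }
  rewrite length_firstn, Nat.min_l in H1; auto.
  assert (H2 : Rabs (s * INR j) <= gm * INR j).
  { rewrite Rabs_mult, (Rabs_right (INR j)); [|apply Rle_ge, pos_INR].
    apply Rmult_le_compat_r; auto. apply pos_INR. }
  assert (INR j <= INR (length l)) by (apply le_INR; auto).
  assert (P := pos_INR j). apply Rabs_le_inv in H1, H2. apply Rabs_le. nra.
Qed.

(** A block sum is a difference of two values of the curve; this is the source of the 2 D in
    [decay_statement]. *)
Lemma curve_infix s l1 b l2 D : (forall j, (j <= length (l1 ++ b ++ l2))%nat ->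
  Rabs (curve s (l1 ++ b ++ l2) j) <= D) -> Rabs (lsum b - s * INR (length b)) <= 2 * D.
Proof.
  intros H. assert (L : length (l1 ++ b ++ l2) = (length l1 + length b + length l2)%nat).
  { rewrite !length_app. lia. }
  assert (H1 := H (length l1 + 0)%nat ltac:(lia)).
  assert (H2 := H (length l1 + length b)%nat ltac:(lia)).
  rewrite curve_app2 in H1, H2. rewrite curve_app1 in H2; auto. rewrite curve_0 in H1.
  unfold curve at 2 in H2. rewrite psum_len in H2.
  apply Rabs_le_inv in H1, H2. apply Rabs_le. lra.
Qed.

Lemma conv_lower f k : (d <= k)%nat -> (forall j, 0 <= f j) -> f (k - d)%nat + f k <= conv d a f k.
Proof.
  intros Hk Hf. unfold conv.
  set (F := fun j => if (j <=? k)%nat then INR (a j) * f (k - j)%nat else 0).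
  assert (F0 : forall j, 0 <= F j).
  { intros j. unfold F. destruct (j <=? k)%nat; [|lra]. apply Rmult_le_pos; auto. apply pos_INR. }
  assert (F1 : forall j, (j <= d)%nat -> f (k - j)%nat <= F j).
  { intros j Hj. unfold F. destruct (Nat.leb_spec j k); [|lia].
    assert (A := le_INR 1 (a j) (a1 j Hj)). simpl in A. assert (Z := Hf (k - j)%nat). nra. }
  replace d with (S (d - 1)) at 2 by lia. rewrite tech5. replace (S (d - 1)) with d by lia.
  assert (Q := sum_f_R0_mono F 0 (d - 1) F0 ltac:(lia)). simpl in Q.
  assert (Q1 := F1 O ltac:(lia)). rewrite Nat.sub_0_r in Q1. assert (Q2 := F1 d (le_n _)). lra.
Qed.

Lemma hA_ge0 n k : 0 <= hA d a n k.
Proof. apply pos_INR. Qed.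

Lemma hA_lower n k : (d <= k)%nat -> hA d a n (k - d) + hA d a n k <= hA d a (S n) k.
Proof.
  intros H. destruct (tw_height_array d a) as [_ E]. rewrite E. apply conv_lower; auto.
  intros; apply hA_ge0.
Qed.

Lemma hA_first m n k : (m <= n)%nat -> (m * d <= k)%nat -> hA d a (n - m) (k - m * d) <= hA d a n k.
Proof.
  intros Hn Hk. destruct (tw_first d a g N d1 a1 cylg m n k Hn Hk) as [rest E]. unfold hA. rewrite E.
  apply le_INR. rewrite length_app, length_map. apply Nat.le_add_r.
Qed.

Lemma gval_bound : exists gm, 0 <= gm /\ forall n k y, (N <= n)%nat -> In y (gl d a g n k) -> Rabs y <= gm.
Proof.
  destruct (allw_bound (gval g)) as [B [B0 HB]]. exists B. split; auto.
  intros n k y Hn Hy. apply in_map_iff in Hy. destruct Hy as [c [<- Hc]].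
  apply in_tw in Hc. destruct Hc as [L [_ V]]. rewrite <- (firstn_skipn N c) in V |- *.
  apply Forall_app in V. destruct V as [V1 V2].
  assert (LN : length (firstn N c) = N) by (rewrite length_firstn; lia).
  rewrite (gval_app d a g N); auto. lia.
Qed.

(** Induction upwards from depth m1, where the heights are so small that the trivial bound on g - s
    suffices; each level up adds at most one block sum per edge. *)
Lemma oscillation_decay gm K rho M0 m1 n k s D : 0 <= gm -> 0 <= K -> 0 < rho < 1 -> 0 < D ->
  Rabs s <= gm -> (N + m1 <= n)%nat ->
  (forall n k y, (N <= n)%nat -> In y (gl d a g n k) -> Rabs y <= gm) ->
  (forall m i, (M0 <= m)%nat -> (m <= m1)%nat -> (i <= m * d)%nat -> (i <= k)%nat ->
    Rabs (lsum (gl d a g (n - m) (k - i)) - s * hA d a (n - m) (k - i)) <= K * rho ^ m * D) ->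
  (forall i, (i <= m1 * d)%nat -> (i <= k)%nat -> hA d a (n - m1) (k - i) <= K * rho ^ m1 * D) ->
  let C := 2 * gm * K + INR (length (elist d a)) * K / (1 - rho) in
  forall m i, (M0 <= m)%nat -> (m <= m1)%nat -> (i <= m * d)%nat -> (i <= k)%nat ->
  curve_bounded s (gl d a g (n - m) (k - i)) (C * rho ^ m * D).
Proof.
  intros G0 K0 [R0 R1] D0 Hs Hn Hg Hb Hh C.
  set (A := INR (length (elist d a))) in *. assert (A0 : 0 <= A) by apply pos_INR.
  assert (AK : 0 <= A * K / (1 - rho)).
  { apply Rmult_le_pos; [nra|]. left. apply Rinv_0_lt_compat. lra. }
  assert (GK : 0 <= 2 * gm * K) by nra.
  (* C contains the geometric series of the block sums, so that the step from depth m + 1 to m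
     closes. *)
  assert (C1 : C * rho + A * K * rho <= C).
  { assert (E : A * K = A * K / (1 - rho) * (1 - rho)) by (field; lra).
    unfold C. set (Z := A * K / (1 - rho)) in *. rewrite E.
    assert (0 <= 2 * gm * K * (1 - rho)) by (apply Rmult_le_pos; lra).
    assert (0 <= Z * ((1 - rho) * (1 - rho))) by (apply Rmult_le_pos; auto; nra). lra. }
  assert (key : forall j m i, (m + j = m1)%nat -> (M0 <= m)%nat -> (i <= m * d)%nat -> (i <= k)%nat ->
    curve_bounded s (gl d a g (n - m) (k - i)) (C * rho ^ m * D)).
  { induction j as [|j IH]; intros m i Hm HM Hi Hk.
    - rewrite Nat.add_0_r in Hm. subst m.
      assert (Q := curve_bounded_trivial gm s (gl d a g (n - m1) (k - i)) G0 Hs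
        (fun y Hy => Hg (n - m1)%nat (k - i)%nat y ltac:(lia) Hy)).
      intros l Hl. eapply Rle_trans; [apply (Q l Hl)|]. rewrite length_gl.
      specialize (Hh i Hi Hk). unfold hA in Hh.
      assert (P : 0 < rho ^ m1) by (apply pow_lt; auto).
      assert (0 <= A * K / (1 - rho) * (rho ^ m1 * D)) by (apply Rmult_le_pos; auto; nra).
      assert (X : 2 * gm * INR (length (tw d a (n - m1) (k - i))) <= 2 * gm * (K * rho ^ m1 * D))
        by (apply Rmult_le_compat_l; lra).
      replace (C * rho ^ m1 * D) with (2 * gm * (K * rho ^ m1 * D) + A * K / (1 - rho) * (rho ^ m1 * D))
        by (unfold C; ring). lra.
    - destruct (gl_blocks_step d a g N d1 a1 cylg (n - S m) (k - i)) as [bs [E [L B]]]; [lia|].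
      replace (S (n - S m)) with (n - m)%nat in E by lia. rewrite E.
      assert (P : 0 < rho ^ m) by (apply pow_lt; auto).
      assert (P' : 0 < rho ^ S m) by (apply pow_lt; auto).
      assert (v0 : 0 <= K * rho ^ S m * D) by (apply Rmult_le_pos; [nra|lra]).
      assert (C0 : 0 <= C) by (unfold C; lra).
      assert (w0 : 0 <= C * rho ^ S m * D) by (apply Rmult_le_pos; [nra|lra]).
      assert (Q : curve_bounded s (concat bs) (INR (length bs) * (K * rho ^ S m * D) + C * rho ^ S m * D)).
      { apply curve_bounded_concat; auto. intros b Hb'. destruct (B b Hb') as [i' [I1 [I2 ->]]].
        replace (k - i - i')%nat with (k - (i + i'))%nat by lia. split.
        - unfold curve. rewrite psum_len, length_gl. apply Hb; simpl; lia.
        - apply IH; simpl; lia. }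
      intros l Hl. eapply Rle_trans; [apply (Q l Hl)|].
      assert (LA : INR (length bs) <= A) by (apply le_INR; auto).
      assert (X : INR (length bs) * (K * rho ^ S m * D) <= A * (K * rho ^ S m * D))
        by (apply Rmult_le_compat_r; auto).
      assert (Y : (C * rho + A * K * rho) * (rho ^ m * D) <= C * (rho ^ m * D)).
      { apply Rmult_le_compat_r; auto. nra. }
      simpl pow in *. lra. }
  intros m i HM Hm. apply (key (m1 - m)%nat). lia. auto.
Qed.

Let w := t / q.

(* x is the word number pos of its level-n tower, close enough to the start for
   the largest deviation D of the whole tower to be attained later. *)
Record tower_data (Cc rho : R) (M0 : nat) (x : path) (n : nat) (s D : R) (pos : nat) : Prop := {
  td_len : (pos < length (gl d a g n (vtx x n)))%nat;
  td_pos : nth pos (tw d a n (vtx x n)) [] = pre n x;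
  td_D : 0 < D;
  td_end : curve s (gl d a g n (vtx x n)) (length (gl d a g n (vtx x n))) = 0;
  td_att : exists j, (pos <= j <= length (gl d a g n (vtx x n)))%nat /\
     Rabs (curve s (gl d a g n (vtx x n)) j) = D;
  td_start : Rabs (curve s (gl d a g n (vtx x n)) pos) <= D / 8;
  td_osc : forall m i, (M0 <= m)%nat -> (2 * m <= n)%nat -> (i <= m * d)%nat -> (i <= vtx x n)%nat ->
     curve_bounded s (gl d a g (n - m) (vtx x n - i)) (Cc * rho ^ m * D);
  td_rest : hA d a (n - 1) (vtx x n) <= INR (length (gl d a g n (vtx x n)) - pos)
}.

Arguments td_len {_ _ _ _ _ _ _ _}.
Arguments td_pos {_ _ _ _ _ _ _ _}.
Arguments td_D {_ _ _ _ _ _ _ _}.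
Arguments td_end {_ _ _ _ _ _ _ _}.
Arguments td_att {_ _ _ _ _ _ _ _}.
Arguments td_start {_ _ _ _ _ _ _ _}.
Arguments td_osc {_ _ _ _ _ _ _ _}.
Arguments td_rest {_ _ _ _ _ _ _ _}.

Lemma tower_data_exists gm : 0 <= gm ->
  (forall n k y, (N <= n)%nat -> In y (gl d a g n k) -> Rabs y <= gm) ->
  decay_statement d N (/ q) w gm (hA d a) (fun n k => lsum (gl d a g n k)) ->
  exists Cc rho M0 M n0, 0 <= Cc /\ 0 < rho < 1 /\ forall x n, valid_path d a x -> (n0 <= n)%nat ->
    good_vertex (/ q) w (hA d a) n (vtx x n) -> (forall i, (n - M <= i < n)%nat -> x i = (d, O)) ->
    exists s D pos, tower_data Cc rho M0 x n s D pos.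
Proof.
  intros G0 Hg [K [rho [M0 [n0 [K0 [R01 key]]]]]].
  set (Cc := 2 * gm * K + INR (length (elist d a)) * K / (1 - rho)).
  assert (C0 : 0 <= Cc).
  { assert (A0 := pos_INR (length (elist d a))).
    assert (0 <= INR (length (elist d a)) * K / (1 - rho)); [|unfold Cc; nra].
    apply Rmult_le_pos; [nra|]. left. apply Rinv_0_lt_compat. lra. }
  assert (EM : exists M1, Cc * rho ^ M1 <= / 8).
  { destruct (small_pow rho (/ 8 / (Cc + 1)) R01) as [M1 HM].
    - apply Rdiv_lt_0_compat; lra.
    - exists M1. assert (P : 0 < rho ^ M1) by (apply pow_lt; lra).
      apply Rmult_le_compat_l with (r := Cc + 1) in HM; [|lra].
      replace ((Cc + 1) * (/ 8 / (Cc + 1))) with (/ 8) in HM by (field; lra). lra. }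
  (* M0 for the decay to apply, M1 to bring the curve on the first block below D / 8, and one more
     to make M positive, as [td_rest] requires. *)
  destruct EM as [M1 HM1]. set (M := S (M0 + M1)).
  exists Cc, rho, M0, M, (Nat.max n0 (2 * M + 2 * N + 4)). split; auto. split; auto.
  intros x n V Hn Good Last. set (k := vtx x n) in *. set (L := gl d a g n k).
  destruct (first_block_position d a g N d1 a1 cylg M n x V ltac:(lia) Last) as [Mk [pos [rest [Hpos [Epos EL]]]]].
  fold k in Mk, Hpos, Epos, EL. fold L in EL.
  assert (LL : length L = (length (tw d a (n - M) (k - M * d)) + length rest)%nat).
  { rewrite EL, length_app, length_gl. auto. }
  assert (L0 : 0 < INR (length L)) by (apply lt_0_INR; lia).
  (* With the mean subtracted, the curve of the whole tower returns to 0. *)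
  set (s := lsum L / INR (length L)).
  assert (Hs : Rabs s <= gm).
  { unfold s. rewrite Rabs_div_pos; auto. apply Rdiv_le_iff; auto.
    apply lsum_abs_le. intros y. apply Hg. lia. }
  destruct (argmax_nat (fun j => Rabs (curve s L j)) (length L)) as [js [Hjs Max]].
  set (D := Rabs (curve s L js)) in *.
  destruct (key n k s D ltac:(lia) Good Hs) as [MN key2].
  assert (Blk : forall m i, (m <= n - N)%nat -> (i <= m * d)%nat -> (i <= k)%nat ->
    Rabs (lsum (gl d a g (n - m) (k - i)) - s * hA d a (n - m) (k - i)) <= 2 * D).
  { intros m i Hm Hi Hk. destruct (gl_infix d a g N d1 a1 cylg m n k i ltac:(lia) Hi Hk) as [l1 [l2 E]].
    assert (Q := curve_infix s l1 (gl d a g (n - m) (k - i)) l2 D).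
    rewrite <- E in Q. specialize (Q Max). rewrite length_gl in Q. exact Q. }
  destruct key2 as [D0 [Ka Kb]]; [intros i Hi Hk; apply Blk; auto; lia|].
  (* Half the level satisfies both 2 m1 <= n for the block sums and n <= 4 m1 for the heights. *)
  set (m1 := (n / 2)%nat).
  assert (N2 : (2 * m1 <= n)%nat) by (apply Nat.Div0.mul_div_le).
  assert (N4 : (n < 2 * m1 + 2)%nat).
  { assert (Z := Nat.mul_succ_div_gt n 2 ltac:(lia)). fold m1 in Z. lia. }
  assert (Osc := oscillation_decay gm K rho M0 m1 n k s D G0 K0 R01 D0 Hs ltac:(lia) Hg).
  cbv zeta in Osc. fold Cc in Osc.
  assert (Osc' : forall m i, (M0 <= m)%nat -> (m <= m1)%nat -> (i <= m * d)%nat -> (i <= k)%nat ->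
    curve_bounded s (gl d a g (n - m) (k - i)) (Cc * rho ^ m * D)).
  { apply Osc.
    - intros m i Q1 Q2 Q3 Q4. apply Ka; auto. lia.
    - intros i Q1 Q2. apply Kb; auto; lia. }
  clear Osc.
  assert (St : forall j, (j <= length (tw d a (n - M) (k - M * d)))%nat -> Rabs (curve s L j) <= D / 8).
  { intros j Hj. rewrite EL, curve_app1; [|rewrite length_gl; auto].
    assert (HMM : (M0 <= M)%nat) by (unfold M; lia).
    assert (Mm : (M <= m1)%nat) by lia.
    eapply Rle_trans; [apply (Osc' M (M * d)%nat HMM Mm (le_n _) Mk); rewrite length_gl; auto|].
    assert (P : rho ^ M <= rho ^ M1).
    { unfold M. replace (S (M0 + M1)) with (M1 + S M0)%nat by lia. rewrite pow_add.
        assert (0 < rho ^ M1) by (apply pow_lt; lra).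
        assert (rho ^ S M0 <= 1 ^ S M0) by (apply pow_incr; lra). rewrite pow1 in H0. nra. }
    assert (X : Cc * rho ^ M <= / 8) by nra. nra. }
  exists s, D, pos. constructor; fold k; fold L.
  - lia.
  - auto.
  - auto.
  - unfold curve. rewrite psum_len. unfold s. field. lra.
  - exists js. split; [|auto]. split; auto.
    destruct (Nat.le_gt_cases pos js) as [|G]; auto. exfalso.
    assert (X := St js ltac:(lia)). fold D in X. lra.
  - apply St. lia.
  - intros m i Q1 Q2 Q3 Q4. apply Osc'; auto. lia.
  (* The first block lies in the part of the tower entered through an edge of type d; a part entered
     through type 0 is still ahead. *)
  - assert (X1 := hA_lower (n - 1) k ltac:(nia)). replace (S (n - 1)) with n in X1 by lia.
    assert (X2 := hA_first (M - 1) (n - 1) (k - d) ltac:(lia) ltac:(nia)).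
    replace (n - 1 - (M - 1))%nat with (n - M)%nat in X2 by lia.
    replace (k - d - (M - 1) * d)%nat with (k - M * d)%nat in X2 by nia.
    assert (X3 : INR pos <= hA d a (n - M) (k - M * d)) by (apply le_INR; lia).
    rewrite minus_INR; [|lia]. assert (X4 : INR (length L) = hA d a n k) by (unfold L; rewrite length_gl; auto).
    lra.
Qed.

(** As the curve of the tower ends at 0, the deviations along the forward orbit are the rest of that
    curve minus the chord from its value at pos to 0. *)
Lemma node_curve x n s D pos Cc rho M0 l j : (N <= n)%nat -> valid_path d a x ->
  tower_data Cc rho M0 x n s D pos -> l = (length (gl d a g n (vtx x n)) - pos)%nat -> (j <= l)%nat ->
  node T g x l j = curve s (gl d a g n (vtx x n)) (pos + j)
     - (1 - INR j / INR l) * curve s (gl d a g n (vtx x n)) pos.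
Proof.
  intros Hn V TD -> Hj. set (k := vtx x n). set (L := gl d a g n k).
  assert (Hlen := td_len TD). assert (Hend := td_end TD).
  assert (Hp := td_pos TD). fold k in Hlen, Hend, Hp |- *. fold L in Hlen, Hend, Hj |- *.
  set (l := (length L - pos)%nat) in *.
  assert (l0 : 0 < INR l) by (apply lt_0_INR; unfold l; lia).
  assert (SS : forall i, (i <= l)%nat -> Ssum T g x i = psum L (pos + i) - psum L pos).
  { intros i Hi. rewrite <- (sw_pre n x) at 1. rewrite <- Hp.
    apply (Ssum_tower d a g N d1 a1 cylg); auto. fold k. rewrite <- (length_gl d a g). fold L. unfold l in Hi. lia. }
  unfold node. rewrite !SS; auto. unfold curve in *.
  replace (pos + l)%nat with (length L) by (unfold l; lia).
  rewrite plus_INR.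
  assert (EL : INR (length L) = INR pos + INR l) by (rewrite <- plus_INR; f_equal; unfold l; lia).
  replace (psum L (length L)) with (s * (INR pos + INR l)) by (rewrite <- EL; lra).
  field. lra.
Qed.

Theorem limit_curve_ae : ~ cohom_const d a q t g -> ae (fun x => limit_curve_exists T g x).
Proof.
  intros NC. assert (W := w_pos q t q0 t01). fold w in W.
  assert (P0 := p_at_q d a q t d1 q0 qt). fold w in P0.
  destruct gval_bound as [gm [G0 Hg]].
  assert (HD : decay_statement d N (/ q) w gm (hA d a) (fun n k => lsum (gl d a g n k))).
  { rewrite <- P0. apply (@Coefficients.decay d a w d1 a1 W); auto.
    - apply tw_height_array.
    - apply (gl_sum_array d a g N d1 a1 cylg).
    - intros c. apply not_all_ex_not. intros Q. apply NC. apply (cohom_of_balanced c). exact Q. }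
  assert (HR := @Coefficients.ratio d a w d1 a1 W (hA d a) (tw_height_array d a)). rewrite P0 in HR.
  assert (HL := @Coefficients.large d a w d1 a1 W (hA d a) (tw_height_array d a)). rewrite P0 in HL.
  destruct (tower_data_exists gm G0 Hg HD) as [Cc [rho [M0 [M [n0 [C0 [R01 key]]]]]]].
  destruct (HR 1%nat) as [C1 [nr1 [C10 HC1]]].
  assert (AE := ae_and d a q t d1 a1 q0 qa t01 _ _ (ae_eventually_good d a q t d1 a1 q0 qa t01)
    (recurrent_pattern d a q t d1 a1 q0 qa t01 qt (repeat (d, O) (S M))
      ltac:(apply Forall_forall; intros e He; apply repeat_spec in He; subst; split; simpl; auto)
      ltac:(rewrite repeat_length; lia))).
  eapply ae_impl; [|exact AE]. clear AE. intros x V [[n1 Good] Rec].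
  assert (Seq : forall idx : nat, exists u : nat * R * R * nat, let '(n, s, D, pos) := u in
    (idx <= n)%nat /\ (N <= n)%nat /\ good_vertex (/ q) w (hA d a) n (vtx x n) /\
    tower_data Cc rho M0 x n s D pos /\ INR (S idx) <= INR (length (gl d a g n (vtx x n)) - pos)).
  (* [td_rest] and the one-level ratio C1 turn a height of at least C1 (idx + 1) into a remaining
     length of at least idx + 1. *)
  { intros idx. destruct (HL (C1 * INR (S idx))) as [nl Hnl].
    destruct (Rec (S (idx + N + n0 + n1 + nr1 + nl))) as [m [Hm Pm]]. rewrite repeat_length in Pm.
    set (n := (m + S M)%nat).
    assert (Gn : good_vertex (/ q) w (hA d a) n (vtx x n)) by (apply Good; unfold n; lia).
    destruct (key x n V ltac:(unfold n; lia) Gn) as [s [D [pos TD]]].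
    { intros i Hi. replace i with (m + (i - m))%nat by (unfold n in Hi; lia). rewrite Pm; [|unfold n in Hi; lia].
      apply nth_repeat_lt. unfold n in Hi; lia. }
    exists (n, s, D, pos). split; [unfold n; lia|]. split; [unfold n; lia|]. split; auto. split; auto.
    assert (X1 := td_rest TD).
    assert (X2 := Hnl n (vtx x n) ltac:(unfold n; lia) Gn).
    assert (X3 := HC1 n (vtx x n) O ltac:(unfold n; lia) Gn ltac:(lia)). rewrite Nat.sub_0_r in X3.
    apply Rle_trans with (hA d a (n - 1) (vtx x n)); auto.
    apply Rmult_le_reg_l with C1; auto. lra. }
  apply choice in Seq. destruct Seq as [u Hu].
  set (nn := fun i => fst (fst (fst (u i)))). set (ss := fun i => snd (fst (fst (u i)))).
  set (DD := fun i => snd (fst (u i))). set (pp := fun i => snd (u i)).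
  assert (Hu' : forall i, (i <= nn i)%nat /\ (N <= nn i)%nat /\
    good_vertex (/ q) w (hA d a) (nn i) (vtx x (nn i)) /\
    tower_data Cc rho M0 x (nn i) (ss i) (DD i) (pp i) /\
    INR (S i) <= INR (length (gl d a g (nn i) (vtx x (nn i))) - pp i)).
  { intros i. specialize (Hu i). unfold nn, ss, DD, pp. destruct (u i) as [[[n s] D] pos]. exact Hu. }
  clear Hu. set (l := fun i => (length (gl d a g (nn i) (vtx x (nn i))) - pp i)%nat).
  assert (lS : forall i, (S i <= l i)%nat) by (intros i; apply INR_le; apply Hu').
  apply (limit_curve_of_equicontinuous T g x l DD).
  - intros i. specialize (lS i). lia.
  - intros m. exists m. intros n Hn. specialize (lS n). lia.
  - intros i. destruct (Hu' i) as [_ [_ [_ [TD _]]]]. apply (td_D TD).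
  - intros i. destruct (Hu' i) as [_ [Nn [_ [TD _]]]].
    (* The value D is attained after pos, and the chord changes it by at most D / 8. *)
    destruct (td_att TD) as [j [Hj Ej]]. exists (j - pp i)%nat. split; [unfold l; lia|].
    rewrite (node_curve x (nn i) (ss i) (DD i) (pp i) Cc rho M0 (l i)); auto; [|unfold l; lia].
    replace (pp i + (j - pp i))%nat with j by lia.
    assert (St := td_start TD). assert (DP := td_D TD).
    assert (U := ratio_unit (j - pp i) (l i) ltac:(specialize (lS i); lia) ltac:(unfold l; lia)).
    set (c1 := curve _ _ j) in *. set (c2 := curve _ _ (pp i)) in *. set (r := INR (j - pp i) / INR (l i)) in *.
    assert (X : Rabs ((1 - r) * c2) <= DD i / 8).
    { rewrite Rabs_mult, (Rabs_right (1 - r)); [|lra]. assert (Z := Rabs_pos c2). nra. }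
    assert (T1 := Rabs_triang (c1 - (1 - r) * c2) ((1 - r) * c2)).
    replace (c1 - (1 - r) * c2 + (1 - r) * c2) with c1 in T1 by ring. lra.
  - intros eps He.
    assert (EM : exists m, (M0 <= m)%nat /\ 4 * (Cc * rho ^ m) <= eps / 2).
    { destruct (small_pow rho (eps / 8 / (Cc + 1)) R01) as [m Hm].
      - apply Rdiv_lt_0_compat; lra.
      - exists (M0 + m)%nat. split; [lia|].
        assert (P : 0 < rho ^ m) by (apply pow_lt; lra).
        apply Rmult_le_compat_l with (r := Cc + 1) in Hm; [|lra].
        replace ((Cc + 1) * (eps / 8 / (Cc + 1))) with (eps / 8) in Hm by (field; lra).
        assert (Q : rho ^ M0 <= 1 ^ M0) by (apply pow_incr; lra). rewrite pow1 in Q.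
        assert (Q0 : 0 < rho ^ M0) by (apply pow_lt; lra). rewrite pow_add.
        assert (rho ^ M0 * rho ^ m <= rho ^ m) by nra. nra. }
    destruct EM as [m [Hm1 Hm2]]. destruct (HR m) as [Cm [nm [Cm0 HCm]]].
    (* 1 / Cm keeps the increment below the length of every subtower m levels down; eps / 2 controls
       the chord. *)
    exists (Rmin (/ Cm) (eps / 2)), (nm + 2 * m + N)%nat. split.
    { apply Rmin_pos; [apply Rinv_0_lt_compat; auto|lra]. }
    intros i j j' Hi Hj Hj' Hd. destruct (Hu' i) as [Ni [Nn [Gi [TD _]]]].
    assert (L0 : 0 < INR (l i)) by (apply lt_0_INR; specialize (lS i); lia).
    rewrite !(node_curve x (nn i) (ss i) (DD i) (pp i) Cc rho M0 (l i)); auto; [|lia].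
    assert (St := td_start TD). assert (DP := td_D TD).
    assert (Hlen := td_len TD).
    set (k := vtx x (nn i)) in *. set (L := gl d a g (nn i) k) in *.
    assert (D1 : INR (j' - j) <= / Cm * INR (l i)).
    { eapply Rle_trans; [exact Hd|]. apply Rmult_le_compat_r; [lra|apply Rmin_l]. }
    assert (D2 : INR (j' - j) <= eps / 2 * INR (l i)).
    { eapply Rle_trans; [exact Hd|]. apply Rmult_le_compat_r; [lra|apply Rmin_r]. }
    assert (lL : INR (l i) <= hA d a (nn i) k).
    { unfold hA. rewrite <- (length_gl d a g). apply le_INR. unfold l. fold k. fold L. lia. }
    destruct (gl_blocks d a g N d1 a1 cylg m (nn i) k ltac:(lia)) as [bs [Ebs Hbs]].
    fold L in Ebs.
    assert (EQ : Rabs (curve (ss i) L (pp i + j') - curve (ss i) L (pp i + j)) <= 4 * (Cc * rho ^ m * DD i)).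
    { rewrite Ebs. apply curve_concat_equicont with (eta := (j' - j)%nat).
      - apply Rmult_le_pos; [|lra]. apply Rmult_le_pos; [lra|apply pow_le; lra].
      - intros b Hb. destruct (Hbs b Hb) as [i' [I1 [I2 ->]]]. split.
        + apply INR_le. rewrite length_gl. fold (hA d a (nn i - m) (k - i')).
          assert (X := HCm (nn i) k i' ltac:(lia) Gi I1).
          eapply Rle_trans; [exact D1|]. apply Rmult_le_reg_l with Cm; auto.
          rewrite <- Rmult_assoc, Rinv_r; lra.
        + apply (td_osc TD); auto. lia.
      - lia.
      - rewrite <- Ebs. unfold l in Hj'. fold k in Hj'. fold L in Hj'. lia.
      - lia. }
    set (c0 := curve (ss i) L (pp i)) in *.
    set (cj := curve (ss i) L (pp i + j)) in *. set (cj' := curve (ss i) L (pp i + j')) in *.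
    assert (E : cj' - (1 - INR j' / INR (l i)) * c0 - (cj - (1 - INR j / INR (l i)) * c0) =
      (cj' - cj) + INR (j' - j) / INR (l i) * c0).
    { rewrite minus_INR; auto. field. lra. }
    rewrite E. eapply Rle_trans; [apply Rabs_triang|].
    assert (X : Rabs (INR (j' - j) / INR (l i) * c0) <= eps / 2 * DD i).
    { assert (Z : 0 <= INR (j' - j) / INR (l i) <= eps / 2).
      { split; [apply Rmult_le_pos; [apply pos_INR|left; apply Rinv_0_lt_compat; auto]|].
        apply Rdiv_le_iff; lra. }
      rewrite Rabs_mult, (Rabs_right (INR (j' - j) / INR (l i))); [|lra].
      assert (Z0 := Rabs_pos c0). nra. }
    assert (Y : 4 * (Cc * rho ^ m * DD i) <= eps / 2 * DD i).
    { replace (4 * (Cc * rho ^ m * DD i)) with (4 * (Cc * rho ^ m) * DD i) by ring.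
      apply Rmult_le_compat_r; lra. }
    lra.
Qed.
End Main.

Theorem mainTheorem6 (d : nat) (a : nat -> nat) (q t : R) (g : path -> R) (N : nat) :
  (1 <= d)%nat ->
  (forall j, (j <= d)%nat -> (0 < a j)%nat) ->
  0 < q -> q < / INR (a O) ->
  0 < t < 1 ->
  sum_f_R0 (fun j => INR (a j) * q ^ (d - j) * t ^ j) d = q ^ (d - 1) ->
  cylindric d a g N ->
  (~ cohom_const d a q t g ->
     ae d a q t (fun x => limit_curve_exists (Tp d a) g x)) /\
  (cohom_const d a q t g ->
     ae d a q t (fun x => ~ limit_curve_exists (Tp d a) g x)).
Proof.
  intros. split.
  - apply (limit_curve_ae d a q t g N); auto.
  - apply (no_limit_curve d a q t g); auto.
Qed.
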